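(* Let $g, c_1, c_2$ be real parameters with $g\neq 0$, and let $A$ be the self-adjoint operator in $\ell_2$ (with standard orthonormal basis $a_0,a_1,a_2,\dots$) given by the infinite Jacobi matrix $$ A=\begin{pmatrix} c_1&g\sqrt{1}&0&0&0&\cdots\\ g\sqrt{1}&1+c_2&g\sqrt{2}&0&0&\cdots\\ 0&g\sqrt{2}&2+c_1&g\sqrt{3}&0&\cdots\\ 0&0&g\sqrt{3}&3+c_2&g\sqrt{4}&\cdots\\ 0&0&0&g\sqrt{4}&4+c_1&\cdots\\ \vdots&\vdots&\vdots&\vdots&\vdots&\ddots \end{pmatrix}, $$ i.e. $A_{n,n}=n+c_1$ for even $n$, $A_{n,n}=n+c_2$ for odd $n$, $A_{n,n+1}=A_{n+1,n}=g\sqrt{n+1}$ ($n=0,1,2,\dots$), and all other entries zero. Then $A$ has discrete spectrum, and its eigenvalues $\lambda_n(A)$, $n=0,1,2,\dots$, satisfy $$ \lambda_n(A)=n-g^2+\frac{c_1+c_2}{2}+O\!\left(\frac{1}{n^{1/16}}\right),\qquad n\to\infty . $$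
   Context: The Jacobi matrix defines a self-adjoint operator with simple spectrum and domain dense in $\ell_2(\mathbb{N})$. The eigenvalues $\lambda_n(A)$ are enumerated in increasing order starting from $n=0$. *)

(* Defs.v *)
From Stdlib Require Import Reals.
From Coquelicot Require Import Coquelicot.
Open Scope R_scope.

Definition jac_diag (c1 c2 : R) (n : nat) : R :=
  INR n + (if Nat.even n then c1 else c2).

Definition jac_off (g : R) (n : nat) : R := g * sqrt (INR (n + 1)).

Definition jac_apply (g c1 c2 : R) (x : nat -> R) (n : nat) : R :=
  (match n with O => 0 | S m => jac_off g m * x m end)
  + jac_diag c1 c2 n * x n + jac_off g n * x (S n).

Definition l2 (x : nat -> R) : Prop := ex_series (fun n => x n ^ 2).

Definition l2_norm2 (x : nat -> R) : R := Series (fun n => x n ^ 2).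

(* Domain of the self-adjoint operator A (maximal domain of the Jacobi
   matrix, which coincides with the closure of the minimal one). *)
Definition in_dom (g c1 c2 : R) (x : nat -> R) : Prop :=
  l2 x /\ l2 (jac_apply g c1 c2 x).

Definition is_eigenvalue (g c1 c2 mu : R) : Prop :=
  exists x : nat -> R, in_dom g c1 c2 x /\ (exists n, x n <> 0) /\
    forall n, jac_apply g c1 c2 x n = mu * x n.

Definition in_resolvent (g c1 c2 mu : R) : Prop :=
  (forall x, in_dom g c1 c2 x ->
     (forall n, jac_apply g c1 c2 x n = mu * x n) -> forall n, x n = 0) /\
  exists C : R, forall y, l2 y ->
    exists x, in_dom g c1 c2 x /\
      (forall n, jac_apply g c1 c2 x n - mu * x n = y n) /\
      l2_norm2 x <= C * l2_norm2 y.

Definition in_spectrum (g c1 c2 mu : R) : Prop := ~ in_resolvent g c1 c2 mu.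

(* Main.v *)
Require Import Defs.
From Stdlib Require Import Reals Lra Lia Psatz Arith Bool.
From Stdlib Require Import FunctionalExtensionality ProofIrrelevance Classical ClassicalEpsilon.
From Coquelicot Require Import Coquelicot.
Open Scope R_scope.

(** Write [A = A0 + t P] with [A0 = N + g (a + a^* ) + c], [c = (c1 + c2) / 2],
    [t = (c1 - c2) / 2] and [P = (-1)^N].  The shifted ladder operators [a + g]
    and [a^* + g] show that [A0] has exactly the eigenvalues [n - g^2 + c].  Since
    [P A0 P] differs from [A0] by [-2 g (a + a^* )], the matrix [V_mk = <e_m, P e_k>]
    in the eigenbasis of [A0] satisfies in [k] a three-term recurrence close to
    [V_(k+1) = - V_(k-1)] for [k], [m] near [n]; its energy [V_k^2 + V_(k+1)^2] is
    therefore comparable over a window of [W ~ n^(1/4)] indices, and as rows of [V]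
    are unit vectors this gives [V_mk^2 <= C / W].  Expanding the eigenvalue equation
    of [A0 + t P] in the basis [e], an eigenvalue at distance [d <= 1/2] from
    [n - g^2 + c] satisfies [d^4 <= C / W], that is [d = O(n^(-1/16))], uniformly for
    bounded [t].  The index is then fixed by the homotopy from [t = 0]: by min-max the
    [n]-th eigenvalue is Lipschitz in [t], so it cannot leave the interval of radius
    [1/4] around [n - g^2 + c].

    Discreteness of the spectrum and completeness of the eigenvectors use no compact
    operator theory: a sequence of approximate eigenvectors has its mass in finitely
    many coordinates, and there the three-term recurrence makes it converge up to a
    scalar. *)

(** The exponents come from one balance. Near index n the off-diagonal coefficients of the
    recurrence for V have size sqrt n, while the diagonal one is at most a multiple of W inside the
    window. One step therefore changes the energy by a factor 1 + O(W / sqrt n), and W steps change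
    it by a bounded factor as long as W^2 = O(sqrt n). The power d^4 comes from dividing twice by
    the distances |k - x|, where x is the shifted eigenvalue: once to bound P u near n, once to
    recover the coefficients of u from those of P u. Each sum of 1 / |k - x|^2 costs a factor 1 /
    d^2.

    The homotopy uses no continuity of eigenvalues. The parameter t moves in finitely many steps,
    each shifting the n-th eigenvalue by at most 1/4; it thus stays within 1/2 of n - g^2 + c, where
    the localization applies and puts it back within 1/4.

    The sign of g is absorbed by normalizing eigenvectors to a positive coordinate 0; the ladder
    relations then carry |g|. *)

Arguments INR : simpl never.

(** * The Hilbert space l2 *)

Lemma ex_series_bounded (a : nat -> R) (M : R) :
  (forall n, 0 <= a n) -> (forall n, sum_n a n <= M) -> ex_series a.
Proof.
  intros Ha HM.
  destruct (ex_finite_lim_seq_incr (sum_n a) M) as [l Hl]; auto.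
  - intros n. rewrite sum_Sn. unfold plus; simpl. specialize (Ha (S n)). lra.
  - exists l. exact Hl.
Qed.

Lemma sum_n_le_Series (a : nat -> R) (n : nat) :
  (forall n, 0 <= a n) -> ex_series a -> sum_n a n <= Series a.
Proof.
  intros Ha Hex.
  apply (is_lim_seq_incr_compare (sum_n a) (Series a)).
  - apply Series_correct in Hex. exact Hex.
  - intros k. rewrite sum_Sn. unfold plus; simpl. specialize (Ha (S k)). lra.
Qed.

Lemma Series_le_bound (a : nat -> R) (M : R) :
  (forall n, 0 <= a n) -> (forall n, sum_n a n <= M) -> Series a <= M.
Proof.
  intros Ha HM.
  assert (Hex := ex_series_bounded a M Ha HM).
  apply Series_correct in Hex.
  exact (is_lim_seq_le _ _ (Finite (Series a)) (Finite M) HM Hex (is_lim_seq_const M)).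
Qed.

Lemma Series_nonneg (a : nat -> R) :
  (forall n, 0 <= a n) -> ex_series a -> 0 <= Series a.
Proof.
  intros Ha Hex. apply Rle_trans with (sum_n a 0).
  - rewrite sum_O. apply Ha.
  - now apply sum_n_le_Series.
Qed.

Lemma l2_le (x y : nat -> R) :
  (forall n, x n ^ 2 <= y n) -> ex_series y -> l2 x.
Proof.
  intros H Hy. unfold l2.
  apply (ex_series_le (V := R_CompleteNormedModule)) with (b := y); auto.
  intros n. change (Rabs (x n ^ 2) <= y n).
  rewrite Rabs_pos_eq by apply pow2_ge_0. apply H.
Qed.

Lemma l2_add (x y : nat -> R) : l2 x -> l2 y -> l2 (fun n => x n + y n).
Proof.
  intros Hx Hy.
  apply l2_le with (y := fun n => 2 * (x n ^ 2 + y n ^ 2)).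
  - intros n. assert (H := pow2_ge_0 (x n - y n)). lra.
  - apply (ex_series_scal_l 2 (fun n => x n ^ 2 + y n ^ 2)).
    apply (ex_series_plus (fun n => x n ^ 2) (fun n => y n ^ 2)); auto.
Qed.

Lemma l2_scal (a : R) (x : nat -> R) : l2 x -> l2 (fun n => a * x n).
Proof.
  intros Hx. apply l2_le with (y := fun n => a ^ 2 * x n ^ 2).
  - intros n. apply Req_le. ring.
  - apply (ex_series_scal_l (a ^ 2) (fun n => x n ^ 2)); auto.
Qed.

Lemma l2_ext (x y : nat -> R) : (forall n, x n = y n) -> l2 x -> l2 y.
Proof.
  intros H Hx. apply ex_series_ext with (2 := Hx). intros n. now rewrite H.
Qed.

Lemma l2_0 : l2 (fun _ => 0).
Proof.
  exists 0. change (is_lim_seq (sum_n (fun _ : nat => 0 ^ 2)) 0).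
  apply is_lim_seq_ext with (u := fun _ => 0).
  - intros n. induction n as [|n IH].
    + rewrite sum_O; lra.
    + rewrite sum_Sn, <- IH. unfold plus; simpl; ring.
  - apply is_lim_seq_const.
Qed.

Lemma ex_series_mul (x y : nat -> R) : l2 x -> l2 y -> ex_series (fun n => x n * y n).
Proof.
  intros Hx Hy.
  apply (ex_series_le (V := R_CompleteNormedModule)) with (b := fun n => x n ^ 2 + y n ^ 2).
  - intros n. change (Rabs (x n * y n) <= x n ^ 2 + y n ^ 2). apply Rabs_le. nra.
  - apply (ex_series_plus (fun n => x n ^ 2) (fun n => y n ^ 2)); auto.
Qed.

Record ell2 := mk_ell2 { coord :> nat -> R; ell2_prop : l2 coord }.

(** Makes equality of vectors Leibniz equality, so that vector identities can be rewritten and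
    [hext] reduces them to [ring] on coordinates. *)
Lemma ell2_ext (x y : ell2) : (forall n, x n = y n) -> x = y.
Proof.
  destruct x as [x Hx], y as [y Hy]; simpl; intros H.
  assert (x = y) by (now apply functional_extensionality). subst y.
  f_equal. apply proof_irrelevance.
Qed.

Definition hzero : ell2 := mk_ell2 _ l2_0.
Definition hadd (x y : ell2) : ell2 := mk_ell2 _ (l2_add x y (ell2_prop x) (ell2_prop y)).
Definition hscal (a : R) (x : ell2) : ell2 := mk_ell2 _ (l2_scal a x (ell2_prop x)).
Definition hsub (x y : ell2) : ell2 := hadd x (hscal (-1) y).

Definition ip (x y : ell2) : R := Series (fun n => x n * y n).
Definition hnorm (x : ell2) : R := sqrt (ip x x).

Ltac hext := apply ell2_ext; intros ?; simpl; ring.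

Lemma ip_sym x y : ip x y = ip y x.
Proof. apply Series_ext. intros n. ring. Qed.

Lemma ip_ex (x y : ell2) : ex_series (fun n => x n * y n).
Proof. apply ex_series_mul; apply ell2_prop. Qed.

Lemma ip_add_l x y z : ip (hadd x y) z = ip x z + ip y z.
Proof.
  unfold ip. rewrite <- Series_plus by apply ip_ex.
  apply Series_ext. intros n. simpl. ring.
Qed.

Lemma ip_scal_l a x z : ip (hscal a x) z = a * ip x z.
Proof.
  unfold ip. rewrite <- Series_scal_l.
  apply Series_ext. intros n. simpl. ring.
Qed.

Lemma ip_add_r x y z : ip z (hadd x y) = ip z x + ip z y.
Proof. rewrite ip_sym, ip_add_l, (ip_sym x), (ip_sym y). ring. Qed.

Lemma ip_scal_r a x z : ip z (hscal a x) = a * ip z x.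
Proof. rewrite ip_sym, ip_scal_l, (ip_sym x). ring. Qed.

Lemma ip_sub_l x y z : ip (hsub x y) z = ip x z - ip y z.
Proof. unfold hsub. rewrite ip_add_l, ip_scal_l. ring. Qed.

Lemma ip_sub_r x y z : ip z (hsub x y) = ip z x - ip z y.
Proof. unfold hsub. rewrite ip_add_r, ip_scal_r. ring. Qed.

Lemma ip_zero_l z : ip hzero z = 0.
Proof. replace hzero with (hscal 0 z) by hext. rewrite ip_scal_l. ring. Qed.

Hint Rewrite ip_add_l ip_add_r ip_scal_l ip_scal_r ip_sub_l ip_sub_r ip_zero_l : ip.

Lemma l2_norm2_ip (x : ell2) : l2_norm2 x = ip x x.
Proof. apply Series_ext. intros n. ring. Qed.

Lemma partial_le_ip (x : ell2) n : sum_n (fun k => x k ^ 2) n <= ip x x.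
Proof.
  rewrite <- l2_norm2_ip. apply sum_n_le_Series.
  - intros; nra.
  - apply ell2_prop.
Qed.

Lemma ip_le_bound (x : ell2) M : (forall n, sum_n (fun k => x k ^ 2) n <= M) -> ip x x <= M.
Proof.
  intros H. rewrite <- l2_norm2_ip. apply Series_le_bound; auto. intros; nra.
Qed.

Lemma sum_n_nonneg (a : nat -> R) n : (forall k, 0 <= a k) -> 0 <= sum_n a n.
Proof.
  intros Ha. induction n as [|n IH].
  - rewrite sum_O. apply Ha.
  - rewrite sum_Sn. unfold plus; simpl. specialize (Ha (S n)). lra.
Qed.

Lemma ip_pos x : 0 <= ip x x.
Proof. rewrite <- l2_norm2_ip. apply Series_nonneg; [intros; nra | apply ell2_prop]. Qed.

Lemma sum_n_ge_term (a : nat -> R) k n : (forall k, 0 <= a k) -> (k <= n)%nat -> a k <= sum_n a n.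
Proof.
  intros Ha Hk. induction n as [|n IH].
  - replace k with 0%nat by lia. rewrite sum_O. lra.
  - rewrite sum_Sn. unfold plus; simpl.
    destruct (Nat.eq_dec k (S n)) as [->|Hne].
    + assert (H := sum_n_nonneg a n Ha). lra.
    + assert (a k <= sum_n a n) by (apply IH; lia). specialize (Ha (S n)). lra.
Qed.

Lemma coord_sqr_le (x : ell2) n : x n ^ 2 <= ip x x.
Proof.
  apply Rle_trans with (2 := partial_le_ip x n).
  apply (sum_n_ge_term (fun k => x k ^ 2)); auto. intros; nra.
Qed.

Lemma ip_eq0 x : ip x x = 0 -> x = hzero.
Proof.
  intros H. apply ell2_ext. intros n. simpl.
  assert (H1 := coord_sqr_le x n). nra.
Qed.

Lemma cauchy_schwarz x y : ip x y ^ 2 <= ip x x * ip y y.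
Proof.
  assert (Hq : forall a b, 0 <= a * a * ip x x + 2 * a * b * ip x y + b * b * ip y y).
  { intros a b. assert (H := ip_pos (hadd (hscal a x) (hscal b y))).
    autorewrite with ip in H. rewrite (ip_sym y x) in H. nra. }
  assert (Hx := ip_pos x). assert (Hy := ip_pos y).
  destruct (Req_dec (ip x x) 0) as [H0|H0].
  - apply ip_eq0 in H0. subst x. rewrite !ip_zero_l. nra.
  (* This choice turns the quadratic form into [ip x x] times the Gram determinant of [x] and
     [y]. *)
  - assert (H := Hq (ip x y) (- ip x x)).
    assert (0 < ip x x) by lra.
    assert (0 <= ip x x * (ip x x * ip y y - ip x y ^ 2)) by nra.
    apply Rnot_lt_le. intros Hlt. nra.
Qed.

Lemma hnorm_pos x : 0 <= hnorm x.
Proof. apply sqrt_pos. Qed.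

Lemma hnorm_sqr x : hnorm x ^ 2 = ip x x.
Proof. unfold hnorm. rewrite pow2_sqrt; auto. apply ip_pos. Qed.

Lemma hnorm_eq0 x : hnorm x = 0 -> x = hzero.
Proof. intros H. apply ip_eq0. rewrite <- hnorm_sqr, H. ring. Qed.

Lemma hnorm_le_sqr x M : 0 <= M -> ip x x <= M ^ 2 -> hnorm x <= M.
Proof.
  intros HM H. unfold hnorm. rewrite <- (sqrt_pow2 M HM). now apply sqrt_le_1_alt.
Qed.

Lemma ip_le_hnorm x y : Rabs (ip x y) <= hnorm x * hnorm y.
Proof.
  unfold hnorm. rewrite <- sqrt_mult by apply ip_pos.
  rewrite <- sqrt_Rsqr_abs. apply sqrt_le_1_alt.
  assert (H := cauchy_schwarz x y). unfold Rsqr. lra.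
Qed.

Lemma hnorm_triangle x y : hnorm (hadd x y) <= hnorm x + hnorm y.
Proof.
  assert (Hx := hnorm_pos x). assert (Hy := hnorm_pos y).
  apply hnorm_le_sqr; [lra|]. autorewrite with ip. rewrite (ip_sym y x).
  assert (H := ip_le_hnorm x y). apply Rabs_le_between in H.
  rewrite <- (hnorm_sqr x), <- (hnorm_sqr y). nra.
Qed.

Lemma hnorm_scal a x : hnorm (hscal a x) = Rabs a * hnorm x.
Proof.
  unfold hnorm. autorewrite with ip.
  rewrite <- Rmult_assoc, sqrt_mult; [| nra | apply ip_pos].
  f_equal. apply sqrt_Rsqr_abs.
Qed.

Lemma coord_le_hnorm (x : ell2) n : Rabs (x n) <= hnorm x.
Proof.
  unfold hnorm. rewrite <- sqrt_Rsqr_abs. apply sqrt_le_1_alt.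
  assert (H := coord_sqr_le x n). unfold Rsqr. lra.
Qed.

(** * Norm convergence and completeness of l2 *)

Definition hcv (u : nat -> ell2) (x : ell2) : Prop :=
  is_lim_seq (fun n => hnorm (hsub (u n) x)) 0.

Definition hcauchy (u : nat -> ell2) : Prop :=
  forall eps, 0 < eps -> exists N, forall n m, (N <= n)%nat -> (N <= m)%nat ->
    hnorm (hsub (u n) (u m)) <= eps.

Lemma hcv_coord u x k : hcv u x -> is_lim_seq (fun n => u n k) (x k).
Proof.
  intros H. apply is_lim_seq_ext with (u := fun n => (u n k - x k) + x k).
  { intros n. ring. }
  replace (Finite (x k)) with (Rbar_plus 0 (x k)) by (simpl; f_equal; ring).
  apply is_lim_seq_plus with (l1 := 0) (l2 := x k).
  - apply is_lim_seq_abs_0.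
    apply is_lim_seq_le_le with (u := fun _ => 0) (w := fun n => hnorm (hsub (u n) x)); auto.
    + intros n. split; [apply Rabs_pos|].
      replace (u n k - x k) with (hsub (u n) x k) by (simpl; ring).
      apply coord_le_hnorm.
    + apply is_lim_seq_const.
  - apply is_lim_seq_const.
  - unfold is_Rbar_plus; simpl. f_equal.
Qed.

Lemma hcv_ip u x y : hcv u x -> is_lim_seq (fun n => ip (u n) y) (ip x y).
Proof.
  intros H. apply is_lim_seq_ext with (u := fun n => ip (hsub (u n) x) y + ip x y).
  { intros n. rewrite ip_sub_l. ring. }
  replace (Finite (ip x y)) with (Rbar_plus 0 (ip x y)) by (simpl; f_equal; ring).
  apply is_lim_seq_plus with (l1 := 0) (l2 := ip x y).
  - apply is_lim_seq_abs_0.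
    apply is_lim_seq_le_le with (u := fun _ => 0) (w := fun n => hnorm (hsub (u n) x) * hnorm y); auto.
    + intros n. split; [apply Rabs_pos|]. apply ip_le_hnorm.
    + apply is_lim_seq_const.
    + replace (Finite 0) with (Rbar_mult 0 (hnorm y)) by (simpl; f_equal; ring).
      apply is_lim_seq_scal_r. exact H.
  - apply is_lim_seq_const.
  - unfold is_Rbar_plus; simpl. f_equal.
Qed.

(** The coordinatewise limit is the candidate. The Cauchy bound passes to the limit in every partial
    sum ([Hfat], a Fatou argument), which gives both membership in l2 and convergence in norm. *)
Lemma ell2_complete u : hcauchy u -> exists x, hcv u x.
Proof.
  intros Hu.
  assert (Hk : forall k, ex_finite_lim_seq (fun n => u n k)).
  { intros k. apply ex_lim_seq_cauchy_corr. intros eps.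
    destruct (Hu (eps / 2)) as [N HN]. { destruct eps; simpl; lra. }
    exists N. intros n m Hn Hm.
    apply Rle_lt_trans with (eps / 2).
    - replace (u n k - u m k) with (hsub (u n) (u m) k) by (simpl; ring).
      apply Rle_trans with (1 := coord_le_hnorm _ _). now apply HN.
    - destruct eps; simpl; lra. }
  set (x := fun k => real (Lim_seq (fun n => u n k))).
  assert (Hx : forall k, is_lim_seq (fun n => u n k) (x k)).
  { intros k. apply Lim_seq_correct'. apply Hk. }
  assert (Hfat : forall eps, 0 < eps -> exists N, forall n K, (N <= n)%nat ->
    sum_n (fun k => (u n k - x k) ^ 2) K <= eps ^ 2).
  { intros eps He. destruct (Hu eps He) as [N HN]. exists N. intros n K Hn.
    assert (Hl : is_lim_seq (fun m => sum_n (fun k => (u n k - u m k) ^ 2) K)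
       (sum_n (fun k => (u n k - x k) ^ 2) K)).
    { assert (Hd : forall k, is_lim_seq (fun m => (u n k - u m k) ^ 2) ((u n k - x k) ^ 2)).
      { intros k.
        assert (H1 : is_lim_seq (fun m => u n k - u m k) (u n k - x k)).
        { apply is_lim_seq_minus'; [apply is_lim_seq_const | apply Hx]. }
        apply is_lim_seq_ext with (u := fun m => (u n k - u m k) * (u n k - u m k)).
        { intros; ring. }
        replace ((u n k - x k) ^ 2) with ((u n k - x k) * (u n k - x k)) by ring.
        now apply is_lim_seq_mult'. }
      induction K as [|K IH].
      - rewrite sum_O. apply is_lim_seq_ext with (2 := Hd 0%nat).
        intros m. now rewrite sum_O.
      - rewrite sum_Sn. eapply is_lim_seq_ext.
        { intros m. symmetry. apply sum_Sn. }
        apply is_lim_seq_plus'; auto. }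
    apply (is_lim_seq_le_loc _ (fun _ => eps ^ 2) _ _) with (2 := Hl) (3 := is_lim_seq_const _).
    exists N. intros m Hm.
    apply Rle_trans with (ip (hsub (u n) (u m)) (hsub (u n) (u m))).
    - apply Rle_trans with (2 := partial_le_ip _ K).
      apply Req_le. apply sum_n_ext. intros k. simpl. ring.
    - rewrite <- hnorm_sqr. apply pow_incr. split; [apply hnorm_pos | now apply HN]. }
  assert (Hl2 : l2 x).
  { destruct (Hfat 1 Rlt_0_1) as [N HN].
    assert (Hd : l2 (fun k => u N k - x k)).
    { apply ex_series_bounded with (M := 1 ^ 2); [intros; apply pow2_ge_0|]. intros K. now apply HN. }
    apply l2_ext with (x := fun k => u N k + (-1) * (u N k - x k)). { intros; ring. }
    apply l2_add; [apply ell2_prop | now apply l2_scal]. }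
  exists (mk_ell2 x Hl2).
  apply is_lim_seq_spec. intros eps.
  assert (He : 0 < eps / 2) by (destruct eps; simpl; lra).
  destruct (Hfat (eps / 2) He) as [N HN]. exists N. intros n Hn.
  rewrite Rminus_0_r, Rabs_pos_eq by apply hnorm_pos.
  apply Rle_lt_trans with (eps / 2); [|destruct eps; simpl in *; lra].
  apply hnorm_le_sqr; [lra|]. apply ip_le_bound. intros K.
  apply Rle_trans with (2 := HN n K Hn).
  apply Req_le. apply sum_n_ext. intros k. simpl. ring.
Qed.

(** * The graph of the Jacobi operator *)

Lemma sum_n_le (a b : nat -> R) n : (forall k, (k <= n)%nat -> a k <= b k) -> sum_n a n <= sum_n b n.
Proof.
  intros H. induction n as [|n IH].
  - rewrite !sum_O. apply H. lia.
  - rewrite !sum_Sn. apply Rplus_le_compat; [apply IH; intros; apply H; lia | apply H; lia].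
Qed.

Lemma sum_n_add (a b : nat -> R) n : sum_n (fun k => a k + b k) n = sum_n a n + sum_n b n.
Proof. exact (sum_n_plus a b n). Qed.

Lemma sum_n_scal (c : R) (a : nat -> R) n : sum_n (fun k => c * a k) n = c * sum_n a n.
Proof. exact (sum_n_mult_l c a n). Qed.

Lemma sum_n_S (a : nat -> R) n : sum_n a (S n) = sum_n a n + a (S n).
Proof. exact (sum_Sn a n). Qed.

Lemma sum_n_0 (a : nat -> R) : sum_n a 0 = a 0%nat.
Proof. exact (sum_O a). Qed.

Lemma sum_n_shift (a : nat -> R) n : a 0%nat + sum_n (fun k => a (S k)) n = sum_n a (S n).
Proof.
  induction n as [|n IH].
  - rewrite sum_n_S, !sum_n_0. ring.
  - rewrite (sum_n_S _ (S n)), <- IH, sum_n_S. ring.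
Qed.

(** Common source of the norm bounds for tridiagonal operators: it serves the weighted norm of
    domain vectors, the ladder operators and the Neumann series. The slot [y] holds a right-hand
    side and is [hzero] where there is none. *)
Lemma three_term_sum (K : R) (z : nat -> R) (x y : ell2) n :
  (forall n, Rabs (z n) <= K * (Rabs (y n) + Rabs (x (pred n)) + Rabs (x n) + Rabs (x (S n)))) ->
  sum_n (fun k => z k ^ 2) n <= 4 * K ^ 2 * (ip y y + 4 * ip x x).
Proof.
  intros H.
  apply Rle_trans with (sum_n (fun k => 4 * K ^ 2 * (y k ^ 2 + (x (pred k) ^ 2 + (x k ^ 2 + x (S k) ^ 2)))) n).
  - apply sum_n_le. intros k _.
    rewrite <- (pow2_abs (z k)), <- (pow2_abs (y k)), <- (pow2_abs (x (pred k))),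
      <- (pow2_abs (x k)), <- (pow2_abs (x (S k))).
    specialize (H k). assert (H0 := Rabs_pos (z k)). revert H H0.
    generalize (Rabs (z k)) (Rabs (y k)) (Rabs (x (pred k))) (Rabs (x k)) (Rabs (x (S k))).
    intros Z a b c d H H0.
    apply Rle_trans with ((K * (a + b + c + d)) ^ 2).
    + apply pow_incr. lra.
    + rewrite Rpow_mult_distr.
      assert ((a + b + c + d) ^ 2 <= 4 * (a ^ 2 + (b ^ 2 + (c ^ 2 + d ^ 2)))).
      { assert (H1 := pow2_ge_0 (a - b)). assert (H2 := pow2_ge_0 (a - c)).
        assert (H3 := pow2_ge_0 (a - d)). assert (H4 := pow2_ge_0 (b - c)).
        assert (H5 := pow2_ge_0 (b - d)). assert (H6 := pow2_ge_0 (c - d)). lra. }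
      assert (HK := pow2_ge_0 K). nra.
  - rewrite sum_n_scal, !sum_n_add.
    apply Rmult_le_compat_l. { assert (HK := pow2_ge_0 K). lra. }
    assert (Hy := partial_le_ip y n). assert (Hx := partial_le_ip x n).
    assert (H1 : sum_n (fun k => x (S k) ^ 2) n <= ip x x).
    { apply Rle_trans with (2 := partial_le_ip x (S n)).
      rewrite <- (sum_n_shift (fun k => x k ^ 2)). assert (H0 := pow2_ge_0 (x 0%nat)). lra. }
    (* Since [pred 0 = 0], coordinate 0 is counted twice; hence 2 here, and 2 + 1 + 1 = 4 in the
       statement. *)
    assert (H2 : sum_n (fun k => x (pred k) ^ 2) n <= 2 * ip x x).
    { apply Rle_trans with (x 0%nat ^ 2 + sum_n (fun k => x k ^ 2) n).
      - destruct n as [|n].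
        + rewrite !sum_n_0. simpl pred. assert (H0 := pow2_ge_0 (x 0%nat)). lra.
        + rewrite <- (sum_n_shift (fun k => x (pred k) ^ 2)). simpl pred.
          rewrite sum_n_S. assert (H0 := pow2_ge_0 (x (S n))). lra.
      - assert (H0 := coord_sqr_le x 0). lra. }
    lra.
Qed.

Lemma three_term_l2 (K : R) (z : nat -> R) (x y : ell2) :
  (forall n, Rabs (z n) <= K * (Rabs (y n) + Rabs (x (pred n)) + Rabs (x n) + Rabs (x (S n)))) ->
  l2 z.
Proof.
  intros H. apply ex_series_bounded with (M := 4 * K ^ 2 * (ip y y + 4 * ip x x)).
  - intros n. apply pow2_ge_0.
  - intros n. now apply three_term_sum.
Qed.

(** * Ladder operators and the domain of the Jacobi operator *)

(** [lower] and [raise] are the annihilation operator a and the creation operator a^* in the number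
    basis, acting on arbitrary sequences. *)
Definition lower (x : nat -> R) (n : nat) : R := sqrt (INR (S n)) * x (S n).
Definition raise (x : nat -> R) (n : nat) : R :=
  match n with O => 0 | S m => sqrt (INR (S m)) * x m end.

Lemma jac_apply_lr g c1 c2 x n :
  jac_apply g c1 c2 x n = g * raise x n + jac_diag c1 c2 n * x n + g * lower x n.
Proof.
  unfold jac_apply, raise, lower, jac_off. destruct n as [|m]; rewrite ?Nat.add_1_r; ring.
Qed.

Lemma jac_diag_le c1 c2 n : Rabs (jac_diag c1 c2 n - INR n) <= Rabs c1 + Rabs c2.
Proof.
  unfold jac_diag. assert (H1 := Rabs_pos c1). assert (H2 := Rabs_pos c2).
  destruct (Nat.even n).
  - replace (INR n + c1 - INR n) with c1 by ring. lra.
  - replace (INR n + c2 - INR n) with c2 by ring. lra.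
Qed.

(** The domain of the square root of the number operator N, on which a and a^* map into l2. *)
Definition wl2 (x : nat -> R) : Prop := l2 (fun n => sqrt (INR n) * x n).

Lemma sqrt_succ_le n : sqrt (INR (S n)) <= sqrt (INR n) + 1.
Proof.
  assert (H := pos_INR n). assert (Hs := sqrt_pos (INR n)).
  rewrite <- (sqrt_pow2 (sqrt (INR n) + 1)) by lra.
  apply sqrt_le_1_alt. rewrite S_INR.
  assert (H1 := sqrt_sqrt _ H). nra.
Qed.

Lemma lower_l2 x : wl2 x -> l2 (lower x).
Proof.
  intros H. apply (three_term_l2 1) with (x := mk_ell2 _ H) (y := hzero). intros n. simpl coord.
  unfold lower.
  assert (H1 := Rabs_pos (sqrt (INR (pred n)) * x (pred n))).
  assert (H2 := Rabs_pos (sqrt (INR n) * x n)). rewrite Rabs_R0. lra.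
Qed.

(** [raise x] is the shift of the weighted sequence plus a correction with factors sqrt (m + 1) -
    sqrt m, which lie between 0 and 1. *)
Lemma raise_l2 (x : ell2) : wl2 x -> l2 (raise x).
Proof.
  intros H. set (w := mk_ell2 _ H).
  apply l2_ext with (x := fun n => match n with O => 0 | S m => w m end
     + match n with O => 0 | S m => (sqrt (INR (S m)) - sqrt (INR m)) * x m end).
  { intros [|n]; simpl; ring. }
  apply l2_add.
  - apply (three_term_l2 1) with (x := w) (y := hzero). intros n.
    assert (H1 := Rabs_pos (w n)). assert (H2 := Rabs_pos (w (S n))).
    simpl hzero. simpl (coord hzero n). rewrite Rabs_R0.
    destruct n as [|n]; simpl pred; rewrite ?Rabs_R0.
    + assert (H3 := Rabs_pos (w 0%nat)). lra.
    + lra.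
  - apply (three_term_l2 1) with (x := x) (y := hzero). intros n.
    assert (H1 := Rabs_pos (x n)). assert (H2 := Rabs_pos (x (S n))).
    simpl (coord hzero n). rewrite Rabs_R0.
    destruct n as [|n]; simpl pred; rewrite ?Rabs_R0.
    + lra.
    + rewrite Rabs_mult. assert (H3 := sqrt_succ_le n).
      assert (H4 : sqrt (INR n) <= sqrt (INR (S n))).
      { apply sqrt_le_1_alt. rewrite S_INR. lra. }
      rewrite (Rabs_pos_eq (_ - _)) by lra. assert (H5 := Rabs_pos (x n)). nra.
Qed.

Lemma lower_raise_adj (x y : ell2) : wl2 x -> wl2 y ->
  Series (fun n => lower x n * y n) = Series (fun n => x n * raise y n).
Proof.
  intros Hx Hy.
  rewrite (Series_incr_1 (fun n => x n * raise y n)).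
  - simpl raise at 1. rewrite Rmult_0_r, Rplus_0_l. apply Series_ext.
    intros n. unfold lower, raise. ring.
  - apply ex_series_mul; [apply ell2_prop | now apply raise_l2].
Qed.

(* The graph of the operator on its maximal domain: [gr x y] says that [x] is in the domain and [A x = y]. *)
Definition gr (g c1 c2 : R) (x y : ell2) : Prop := forall n, jac_apply g c1 c2 x n = y n.

Lemma gr_add g c1 c2 x y x' y' :
  gr g c1 c2 x y -> gr g c1 c2 x' y' -> gr g c1 c2 (hadd x x') (hadd y y').
Proof.
  intros H H' n. simpl coord. rewrite <- (H n), <- (H' n), !jac_apply_lr.
  unfold raise, lower. destruct n; simpl coord; ring.
Qed.

Lemma gr_scal g c1 c2 a x y : gr g c1 c2 x y -> gr g c1 c2 (hscal a x) (hscal a y).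
Proof.
  intros H n. simpl coord. rewrite <- (H n), !jac_apply_lr.
  unfold raise, lower. destruct n; simpl coord; ring.
Qed.

Lemma gr_sub g c1 c2 x y x' y' :
  gr g c1 c2 x y -> gr g c1 c2 x' y' -> gr g c1 c2 (hsub x x') (hsub y y').
Proof. intros H H'. apply gr_add; [assumption | now apply gr_scal]. Qed.

Definition wbound (g c1 c2 : R) : R := 1 + Rabs c1 + Rabs c2 + 2 * Rabs g.

Lemma wbound_ge1 g c1 c2 : 1 <= wbound g c1 c2.
Proof.
  unfold wbound. assert (H1 := Rabs_pos c1). assert (H2 := Rabs_pos c2). assert (H3 := Rabs_pos g). lra.
Qed.

(** Row n solved for n x_n leaves off-diagonal terms of size sqrt n only, so division by sqrt n
    gives a three-term bound for sqrt n x_n. The 2 |g| in [wbound] covers sqrt (n + 1) <= 2 sqrt n;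
    row 0 has weight 0. *)
Lemma gr_weight_pointwise g c1 c2 x y : gr g c1 c2 x y ->
  forall n, Rabs (sqrt (INR n) * x n) <=
    wbound g c1 c2 * (Rabs (y n) + Rabs (x (pred n)) + Rabs (x n) + Rabs (x (S n))).
Proof.
  intros H n. assert (HK := wbound_ge1 g c1 c2).
  assert (H1 := Rabs_pos (y n)). assert (H2 := Rabs_pos (x (pred n))).
  assert (H3 := Rabs_pos (x n)). assert (H4 := Rabs_pos (x (S n))).
  assert (Hg := Rabs_pos g).
  destruct n as [|m].
  - rewrite INR_0, sqrt_0, Rmult_0_l, Rabs_R0. nra.
  - specialize (H (S m)). rewrite jac_apply_lr in H. unfold raise, lower in H. simpl pred in *.
    set (n := S m) in *.
    assert (Hn : 1 <= INR n) by (unfold n; rewrite S_INR; assert (Hm := pos_INR m); lra).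
    set (s := sqrt (INR n)) in *.
    assert (Hs : s * s = INR n) by (apply sqrt_sqrt; lra).
    assert (Hs0 : 0 <= s) by apply sqrt_pos.
    assert (Hs1 : 1 <= s) by nra.
    assert (Hss := sqrt_succ_le n). fold s in Hss.
    assert (Hss0 := sqrt_pos (INR (S n))).
    assert (Hd := jac_diag_le c1 c2 n).
    set (d := jac_diag c1 c2 n) in *.
    assert (He : s * (s * x n) = y n - g * (s * x m) - (d - INR n) * x n - g * (sqrt (INR (S n)) * x (S n))).
    { rewrite <- H, <- Rmult_assoc, Hs. ring. }
    assert (Hb : Rabs (s * (s * x n)) <= Rabs (y n) + Rabs g * (s * Rabs (x m))
       + (Rabs c1 + Rabs c2) * Rabs (x n) + Rabs g * (2 * s * Rabs (x (S n)))).
    { rewrite He.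
      apply Rle_trans with (Rabs (y n) + Rabs (g * (s * x m)) + Rabs ((d - INR n) * x n) + Rabs (g * (sqrt (INR (S n)) * x (S n)))).
      - unfold Rminus. rewrite <- (Rabs_Ropp (g * (s * x m))), <- (Rabs_Ropp ((d + - INR n) * x n)),
          <- (Rabs_Ropp (g * (sqrt (INR (S n)) * x (S n)))).
        eapply Rle_trans; [apply Rabs_triang|]. apply Rplus_le_compat_r.
        eapply Rle_trans; [apply Rabs_triang|]. apply Rplus_le_compat_r.
        apply Rabs_triang.
      - rewrite !Rabs_mult, (Rabs_pos_eq s), (Rabs_pos_eq (sqrt _)) by assumption.
        apply Rplus_le_compat; [apply Rplus_le_compat|].
        + lra.
        + apply Rmult_le_compat_r; [apply Rabs_pos | exact Hd].
        + apply Rmult_le_compat_l; [exact Hg|]. apply Rmult_le_compat_r; [apply Rabs_pos|]. lra. }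
    rewrite Rabs_mult, (Rabs_pos_eq s) in Hb by assumption.
    apply Rmult_le_reg_l with s; [lra|].
    apply Rle_trans with (1 := Hb). unfold wbound.
    assert (Hc1 := Rabs_pos c1). assert (Hc2 := Rabs_pos c2).
    generalize dependent (Rabs (y n)). generalize dependent (Rabs (x n)).
    generalize dependent (Rabs (x m)). generalize dependent (Rabs (x (S n))). clear - Hs1 Hg Hc1 Hc2.
    intros a Ha b Hb c Hc d Hd _.
    generalize dependent (Rabs g). generalize dependent (Rabs c1). generalize dependent (Rabs c2).
    intros k2 Hk2 k1 Hk1 G HG.
    assert (d <= s * d) by nra.
    assert ((k1 + k2) * c <= s * ((k1 + k2) * c)).
    { assert (0 <= (k1 + k2) * c) by (apply Rmult_le_pos; lra). nra. }
    assert (0 <= s * (G * a)) by (apply Rmult_le_pos; [lra | apply Rmult_le_pos; lra]).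
    assert (0 <= s * (G * b)) by (apply Rmult_le_pos; [lra | apply Rmult_le_pos; lra]).
    assert (0 <= s * (G * c)) by (apply Rmult_le_pos; [lra | apply Rmult_le_pos; lra]).
    assert (0 <= s * (G * d)) by (apply Rmult_le_pos; [lra | apply Rmult_le_pos; lra]).
    assert (0 <= s * a) by (apply Rmult_le_pos; lra).
    assert (0 <= s * b) by (apply Rmult_le_pos; lra).
    assert (0 <= s * c) by (apply Rmult_le_pos; lra).
    assert (0 <= s * ((k1 + k2) * a)) by (apply Rmult_le_pos; [lra | apply Rmult_le_pos; lra]).
    assert (0 <= s * ((k1 + k2) * b)) by (apply Rmult_le_pos; [lra | apply Rmult_le_pos; lra]).
    assert (0 <= s * ((k1 + k2) * d)) by (apply Rmult_le_pos; [lra | apply Rmult_le_pos; lra]).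
    replace (s * ((1 + k1 + k2 + 2 * G) * (d + b + c + a))) with
     (s * d + s * a + s * b + s * c + (s * ((k1 + k2) * c) + s * ((k1 + k2) * a) + s * ((k1 + k2) * b) + s * ((k1 + k2) * d))
      + 2 * (s * (G * a) + s * (G * b) + s * (G * c) + s * (G * d))) by ring.
    lra.
Qed.

Lemma gr_wl2 g c1 c2 x y : gr g c1 c2 x y -> wl2 x.
Proof.
  intros H. apply (three_term_l2 (wbound g c1 c2)) with (x := x) (y := y).
  now apply gr_weight_pointwise.
Qed.

(** Beyond index [n0] the weight n is at least n0 + 1, and the weighted norm is bounded by the norms
    of [x] and [y]. This uniform tail estimate takes the place of compactness of the resolvent. *)
Lemma gr_tail g c1 c2 x y n0 : gr g c1 c2 x y ->
  ip x x <= sum_n (fun k => x k ^ 2) n0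
    + 4 * wbound g c1 c2 ^ 2 * (ip y y + 4 * ip x x) / INR (S n0).
Proof.
  intros H. apply ip_le_bound. intros N.
  assert (Hw := three_term_sum _ _ x y N (gr_weight_pointwise _ _ _ _ _ H)).
  set (B := 4 * wbound g c1 c2 ^ 2 * (ip y y + 4 * ip x x)) in *.
  assert (Hn0 : 0 < INR (S n0)) by (apply lt_0_INR; lia).
  apply Rle_trans with (sum_n (fun k => x k ^ 2) n0
     + sum_n (fun k => (sqrt (INR k) * x k) ^ 2) N / INR (S n0)).
  2:{ apply Rplus_le_compat_l. apply Rmult_le_compat_r; [|exact Hw].
      now apply Rlt_le, Rinv_0_lt_compat. }
  clear B Hw. induction N as [|N IH].
  - assert (H1 := sum_n_ge_term (fun k => x k ^ 2) 0 n0 (fun k => pow2_ge_0 _) ltac:(lia)).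
    rewrite !sum_n_0. rewrite INR_0, sqrt_0. unfold Rdiv. simpl in *. lra.
  - destruct (le_lt_dec (S N) n0) as [Hle|Hlt].
    + assert (H1 : sum_n (fun k => x k ^ 2) (S N) <= sum_n (fun k => x k ^ 2) n0).
      { clear - Hle. induction Hle as [|m Hm IH]; [lra|]. rewrite (sum_n_S _ m).
        assert (H := pow2_ge_0 (x (S m))). lra. }
      assert (0 <= sum_n (fun k => (sqrt (INR k) * x k) ^ 2) (S N) / INR (S n0)).
      { apply Rmult_le_pos; [apply sum_n_nonneg; intros; apply pow2_ge_0 |].
        now apply Rlt_le, Rinv_0_lt_compat. }
      lra.
    + rewrite !(sum_n_S _ N).
      assert (x (S N) ^ 2 <= (sqrt (INR (S N)) * x (S N)) ^ 2 / INR (S n0)).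
      { rewrite Rpow_mult_distr, pow2_sqrt by apply pos_INR.
        apply Rmult_le_reg_r with (INR (S n0)); [assumption|].
        replace (INR (S N) * x (S N) ^ 2 / INR (S n0) * INR (S n0)) with (INR (S N) * x (S N) ^ 2)
          by (field; lra).
        assert (INR (S n0) <= INR (S N)) by (apply le_INR; lia).
        assert (Hp := pow2_ge_0 (x (S N))). nra. }
      unfold Rdiv in *. lra.
Qed.

(** [gr_wl2] puts the whole maximal domain inside [wl2], where a and a^* are adjoint to each other;
    no boundary term at infinity appears. *)
Lemma gr_sym g c1 c2 x y x' y' : gr g c1 c2 x y -> gr g c1 c2 x' y' -> ip y x' = ip x y'.
Proof.
  intros H H'. assert (Hx := gr_wl2 _ _ _ _ _ H). assert (Hx' := gr_wl2 _ _ _ _ _ H').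
  assert (A1 := lower_raise_adj x x' Hx Hx'). assert (A2 := lower_raise_adj x' x Hx' Hx).
  assert (E1 := ex_series_mul _ _ (lower_l2 x Hx) (ell2_prop x')).
  assert (E2 := ex_series_mul _ _ (raise_l2 x Hx) (ell2_prop x')).
  assert (E3 := ex_series_mul _ _ (ell2_prop x) (lower_l2 x' Hx')).
  assert (E4 := ex_series_mul _ _ (ell2_prop x) (raise_l2 x' Hx')).
  assert (S1 := Series_ext (fun n => lower x' n * x n) (fun n => x n * lower x' n) (fun n => Rmult_comm _ _)).
  assert (S2 := Series_ext (fun n => x' n * raise x n) (fun n => raise x n * x' n) (fun n => Rmult_comm _ _)).
  apply Rminus_diag_uniq. unfold ip. rewrite <- Series_minus; try apply ip_ex.
  transitivity (Series (fun n => g * ((lower x n * x' n - x n * raise x' n)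
     + (raise x n * x' n - x n * lower x' n)))).
  - apply Series_ext. intros n. rewrite <- (H n), <- (H' n), !jac_apply_lr. ring.
  - rewrite Series_scal_l, Series_plus, !Series_minus by (assumption || (apply (ex_series_minus (V := R_NormedModule)); assumption)).
    rewrite A1, <- S2, <- A2, S1. ring.
Qed.

(** * Formal eigenvectors and stability of the recurrence *)

(** The polynomials of the first kind of the Jacobi matrix, the formal solution of A p = mu p with
    p_0 = 1. Two consecutive values are carried to make the recursion structural. *)
Fixpoint pol_pair (g c1 c2 mu : R) (n : nat) : R * R :=
  match n with
  | O => (1, (mu - jac_diag c1 c2 0) / jac_off g 0)
  | S m => let (a, b) := pol_pair g c1 c2 mu m in
           (b, ((mu - jac_diag c1 c2 (S m)) * b - jac_off g m * a) / jac_off g (S m))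
  end.

Definition pol g c1 c2 mu n := fst (pol_pair g c1 c2 mu n).

Lemma jac_off_neq0 g n : g <> 0 -> jac_off g n <> 0.
Proof.
  intros Hg. unfold jac_off. apply Rmult_integral_contrapositive. split; auto.
  apply Rgt_not_eq, sqrt_lt_R0, lt_0_INR. lia.
Qed.

Lemma pol_1 g c1 c2 mu : pol g c1 c2 mu 1 = (mu - jac_diag c1 c2 0) / jac_off g 0.
Proof. reflexivity. Qed.

Lemma pol_SS g c1 c2 mu n :
  pol g c1 c2 mu (S (S n)) =
  ((mu - jac_diag c1 c2 (S n)) * pol g c1 c2 mu (S n) - jac_off g n * pol g c1 c2 mu n) / jac_off g (S n).
Proof.
  unfold pol. cbn [pol_pair]. destruct (pol_pair g c1 c2 mu n) as [a b]. reflexivity.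
Qed.

Lemma pol_eigen g c1 c2 mu n : g <> 0 ->
  jac_apply g c1 c2 (pol g c1 c2 mu) n = mu * pol g c1 c2 mu n.
Proof.
  intros Hg. unfold jac_apply. destruct n as [|n].
  - rewrite pol_1. change (pol g c1 c2 mu 0) with 1. field. now apply jac_off_neq0.
  - rewrite pol_SS. field. now apply jac_off_neq0.
Qed.

(** Forward substitution: row n determines x_(n+1) from the two preceding entries and the residual,
    so up to a fixed index the error is linear in the residual, with a constant independent of [x]
    and [f]. Residual 0 gives simplicity of the spectrum. *)
Lemma recurrence_bound g c1 c2 mu : g <> 0 -> forall K, exists C, 0 <= C /\
  forall (x f : nat -> R) eps, (forall n, jac_apply g c1 c2 x n = mu * x n + f n) ->
   (forall n, Rabs (f n) <= eps) ->
   forall n, (n <= K)%nat -> Rabs (x n - x 0%nat * pol g c1 c2 mu n) <= C * eps.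
Proof.
  intros Hg.
  assert (Hmain : forall n, exists C, 0 <= C /\
    forall (x f : nat -> R) eps, (forall n, jac_apply g c1 c2 x n = mu * x n + f n) ->
     (forall n, Rabs (f n) <= eps) ->
     Rabs (x n - x 0%nat * pol g c1 c2 mu n) <= C * eps /\
     Rabs (x (S n) - x 0%nat * pol g c1 c2 mu (S n)) <= C * eps).
  { induction n as [|n [C [HC IH]]].
    - exists (/ Rabs (jac_off g 0)).
      assert (Hb := jac_off_neq0 g 0 Hg). assert (Hb' := Rabs_pos_lt _ Hb).
      split; [now apply Rlt_le, Rinv_0_lt_compat|].
      intros x f eps Hx Hf. assert (He : 0 <= eps) by (eapply Rle_trans; [apply Rabs_pos | apply (Hf 0%nat)]).
      split.
      + change (pol g c1 c2 mu 0) with 1. rewrite Rmult_1_r, Rminus_diag, Rabs_R0.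
        apply Rmult_le_pos; [now apply Rlt_le, Rinv_0_lt_compat | exact He].
      + rewrite pol_1. specialize (Hx 0%nat). unfold jac_apply in Hx.
        replace (x 1%nat - x 0%nat * ((mu - jac_diag c1 c2 0) / jac_off g 0)) with (/ jac_off g 0 * f 0%nat).
        * rewrite Rabs_mult, Rabs_inv. apply Rmult_le_compat_l; [now apply Rlt_le, Rinv_0_lt_compat | apply Hf].
        * replace (f 0%nat) with (0 + jac_diag c1 c2 0 * x 0%nat + jac_off g 0 * x 1%nat - mu * x 0%nat) by lra.
          field. exact Hb.
    - assert (Hb := jac_off_neq0 g (S n) Hg). assert (Hb' := Rabs_pos_lt _ Hb).
      set (b := jac_off g (S n)) in *. set (a := mu - jac_diag c1 c2 (S n)).
      exists (C + (Rabs a * C + Rabs (jac_off g n) * C + 1) / Rabs b).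
      assert (Hpos : 0 <= (Rabs a * C + Rabs (jac_off g n) * C + 1) / Rabs b).
      { apply Rmult_le_pos; [|now apply Rlt_le, Rinv_0_lt_compat].
        assert (Ha := Rabs_pos a). assert (Hc := Rabs_pos (jac_off g n)).
        assert (0 <= Rabs a * C) by now apply Rmult_le_pos.
        assert (0 <= Rabs (jac_off g n) * C) by now apply Rmult_le_pos. lra. }
      split; [lra|].
      intros x f eps Hx Hf. assert (He : 0 <= eps) by (eapply Rle_trans; [apply Rabs_pos | apply (Hf 0%nat)]).
      destruct (IH x f eps Hx Hf) as [I1 I2].
      split.
      + assert (0 <= (Rabs a * C + Rabs (jac_off g n) * C + 1) / Rabs b * eps) by now apply Rmult_le_pos.
        lra.
      + rewrite pol_SS. fold a b. specialize (Hx (S n)). unfold jac_apply in Hx. fold b in Hx.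
        set (d0 := x n - x 0%nat * pol g c1 c2 mu n) in *.
        set (d1 := x (S n) - x 0%nat * pol g c1 c2 mu (S n)) in *.
        replace (x (S (S n)) - _) with ((a * d1 - jac_off g n * d0 + f (S n)) / b).
        * unfold Rdiv at 1. rewrite Rabs_mult, Rabs_inv.
          apply Rle_trans with ((Rabs a * C + Rabs (jac_off g n) * C + 1) * eps * / Rabs b).
          -- apply Rmult_le_compat_r; [now apply Rlt_le, Rinv_0_lt_compat|].
             eapply Rle_trans; [apply Rabs_triang|].
             replace ((Rabs a * C + Rabs (jac_off g n) * C + 1) * eps) with
               (Rabs a * (C * eps) + Rabs (jac_off g n) * (C * eps) + eps) by ring.
             apply Rplus_le_compat; [|apply Hf].
             unfold Rminus. eapply Rle_trans; [apply Rabs_triang|]. rewrite Rabs_Ropp, !Rabs_mult.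
             apply Rplus_le_compat; apply Rmult_le_compat_l; auto using Rabs_pos.
          -- assert (0 <= C * eps) by now apply Rmult_le_pos. unfold Rdiv. nra.
        * unfold d0, d1. replace (f (S n)) with (jac_off g n * x n + jac_diag c1 c2 (S n) * x (S n) + b * x (S (S n)) - mu * x (S n)) by lra.
          unfold a. field. exact Hb. }
  induction K as [|K [C [HC IH]]].
  - destruct (Hmain 0%nat) as [C [HC H]]. exists C. split; auto.
    intros x f eps Hx Hf n Hn. replace n with 0%nat by lia. now apply (H x f eps).
  - destruct (Hmain (S K)) as [C' [HC' H]]. exists (C + C'). split; [lra|].
    intros x f eps Hx Hf n Hn. assert (He : 0 <= eps) by (eapply Rle_trans; [apply Rabs_pos | apply (Hf 0%nat)]).
    assert (0 <= C * eps) by now apply Rmult_le_pos.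
    assert (0 <= C' * eps) by now apply Rmult_le_pos.
    destruct (Nat.eq_dec n (S K)) as [->|Hne].
    + destruct (H x f eps Hx Hf) as [Hz _]. lra.
    + assert (Hz := IH x f eps Hx Hf n ltac:(lia)). lra.
Qed.

Lemma eigen_pol g c1 c2 mu (x : nat -> R) : g <> 0 ->
  (forall n, jac_apply g c1 c2 x n = mu * x n) -> forall n, x n = x 0%nat * pol g c1 c2 mu n.
Proof.
  intros Hg H n. destruct (recurrence_bound g c1 c2 mu Hg n) as [C [_ HC]].
  assert (H1 := HC x (fun _ => 0) 0).
  assert (H2 : Rabs (x n - x 0%nat * pol g c1 c2 mu n) <= C * 0).
  { apply H1; auto. - intros k. rewrite H. ring. - intros _. rewrite Rabs_R0. lra. }
  rewrite Rmult_0_r in H2. assert (H3 := Rabs_pos (x n - x 0%nat * pol g c1 c2 mu n)).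
  apply Rminus_diag_uniq. destruct (Req_dec (x n - x 0%nat * pol g c1 c2 mu n) 0) as [->|Hne]; auto.
  apply Rabs_pos_lt in Hne. lra.
Qed.

(** * Completeness of the eigenvectors *)

Lemma hnorm_opp x : hnorm (hscal (-1) x) = hnorm x.
Proof. rewrite hnorm_scal, Rabs_left by lra. ring. Qed.

Lemma hnorm_sub_sym x y : hnorm (hsub x y) = hnorm (hsub y x).
Proof.
  replace (hsub x y) with (hscal (-1) (hsub y x)) by hext.
  apply hnorm_opp.
Qed.

Lemma hnorm_triangle_sub x y : hnorm x <= hnorm y + hnorm (hsub x y).
Proof.
  replace x with (hadd y (hsub x y)) at 1 by hext. apply hnorm_triangle.
Qed.

Lemma hnorm_zero : hnorm hzero = 0.
Proof. unfold hnorm. rewrite ip_zero_l. apply sqrt_0. Qed.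

Definition orth_eigen g c1 c2 (z : ell2) : Prop :=
  forall mu u, gr g c1 c2 u (hscal mu u) -> ip z u = 0.

Lemma small_eps (A eta : R) : 0 <= A -> 0 < eta -> exists eps, 0 < eps <= 1 /\ A * eps ^ 2 <= eta.
Proof.
  intros HA He. exists (Rmin 1 (eta / (A + 1))).
  assert (H0 : 0 < eta / (A + 1)) by (apply Rdiv_lt_0_compat; lra).
  assert (H1 := Rmin_l 1 (eta / (A + 1))). assert (H2 := Rmin_r 1 (eta / (A + 1))).
  assert (H3 : 0 < Rmin 1 (eta / (A + 1))) by (apply Rmin_pos; lra).
  set (e := Rmin 1 (eta / (A + 1))) in *. split; [lra|].
  assert (H4 : (A + 1) * e <= eta).
  { apply Rle_trans with ((A + 1) * (eta / (A + 1))).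
    - apply Rmult_le_compat_l; lra.
    - apply Req_le. field. lra. }
  assert (A * e ^ 2 <= A * e) by (apply Rmult_le_compat_l; nra). nra.
Qed.

Lemma large_nat (B eta : R) : 0 < eta -> exists n0, B / INR (S n0) <= eta.
Proof.
  intros He. destruct (INR_unbounded (B / eta)) as [n0 Hn0]. exists n0.
  assert (H : 0 < INR (S n0)) by (apply lt_0_INR; lia).
  apply Rmult_le_reg_r with (INR (S n0)); [assumption|].
  replace (B / INR (S n0) * INR (S n0)) with B by (field; lra).
  rewrite S_INR in *. apply Rle_trans with (eta * (B / eta)).
  - apply Req_le. field. lra.
  - apply Rmult_le_compat_l; lra.
Qed.

Lemma sum_n_sqr_le (x : nat -> R) K C : (forall n, (n <= K)%nat -> Rabs (x n) <= C) ->
  sum_n (fun n => x n ^ 2) K <= INR (S K) * C ^ 2.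
Proof.
  intros H. induction K as [|K IH].
  - rewrite sum_n_0. rewrite <- (pow2_abs (x 0%nat)). rewrite S_INR, INR_0, Rplus_0_l, Rmult_1_l.
    apply pow_incr. split; [apply Rabs_pos | apply H; lia].
  - rewrite sum_n_S, (S_INR (S K)), Rmult_plus_distr_r, Rmult_1_l.
    apply Rplus_le_compat.
    + apply IH. intros n Hn. apply H. lia.
    + rewrite <- (pow2_abs (x (S K))). apply pow_incr. split; [apply Rabs_pos | apply H; lia].
Qed.

Lemma gr_residual g c1 c2 mu (u w : ell2) : gr g c1 c2 u w ->
  forall n, jac_apply g c1 c2 u n = mu * u n + hsub w (hscal mu u) n.
Proof. intros H n. rewrite (H n). simpl. ring. Qed.

(** Tightness of approximate eigenvectors: [n0] is the same for all vectors with norm at most [M]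
    and residual at most 1. *)
Lemma gr_tail_residual g c1 c2 mu M eta : 0 < eta -> 0 <= M -> exists n0, forall u w,
  gr g c1 c2 u w -> hnorm (hsub w (hscal mu u)) <= 1 -> hnorm u <= M ->
  ip u u <= sum_n (fun k => u k ^ 2) n0 + eta.
Proof.
  intros He HM.
  destruct (large_nat (4 * wbound g c1 c2 ^ 2 * ((1 + Rabs mu * M) ^ 2 + 4 * M ^ 2)) eta He) as [n0 Hn0].
  exists n0. intros u w Hg Hr Hu.
  apply Rle_trans with (1 := gr_tail _ _ _ _ _ n0 Hg).
  apply Rplus_le_compat_l. apply Rle_trans with (2 := Hn0).
  apply Rmult_le_compat_r. { apply Rlt_le, Rinv_0_lt_compat, lt_0_INR. lia. }
  apply Rmult_le_compat_l. { assert (H := pow2_ge_0 (wbound g c1 c2)). lra. }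
  assert (Hw : hnorm w <= 1 + Rabs mu * M).
  { apply Rle_trans with (1 := hnorm_triangle_sub w (hscal mu u)).
    rewrite hnorm_scal.
    assert (Rabs mu * hnorm u <= Rabs mu * M) by (apply Rmult_le_compat_l; auto using Rabs_pos). lra. }
  rewrite <- !hnorm_sqr.
  assert (hnorm w ^ 2 <= (1 + Rabs mu * M) ^ 2) by (apply pow_incr; split; auto using hnorm_pos).
  assert (hnorm u ^ 2 <= M ^ 2) by (apply pow_incr; split; auto using hnorm_pos). lra.
Qed.

(** The first n0 + 1 coordinates are small because the recurrence starts from 0, the remaining ones
    by tightness. *)
Lemma small_of_residual g c1 c2 mu M eta : g <> 0 -> 0 < eta -> 0 <= M ->
  exists eps, 0 < eps /\ forall z y, gr g c1 c2 z y -> z 0%nat = 0 ->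
    hnorm z <= M -> hnorm (hsub y (hscal mu z)) <= eps -> ip z z <= eta.
Proof.
  intros Hg He HM.
  destruct (gr_tail_residual g c1 c2 mu M (eta / 2) ltac:(lra) HM) as [n0 Hn0].
  destruct (recurrence_bound g c1 c2 mu Hg n0) as [C [HC HR]].
  destruct (small_eps (INR (S n0) * C ^ 2) (eta / 2)) as [eps [Heps Hs]].
  { apply Rmult_le_pos; [apply pos_INR | apply pow2_ge_0]. } { lra. }
  exists eps. split; [lra|]. intros z y Hz Hz0 HzM Hr.
  assert (H1 := Hn0 z y Hz ltac:(lra) HzM).
  assert (H2 : sum_n (fun k => z k ^ 2) n0 <= INR (S n0) * (C * eps) ^ 2).
  { apply sum_n_sqr_le. intros n Hn.
    replace (z n) with (z n - z 0%nat * pol g c1 c2 mu n) by (rewrite Hz0; ring).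
    apply (HR z (hsub y (hscal mu z))); auto.
    - now apply gr_residual.
    - intros k. apply Rle_trans with (2 := Hr). apply coord_le_hnorm. }
  rewrite Rpow_mult_distr in H2. lra.
Qed.

(** A unit approximate eigenvector u has half of its mass in the first n0 + 1 coordinates, where it
    is close to u_0 times [pol]; hence u_0 is bounded away from 0. On any longer stretch the norm of
    u then bounds that of [pol]. *)
Lemma approx_eigen_pol_l2 g c1 c2 mu : g <> 0 ->
  (forall eps, 0 < eps -> exists u w, gr g c1 c2 u w /\ hnorm u = 1 /\
     hnorm (hsub w (hscal mu u)) <= eps) ->
  l2 (pol g c1 c2 mu).
Proof.
  intros Hg Happ.
  destruct (gr_tail_residual g c1 c2 mu 1 (1 / 2) ltac:(lra) ltac:(lra)) as [n0 Hn0].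
  destruct (recurrence_bound g c1 c2 mu Hg n0) as [C0 [HC0 HR0]].
  set (p := pol g c1 c2 mu) in *.
  set (Sp := sum_n (fun k => p k ^ 2) n0).
  assert (HSp : 1 <= Sp).
  { unfold Sp. replace 1 with (p 0%nat ^ 2) by (unfold p, pol; simpl; ring).
    apply (sum_n_ge_term (fun k => p k ^ 2)); [intros; apply pow2_ge_0 | lia]. }
  (* 24 is 3 divided by 1/8, the two bounds [Hp3] and [Hu0] below. The accuracy [eps] depends on
     [K], but [Sp] does not. *)
  apply ex_series_bounded with (M := 24 * Sp); [intros; apply pow2_ge_0|].
  intros K.
  destruct (recurrence_bound g c1 c2 mu Hg K) as [C [HC HR]]. fold p in HR.
  destruct (small_eps (2 * INR (S n0) * C0 ^ 2 + 2 * INR (S K) * C ^ 2) (1 / 4)) as [eps [Heps Hs]].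
  { assert (H1 := pos_INR (S n0)). assert (H2 := pos_INR (S K)).
    assert (H3 := pow2_ge_0 C0). assert (H4 := pow2_ge_0 C).
    assert (0 <= INR (S n0) * C0 ^ 2) by now apply Rmult_le_pos.
    assert (0 <= INR (S K) * C ^ 2) by now apply Rmult_le_pos. lra. } { lra. }
  destruct (Happ eps ltac:(lra)) as (u & w & Hu & Hnu & Hr).
  assert (Hres := gr_residual _ _ _ mu _ _ Hu).
  assert (Hf : forall n, Rabs (hsub w (hscal mu u) n) <= eps).
  { intros k. apply Rle_trans with (2 := Hr). apply coord_le_hnorm. }
  assert (S0 := sum_n_sqr_le (fun n => u n - u 0%nat * p n) n0 (C0 * eps)
    (fun n Hn => HR0 u _ eps Hres Hf n Hn)).
  assert (S1 := sum_n_sqr_le (fun n => u n - u 0%nat * p n) K (C * eps)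
    (fun n Hn => HR u _ eps Hres Hf n Hn)).
  rewrite Rpow_mult_distr in S0, S1.
  assert (U0 := Hn0 u w Hu ltac:(lra) ltac:(lra)).
  assert (U1 := partial_le_ip u K).
  rewrite <- hnorm_sqr, Hnu in U0, U1.
  assert (P0 : sum_n (fun k => u k ^ 2) n0 <= 2 * u 0%nat ^ 2 * Sp + 2 * sum_n (fun n => (u n - u 0%nat * p n) ^ 2) n0).
  { unfold Sp. rewrite <- !sum_n_scal, <- sum_n_add. apply sum_n_le. intros k _.
    assert (H := pow2_ge_0 (u k - 2 * (u 0%nat * p k))). nra. }
  assert (P1 : u 0%nat ^ 2 * sum_n (fun k => p k ^ 2) K <= 2 * sum_n (fun k => u k ^ 2) K + 2 * sum_n (fun n => (u n - u 0%nat * p n) ^ 2) K).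
  { rewrite <- !sum_n_scal, <- sum_n_add. apply sum_n_le. intros k _.
    assert (H := pow2_ge_0 (2 * u k - u 0%nat * p k)). nra. }
  assert (0 <= INR (S n0) * (C0 ^ 2 * eps ^ 2)).
  { apply Rmult_le_pos; [apply pos_INR | apply Rmult_le_pos; apply pow2_ge_0]. }
  assert (0 <= INR (S K) * (C ^ 2 * eps ^ 2)).
  { apply Rmult_le_pos; [apply pos_INR | apply Rmult_le_pos; apply pow2_ge_0]. }
  assert (Hu0 : 1 / 8 <= u 0%nat ^ 2 * Sp) by lra.
  assert (Hp3 : u 0%nat ^ 2 * sum_n (fun k => p k ^ 2) K <= 3) by lra.
  set (X := sum_n (fun k => p k ^ 2) K) in *.
  assert (HX : 0 <= X) by (apply sum_n_nonneg; intros; apply pow2_ge_0).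
  assert (1 / 8 * X <= 3 * Sp).
  { apply Rle_trans with (u 0%nat ^ 2 * Sp * X); [now apply Rmult_le_compat_r|].
    replace (u 0%nat ^ 2 * Sp * X) with (u 0%nat ^ 2 * X * Sp) by ring.
    apply Rmult_le_compat_r; lra. }
  lra.
Qed.

Lemma pol_gr g c1 c2 mu (H : l2 (pol g c1 c2 mu)) : g <> 0 ->
  gr g c1 c2 (mk_ell2 _ H) (hscal mu (mk_ell2 _ H)).
Proof. intros Hg n. simpl. now apply pol_eigen. Qed.

(* For an eigenvalue [mu] too: an approximate eigenvector is close to a multiple of the
   polynomial solution [pol], so it cannot be orthogonal to the eigenvectors. *)
Lemma gap g c1 c2 mu : g <> 0 -> exists c, 0 < c /\ forall u w,
  orth_eigen g c1 c2 u -> gr g c1 c2 u w -> c * hnorm u <= hnorm (hsub w (hscal mu u)).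
Proof.
  intros Hg. apply NNPP. intros Hno.
  assert (Happ : forall eps, 0 < eps -> exists u w, orth_eigen g c1 c2 u /\ gr g c1 c2 u w /\
     hnorm u = 1 /\ hnorm (hsub w (hscal mu u)) <= eps).
  { intros eps He. apply NNPP. intros Hn. apply Hno. exists eps. split; auto.
    intros u w HS Hu. apply Rnot_lt_le. intros Hlt. apply Hn.
    destruct (Req_dec (hnorm u) 0) as [H0|H0].
    { rewrite H0, Rmult_0_r in Hlt. assert (H := hnorm_pos (hsub w (hscal mu u))). lra. }
    assert (Hpos : 0 < hnorm u) by (assert (H := hnorm_pos u); lra).
    assert (Hi : 0 < / hnorm u) by now apply Rinv_0_lt_compat.
    exists (hscal (/ hnorm u) u), (hscal (/ hnorm u) w). repeat split.
    - intros nu v Hv. rewrite ip_scal_l, (HS nu v Hv). ring.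
    - now apply gr_scal.
    - rewrite hnorm_scal, Rabs_pos_eq by lra. now field.
    - replace (hsub _ _) with (hscal (/ hnorm u) (hsub w (hscal mu u))) by hext.
      rewrite hnorm_scal, Rabs_pos_eq by lra.
      apply Rmult_le_reg_l with (hnorm u); auto. rewrite <- Rmult_assoc, Rinv_r by auto. lra. }
  assert (Hp : l2 (pol g c1 c2 mu)).
  { apply approx_eigen_pol_l2; auto. intros eps He.
    destruct (Happ eps He) as (u & w & _ & H). now exists u, w. }
  assert (HP := pol_gr g c1 c2 mu Hp Hg). set (P := mk_ell2 _ Hp) in *.
  assert (HM : 0 <= 1 + hnorm P) by (assert (H := hnorm_pos P); lra).
  destruct (small_of_residual g c1 c2 mu (1 + hnorm P) (1 / 4) Hg ltac:(lra) HM) as [eps [He Hs]].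
  destruct (Happ eps He) as (u & w & HS & Hu & Hnu & Hr).
  (* Removing the multiple of [P] with the same coordinate 0 makes [small_of_residual] applicable.
     As [u] is orthogonal to [P], the inner product of [u] and [z] is 1, against a norm of [z] of at
     most 1/2. *)
  set (z := hsub u (hscal (u 0%nat) P)).
  assert (Hz : ip z z <= 1 / 4).
  { apply Hs with (y := hsub w (hscal (u 0%nat) (hscal mu P))).
    - apply gr_sub; auto. now apply gr_scal.
    - simpl. change (pol g c1 c2 mu 0) with 1. ring.
    - unfold z, hsub. eapply Rle_trans; [apply hnorm_triangle|]. rewrite hnorm_opp, hnorm_scal, Hnu. assert (H := coord_le_hnorm u 0). rewrite Hnu in H.
      assert (HP0 := hnorm_pos P). nra.
    - apply Rle_trans with (2 := Hr). apply Req_le. f_equal. unfold z. hext. }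
  assert (H1 : ip u u = ip u z).
  { unfold z. rewrite ip_sub_r, ip_scal_r, (HS mu P HP). ring. }
  assert (H2 := cauchy_schwarz u z). rewrite <- H1, <- hnorm_sqr, Hnu in H2. lra.
Qed.

(* For [kap >= kap0] the off-diagonal part relative to [N + kap] is a contraction with
   constant 1/2, so [A + kap] is inverted by a Neumann series. *)
Definition kap0 (g c1 c2 : R) : R := 1 + 16 * g ^ 2 + 8 * (Rabs c1 + Rabs c2).

Lemma kap0_ge1 g c1 c2 : 1 <= kap0 g c1 c2.
Proof.
  unfold kap0. assert (H1 := Rabs_pos c1). assert (H2 := Rabs_pos c2). assert (H3 := pow2_ge_0 g). lra.
Qed.

(** With the constant 1/8, [three_term_sum] yields 4 (1/8)^2 4 = 1/4 for the squared norm, which is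
    the contraction factor 1/2. *)
Lemma offdiag_rel_bound g c1 c2 kap (x : ell2) : kap0 g c1 c2 <= kap -> forall n,
  Rabs ((jac_apply g c1 c2 x n - INR n * x n) / (INR n + kap)) <=
  1 / 8 * (Rabs (hzero n) + Rabs (x (pred n)) + Rabs (x n) + Rabs (x (S n))).
Proof.
  intros Hk n. assert (Hk1 := kap0_ge1 g c1 c2). assert (Hn := pos_INR n).
  rewrite jac_apply_lr. simpl (coord hzero n). rewrite Rabs_R0.
  unfold Rdiv. rewrite Rabs_mult, Rabs_inv, (Rabs_pos_eq (INR n + kap)) by lra.
  apply Rmult_le_reg_r with (INR n + kap); [lra|].
  rewrite Rmult_assoc, Rinv_l by lra. rewrite Rmult_1_r.
  assert (Hd := jac_diag_le c1 c2 n). set (d := jac_diag c1 c2 n) in *.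
  assert (Hg := Rabs_pos g).
  assert (Hsq : Rabs g * sqrt (INR (S n)) <= (INR n + kap) / 8).
  { assert (Hs := sqrt_sqrt (INR (S n)) (pos_INR _)). rewrite S_INR in *.
    (* Gives 8 |g| sqrt (n + 1) <= 16 g^2 + n + 1, the origin of the terms 1 and 16 g^2 in
       [kap0]. *)
    assert (H := pow2_ge_0 (4 * Rabs g - sqrt (INR n + 1))). unfold kap0 in Hk.
    rewrite <- (pow2_abs g) in Hk. assert (H1 := Rabs_pos c1). assert (H2 := Rabs_pos c2). nra. }
  assert (Hsq' : Rabs g * sqrt (INR n) <= (INR n + kap) / 8).
  { apply Rle_trans with (2 := Hsq). apply Rmult_le_compat_l; auto.
    apply sqrt_le_1_alt. rewrite S_INR. lra. }
  assert (Hdd : Rabs (d - INR n) <= (INR n + kap) / 8).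
  { unfold kap0 in Hk. assert (H := pow2_ge_0 g). lra. }
  apply Rle_trans with (Rabs (g * raise x n) + Rabs ((d - INR n) * x n) + Rabs (g * lower x n)).
  { replace (g * raise x n + d * x n + g * lower x n - INR n * x n) with
      (g * raise x n + (d - INR n) * x n + g * lower x n) by ring.
    eapply Rle_trans; [apply Rabs_triang|]. apply Rplus_le_compat_r. apply Rabs_triang. }
  assert (H2 : Rabs ((d - INR n) * x n) <= (INR n + kap) / 8 * Rabs (x n)).
  { rewrite Rabs_mult. apply Rmult_le_compat_r; auto using Rabs_pos. }
  assert (H3 : Rabs (g * lower x n) <= (INR n + kap) / 8 * Rabs (x (S n))).
  { unfold lower. rewrite <- Rmult_assoc, !Rabs_mult, (Rabs_pos_eq (sqrt _)) by apply sqrt_pos.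
    apply Rmult_le_compat_r; auto using Rabs_pos. }
  assert (H1 : Rabs (g * raise x n) <= (INR n + kap) / 8 * Rabs (x (pred n))).
  { unfold raise. destruct n as [|m].
    - rewrite Rmult_0_r, Rabs_R0. apply Rmult_le_pos; [lra | apply Rabs_pos].
    - simpl pred. rewrite <- Rmult_assoc, !Rabs_mult, (Rabs_pos_eq (sqrt _)) by apply sqrt_pos.
      apply Rmult_le_compat_r; auto using Rabs_pos. }
  lra.
Qed.

(** * The inverse of A + kap and completeness of the eigenvectors *)

Section Resolvent.

Variables g c1 c2 kap : R.
Hypothesis Hkap : kap0 g c1 c2 <= kap.

Definition offrel (x : ell2) : ell2 :=
  mk_ell2 _ (three_term_l2 (1 / 8) _ x hzero (offdiag_rel_bound g c1 c2 kap x Hkap)).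

Lemma offrel_norm x : hnorm (offrel x) <= / 2 * hnorm x.
Proof.
  assert (H := hnorm_pos x). apply hnorm_le_sqr; [lra|].
  apply ip_le_bound. intros n.
  apply Rle_trans with (1 := three_term_sum _ _ _ _ n (offdiag_rel_bound g c1 c2 kap x Hkap)).
  rewrite ip_zero_l, Rpow_mult_distr, hnorm_sqr. lra.
Qed.

Lemma diag_rel_bound (y : ell2) n : Rabs (y n / (INR n + kap)) <= Rabs (y n).
Proof.
  assert (Hk1 := kap0_ge1 g c1 c2). assert (Hn := pos_INR n).
  unfold Rdiv. rewrite Rabs_mult, Rabs_inv, (Rabs_pos_eq (INR n + kap)) by lra.
  rewrite <- (Rmult_1_r (Rabs (y n))) at 2. apply Rmult_le_compat_l; [apply Rabs_pos|].
  rewrite <- Rinv_1. apply Rinv_le_contravar; lra.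
Qed.

Lemma diagrel_sqr (y : ell2) n : (y n / (INR n + kap)) ^ 2 <= y n ^ 2.
Proof.
  rewrite <- (pow2_abs (y n / _)), <- (pow2_abs (y n)). apply pow_incr.
  split; [apply Rabs_pos | apply diag_rel_bound].
Qed.

Definition diagrel (y : ell2) : ell2 :=
  mk_ell2 _ (l2_le _ (fun n => y n ^ 2) (diagrel_sqr y) (ell2_prop y)).

Lemma diagrel_norm y : hnorm (diagrel y) <= hnorm y.
Proof.
  apply hnorm_le_sqr; [apply hnorm_pos|]. rewrite hnorm_sqr.
  apply ip_le_bound. intros n. apply Rle_trans with (2 := partial_le_ip y n).
  apply sum_n_le. intros k _. apply diagrel_sqr.
Qed.

Lemma offrel_sub x y : offrel (hsub x y) = hsub (offrel x) (offrel y).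
Proof.
  apply ell2_ext. intros n. simpl. rewrite !jac_apply_lr. unfold raise, lower.
  destruct n; simpl; unfold Rdiv; ring.
Qed.

(** The right side encodes (A + kap) x = y; dividing each row by n + kap turns it into a fixed-point
    equation. *)
Lemma fixed_iff x y : x = hsub (diagrel y) (offrel x) <-> gr g c1 c2 x (hsub y (hscal kap x)).
Proof.
  assert (Hk1 := kap0_ge1 g c1 c2).
  split.
  - intros H n. assert (Hn := pos_INR n). assert (H1 := f_equal (fun u => coord u n) H). simpl in *.
    apply (f_equal (fun t => t * (INR n + kap))) in H1.
    replace ((y n / (INR n + kap) + -1 * ((jac_apply g c1 c2 x n - INR n * x n) / (INR n + kap))) * (INR n + kap))
      with (y n - (jac_apply g c1 c2 x n - INR n * x n)) in H1 by (field; lra). lra.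
  - intros H. apply ell2_ext. intros n. assert (Hn := pos_INR n). simpl. rewrite (H n). simpl.
    field. lra.
Qed.

Lemma resolvent_bound x y : gr g c1 c2 x (hsub y (hscal kap x)) -> hnorm x <= 2 * hnorm y.
Proof.
  intros H. apply fixed_iff in H.
  assert (H1 := hnorm_triangle (diagrel y) (hscal (-1) (offrel x))).
  change (hadd _ _) with (hsub (diagrel y) (offrel x)) in H1. rewrite <- H, hnorm_opp in H1.
  assert (H2 := offrel_norm x). assert (H3 := diagrel_norm y). lra.
Qed.

Lemma resolvent_ex y : exists x, gr g c1 c2 x (hsub y (hscal kap x)).
Proof.
  set (u := fix u n := match n with O => hzero | S m => hsub (diagrel y) (offrel (u m)) end).
  assert (Hstep : forall n, hnorm (hsub (u (S n)) (u n)) <= (/ 2) ^ n * hnorm (u 1%nat)).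
  { induction n as [|n IH].
    - rewrite pow_O, Rmult_1_l. apply Req_le. f_equal. change (u 0%nat) with hzero. hext.
    - replace (hsub (u (S (S n))) (u (S n))) with (hscal (-1) (offrel (hsub (u (S n)) (u n)))).
      + rewrite hnorm_opp.
        apply Rle_trans with (1 := offrel_norm _). rewrite <- tech_pow_Rmult. lra.
      + rewrite offrel_sub. change (u (S (S n))) with (hsub (diagrel y) (offrel (u (S n)))).
        change (u (S n)) with (hsub (diagrel y) (offrel (u n))) at 3.
        apply ell2_ext. intros k. cbn [coord hsub hadd hscal]. ring. }
  set (D := hnorm (u 1%nat)) in *. assert (HD : 0 <= D) by apply hnorm_pos.
  assert (Hsum : forall p n, hnorm (hsub (u (n + p)%nat) (u n)) <= 2 * (/ 2) ^ n * D * (1 - (/ 2) ^ p)).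
  { induction p as [|p IH]; intros n.
    - rewrite Nat.add_0_r, pow_O, Rminus_diag, Rmult_0_r.
      replace (hsub (u n) (u n)) with hzero by hext. rewrite hnorm_zero. lra.
    - replace (hsub (u (n + S p)%nat) (u n)) with
        (hadd (hsub (u (n + S p)%nat) (u (n + p)%nat)) (hsub (u (n + p)%nat) (u n))) by hext.
      eapply Rle_trans; [apply hnorm_triangle|].
      specialize (IH n). assert (H := Hstep (n + p)%nat). rewrite Nat.add_succ_r.
      rewrite pow_add in H. rewrite <- tech_pow_Rmult. lra. }
  assert (Hc : hcauchy u).
  { intros eps He.
    assert (Hlim : is_lim_seq (fun n => (/ 2) ^ n * (4 * D)) (0 * (4 * D))).
    { apply is_lim_seq_mult'; [|apply is_lim_seq_const].
      apply is_lim_seq_geom. rewrite Rabs_pos_eq; lra. }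
    rewrite Rmult_0_l in Hlim. apply is_lim_seq_spec in Hlim.
    destruct (Hlim (mkposreal eps He)) as [N HN]. simpl in HN. exists N. intros n m Hn Hm.
    assert (HNN := HN N (le_n _)). rewrite Rminus_0_r in HNN.
    assert (Hp : 0 <= (/ 2) ^ N) by (apply pow_le; lra).
    rewrite Rabs_pos_eq in HNN by (apply Rmult_le_pos; lra).
    assert (Hb : forall k, (N <= k)%nat -> hnorm (hsub (u k) (u N)) <= (/ 2) ^ N * (2 * D)).
    { intros k Hk. replace k with (N + (k - N))%nat by lia.
      apply Rle_trans with (1 := Hsum _ _).
      assert (0 <= (/ 2) ^ (k - N)) by (apply pow_le; lra).
      assert (0 <= (/ 2) ^ N * D) by now apply Rmult_le_pos. nra. }
    replace (hsub (u n) (u m)) with (hadd (hsub (u n) (u N)) (hsub (u N) (u m))) by hext.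
    eapply Rle_trans; [apply hnorm_triangle|].
    rewrite (hnorm_sub_sym (u N) (u m)). assert (H1 := Hb n Hn). assert (H2 := Hb m Hm). lra. }
  destruct (ell2_complete u Hc) as [x Hx]. exists x. apply fixed_iff.
  set (d := hsub x (hsub (diagrel y) (offrel x))).
  assert (Hd : d = hzero).
  { apply hnorm_eq0. apply Rle_antisym; [|apply hnorm_pos].
    assert (Hle : forall n, hnorm d <= hnorm (hsub (u (S n)) x) + / 2 * hnorm (hsub (u n) x)).
    { intros n.
      replace d with (hadd (hsub x (u (S n))) (hscal (-1) (offrel (hsub (u n) x)))).
      - eapply Rle_trans; [apply hnorm_triangle|]. rewrite hnorm_opp, (hnorm_sub_sym x).
        assert (H := offrel_norm (hsub (u n) x)). lra.
      - rewrite offrel_sub. unfold d. change (u (S n)) with (hsub (diagrel y) (offrel (u n))).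
        apply ell2_ext. intros k. cbn [coord hsub hadd hscal]. ring. }
    assert (Hl : is_lim_seq (fun n => hnorm (hsub (u (S n)) x) + / 2 * hnorm (hsub (u n) x)) (0 + / 2 * 0)).
    { apply is_lim_seq_plus'.
      - apply (is_lim_seq_incr_1 (fun n => hnorm (hsub (u n) x))). exact Hx.
      - apply is_lim_seq_mult'; [apply is_lim_seq_const | exact Hx]. }
    rewrite Rmult_0_r, Rplus_0_l in Hl.
    exact (is_lim_seq_le _ _ (Finite (hnorm d)) (Finite 0) Hle (is_lim_seq_const _) Hl). }
  apply ell2_ext. intros n. assert (H := f_equal (fun v => coord v n) Hd). unfold d in H. simpl in *. lra.
Qed.

Definition res (y : ell2) : ell2 := proj1_sig (constructive_indefinite_description _ (resolvent_ex y)).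

Lemma res_gr y : gr g c1 c2 (res y) (hsub y (hscal kap (res y))).
Proof. unfold res. now destruct (constructive_indefinite_description _ (resolvent_ex y)). Qed.

Lemma res_norm y : hnorm (res y) <= 2 * hnorm y.
Proof. apply resolvent_bound, res_gr. Qed.

Lemma res_unique x y : gr g c1 c2 x (hsub y (hscal kap x)) -> x = res y.
Proof.
  intros H. assert (H1 := gr_sub _ _ _ _ _ _ _ H (res_gr y)).
  replace (hsub (hsub y (hscal kap x)) (hsub y (hscal kap (res y)))) with
    (hsub hzero (hscal kap (hsub x (res y)))) in H1 by hext.
  apply resolvent_bound in H1. rewrite hnorm_zero in H1.
  assert (H2 : hsub x (res y) = hzero).
  { apply hnorm_eq0. assert (H3 := hnorm_pos (hsub x (res y))). lra. }
  apply ell2_ext. intros n. assert (H3 := f_equal (fun v => coord v n) H2). simpl in H3. lra.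
Qed.

Lemma res_add x y : res (hadd x y) = hadd (res x) (res y).
Proof.
  symmetry. apply res_unique.
  replace (hsub _ _) with (hadd (hsub x (hscal kap (res x))) (hsub y (hscal kap (res y)))) by hext.
  apply gr_add; apply res_gr.
Qed.

Lemma res_scal a x : res (hscal a x) = hscal a (res x).
Proof.
  symmetry. apply res_unique.
  replace (hsub _ _) with (hscal a (hsub x (hscal kap (res x)))) by hext.
  apply gr_scal, res_gr.
Qed.

Lemma res_sym x y : ip (res x) y = ip x (res y).
Proof.
  assert (H := gr_sym _ _ _ _ _ _ _ (res_gr x) (res_gr y)).
  autorewrite with ip in H. lra.
Qed.

Lemma eigen_neg_shift mu u : gr g c1 c2 u (hscal mu u) -> mu = - kap -> u = hzero.
Proof.
  intros H ->. replace (hscal (- kap) u) with (hsub hzero (hscal kap u)) in H by hext.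
  apply resolvent_bound in H. rewrite hnorm_zero in H. apply hnorm_eq0.
  assert (H3 := hnorm_pos u). lra.
Qed.

Lemma orth_eigen_res z : orth_eigen g c1 c2 z -> orth_eigen g c1 c2 (res z).
Proof.
  intros Hz mu u Hu. assert (H := gr_sym _ _ _ _ _ _ _ (res_gr z) Hu).
  autorewrite with ip in H. rewrite (Hz mu u Hu) in H.
  destruct (Req_dec (mu + kap) 0) as [H0|H0].
  - rewrite (eigen_neg_shift mu u Hu) by lra. rewrite ip_sym. apply ip_zero_l.
  - apply Rmult_eq_reg_l with (mu + kap); lra.
Qed.

Hypothesis Hg : g <> 0.

(** With w = v - r^(-1) [res v] one has [res v] - r v = - r w, and w is also (A - (1/r - kap))
    [res v]. So [gap] at 1/r - kap bounds [res v], hence v, by w. *)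
Lemma res_gap r : r <> 0 -> exists c, 0 < c /\ forall v, orth_eigen g c1 c2 v ->
  c * hnorm v <= hnorm (hsub (res v) (hscal r v)).
Proof.
  intros Hr. destruct (gap g c1 c2 (/ r - kap) Hg) as [c [Hc H]].
  assert (Hr' := Rabs_pos_lt r Hr).
  exists (Rabs r / (1 + / (c * Rabs r))).
  assert (Hcr : 0 < / (c * Rabs r)) by (apply Rinv_0_lt_compat; now apply Rmult_lt_0_compat).
  split. { apply Rdiv_lt_0_compat; lra. }
  intros v Hv.
  assert (H1 := H _ _ (orth_eigen_res v Hv) (res_gr v)).
  set (w := hsub _ _) in H1.
  assert (E : hsub (res v) (hscal r v) = hscal (- r) w).
  { unfold w. apply ell2_ext. intros n. simpl. field. exact Hr. }
  rewrite E, hnorm_scal, Rabs_Ropp.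
  assert (Hv2 : hnorm v <= (1 + / (c * Rabs r)) * hnorm w).
  { replace v with (hadd w (hscal (/ r) (res v))) at 1.
    - eapply Rle_trans; [apply hnorm_triangle|]. rewrite hnorm_scal, Rabs_inv.
      rewrite Rinv_mult. assert (hnorm (res v) <= / c * hnorm w).
      { apply Rmult_le_reg_l with c; auto. rewrite <- Rmult_assoc, Rinv_r by lra. lra. }
      assert (0 < / Rabs r) by now apply Rinv_0_lt_compat. nra.
    - unfold w. apply ell2_ext. intros n. simpl. field. exact Hr. }
  unfold Rdiv. rewrite Rmult_assoc. apply Rmult_le_compat_l; [lra|].
  apply Rmult_le_reg_l with (1 + / (c * Rabs r)); [lra|].
  rewrite <- Rmult_assoc, Rinv_r by lra. lra.
Qed.

(* On the orthogonal complement [S] of the eigenvectors let [rho] be the norm of the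
   symmetric operator [res].  By [res_gap] the operator [(res - rho) (res + rho)] is bounded
   below on [S], whereas [|res^2 v - rho^2 v|^2 <= rho^4 |v|^2 - rho^2 |res v|^2] becomes
   arbitrarily small on unit vectors. *)
Lemma eigen_complete z : orth_eigen g c1 c2 z -> z = hzero.
Proof.
  intros Hz. apply NNPP. intros Hnz.
  assert (HS_scal : forall a v, orth_eigen g c1 c2 v -> orth_eigen g c1 c2 (hscal a v)).
  { intros a v Hv mu u Hu. rewrite ip_scal_l, (Hv mu u Hu). ring. }
  set (Q := fun r => exists v, orth_eigen g c1 c2 v /\ hnorm v <= 1 /\ r = hnorm (res v)).
  destruct (completeness Q) as [rho [Hub Hlub]].
  { exists 2. intros r (v & _ & Hv & ->). assert (H := res_norm v). lra. }
  { exists (hnorm (res hzero)), hzero. split; [|split; auto].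
    - intros mu u _. apply ip_zero_l.
    - rewrite hnorm_zero. lra. }
  assert (Hrho : forall v, orth_eigen g c1 c2 v -> hnorm (res v) <= rho * hnorm v).
  { intros v Hv. destruct (Req_dec (hnorm v) 0) as [H0|H0].
    - apply Rle_trans with (1 := res_norm v). rewrite H0. lra.
    - assert (Hpos : 0 < hnorm v) by (assert (H := hnorm_pos v); lra).
      assert (Hi := Rinv_0_lt_compat _ Hpos).
      assert (H : hnorm (res (hscal (/ hnorm v) v)) <= rho).
      { apply Hub. exists (hscal (/ hnorm v) v). split; [now apply HS_scal | split; auto].
        rewrite hnorm_scal, Rabs_pos_eq, Rinv_l by lra. lra. }
      rewrite res_scal, hnorm_scal, Rabs_pos_eq in H by lra.
      apply Rmult_le_reg_l with (/ hnorm v); auto. apply Rle_trans with (1 := H).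
      apply Req_le. now field. }
  assert (Hznorm : 0 < hnorm z).
  { assert (H := hnorm_pos z). destruct (Req_dec (hnorm z) 0) as [H0|H0]; [|lra].
    apply hnorm_eq0 in H0. contradiction. }
  assert (Hrz : 0 < hnorm (res z)).
  { assert (H := hnorm_pos (res z)). destruct (Req_dec (hnorm (res z)) 0) as [H0|H0]; [|lra].
    exfalso. apply Hnz. apply hnorm_eq0 in H0. assert (H1 := res_gr z). rewrite H0 in H1.
    apply ell2_ext. intros n. specialize (H1 n). rewrite jac_apply_lr in H1. unfold raise, lower in H1.
    destruct n; simpl in *; lra. }
  assert (Hrpos : 0 < rho).
  { assert (H := Hrho z Hz). apply Rnot_le_lt. intros Hle. nra. }
  destruct (res_gap rho ltac:(lra)) as [a [Ha Hga]].
  destruct (res_gap (- rho) ltac:(lra)) as [b [Hb Hgb]].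
  (* [a] and [b] bound the two factors below, so [res] has squared norm at most [q] < rho^2 on the
     complement; this contradicts the choice of [rho] as a supremum. *)
  set (q := rho ^ 2 - (a * b) ^ 2 / rho ^ 2).
  assert (Hq : forall v, orth_eigen g c1 c2 v -> hnorm (res v) ^ 2 <= q * hnorm v ^ 2).
  { intros v Hv.
    set (v1 := hsub (res v) (hscal (- rho) v)).
    assert (Hv1 : orth_eigen g c1 c2 v1).
    { intros mu u Hu. unfold v1. rewrite ip_sub_l, ip_scal_l, (Hv mu u Hu), (orth_eigen_res v Hv mu u Hu). ring. }
    assert (H1 := Hgb v Hv). fold v1 in H1. assert (H2 := Hga v1 Hv1).
    assert (E : hsub (res v1) (hscal rho v1) = hsub (res (res v)) (hscal (rho ^ 2) v)).
    { unfold v1, hsub. rewrite !res_add, !res_scal. hext. }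
    rewrite E in H2.
    assert (H3 : (a * b) * hnorm v <= hnorm (hsub (res (res v)) (hscal (rho ^ 2) v))).
    { rewrite Rmult_assoc. apply Rle_trans with (2 := H2). apply Rmult_le_compat_l; lra. }
    assert (H4 : hnorm (hsub (res (res v)) (hscal (rho ^ 2) v)) ^ 2 <= rho ^ 4 * hnorm v ^ 2 - rho ^ 2 * hnorm (res v) ^ 2).
    { rewrite hnorm_sqr. autorewrite with ip.
      rewrite (ip_sym v (res (res v))), (res_sym (res v) v), <- !hnorm_sqr.
      assert (H5 := Hrho (res v) (orth_eigen_res v Hv)).
      assert (H6 : hnorm (res (res v)) ^ 2 <= (rho * hnorm (res v)) ^ 2).
      { apply pow_incr. split; auto using hnorm_pos. }
      nra. }
    assert (H7 : (a * b * hnorm v) ^ 2 <= hnorm (hsub (res (res v)) (hscal (rho ^ 2) v)) ^ 2).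
    { apply pow_incr. split; auto. apply Rmult_le_pos; [nra | apply hnorm_pos]. }
    apply Rmult_le_reg_l with (rho ^ 2); [nra|].
    replace (rho ^ 2 * (q * hnorm v ^ 2)) with (rho ^ 4 * hnorm v ^ 2 - (a * b * hnorm v) ^ 2).
    - lra.
    - unfold q. field. lra. }
  assert (Hqlt : q < rho ^ 2).
  { unfold q. assert (0 < (a * b) ^ 2 / rho ^ 2).
    { apply Rdiv_lt_0_compat; [apply pow_lt; now apply Rmult_lt_0_compat | now apply pow_lt]. }
    lra. }
  assert (Hle : rho <= sqrt (Rmax 0 q)).
  { apply Hlub. intros r (v & Hv & Hv1 & ->). apply hnorm_le_sqr; [apply sqrt_pos|].
    rewrite pow2_sqrt by apply Rmax_l. rewrite <- hnorm_sqr.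
    apply Rle_trans with (1 := Hq v Hv).
    assert (H0 := hnorm_pos v). assert (H1 := Rmax_l 0 q). assert (H2 := Rmax_r 0 q).
    assert (0 <= hnorm v ^ 2 <= 1) by nra. nra. }
  assert (Hrho2 : rho ^ 2 <= sqrt (Rmax 0 q) ^ 2) by (apply pow_incr; lra).
  rewrite pow2_sqrt in Hrho2 by apply Rmax_l.
  assert (0 < rho ^ 2) by (apply pow_lt; lra).
  revert Hrho2. unfold Rmax. destruct (Rle_dec 0 q); lra.
Qed.

End Resolvent.

Lemma eigen_trivial_low g c1 c2 mu u : gr g c1 c2 u (hscal mu u) -> mu <= - kap0 g c1 c2 -> u = hzero.
Proof.
  intros Hu Hmu. apply (eigen_neg_shift g c1 c2 (- mu)) with (mu := mu); auto; lra.
Qed.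

(** * Enumeration of the eigenvalues *)

(* [sum_n] lives in the carrier of Coquelicot's [AbelianMonoid]; [ring] and [field] need the equation at type [R]. *)
Ltac rring := match goal with |- @eq _ ?a ?b => change (@eq R a b) end; ring.
Ltac rfield := match goal with |- @eq _ ?a ?b => change (@eq R a b) end; field.

Lemma sum_n_eq (a b : nat -> R) n : (forall k, (k <= n)%nat -> a k = b k) -> sum_n a n = sum_n b n.
Proof. intros H. apply sum_n_ext_loc. exact H. Qed.

Lemma sum_n_zero n : sum_n (fun _ => 0) n = 0.
Proof. induction n as [|n IH]; [apply sum_n_0 | rewrite sum_n_S, IH; rring]. Qed.

Lemma sum_n_single (a : nat -> R) j n : (j <= n)%nat -> (forall k, (k <= n)%nat -> k <> j -> a k = 0) ->
  sum_n a n = a j.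
Proof.
  intros Hj H. induction n as [|n IH].
  - replace j with 0%nat by lia. apply sum_n_0.
  - rewrite sum_n_S. destruct (Nat.eq_dec j (S n)) as [->|Hne].
    + rewrite (sum_n_eq a (fun _ => 0)), sum_n_zero; [rring|]. intros k Hk. apply H; lia.
    + rewrite IH; [|lia|intros; apply H; lia]. rewrite (H (S n)) by lia. rring.
Qed.

(** Gaussian elimination of the last unknown: n homogeneous equations in the n + 1 unknowns 0..n. It
    supplies test vectors for the unboundedness of the spectrum and for min-max. *)
Lemma underdetermined n : forall M : nat -> nat -> R, exists alpha : nat -> R,
  (exists k, (k <= n)%nat /\ alpha k <> 0) /\
  forall j, (j < n)%nat -> sum_n (fun k => M j k * alpha k) n = 0.
Proof.
  induction n as [|n IH]; intros M.
  - exists (fun _ => 1). split; [exists 0%nat; split; [lia | lra] | intros; lia].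
  - destruct (classic (exists j0, (j0 < S n)%nat /\ M j0 (S n) <> 0)) as [(j0 & Hj0 & Hne)|Hall].
    (* [sk] enumerates the equations other than the pivot row [j0]. If no row contains the last
       unknown, its unit vector is a solution (second case). *)
    + set (sk := fun j => if lt_dec j j0 then j else S j).
      destruct (IH (fun j k => M (sk j) k - M (sk j) (S n) / M j0 (S n) * M j0 k)) as (al & (k0 & Hk0 & Hal) & Heq).
      set (t := - sum_n (fun k => M j0 k * al k) n / M j0 (S n)).
      exists (fun k => if Nat.eq_dec k (S n) then t else al k). split.
      { exists k0. split; [lia|]. destruct (Nat.eq_dec k0 (S n)); [lia | exact Hal]. }
      assert (Hs : forall j, sum_n (fun k => M j k * (if Nat.eq_dec k (S n) then t else al k)) (S n)
                   = sum_n (fun k => M j k * al k) n + M j (S n) * t).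
      { intros j. rewrite sum_n_S. destruct (Nat.eq_dec (S n) (S n)) as [_|]; [|lia]. f_equal.
        apply sum_n_eq. intros k Hk. destruct (Nat.eq_dec k (S n)); [lia | reflexivity]. }
      intros j Hj. rewrite Hs. destruct (Nat.eq_dec j j0) as [->|Hjj].
      { unfold t. rfield. exact Hne. }
      assert (Hex : exists i, (i < n)%nat /\ sk i = j).
      { unfold sk. destruct (lt_dec j j0) as [Hl|Hl].
        - exists j. destruct (lt_dec j j0); [split; lia | lia].
        - exists (pred j). destruct (lt_dec (pred j) j0); [lia | split; lia]. }
      destruct Hex as (i & Hi & <-). specialize (Heq i Hi).
      assert (E : sum_n (fun k => (M (sk i) k - M (sk i) (S n) / M j0 (S n) * M j0 k) * al k) n =
        sum_n (fun k => M (sk i) k * al k) n + (- (M (sk i) (S n) / M j0 (S n))) * sum_n (fun k => M j0 k * al k) n).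
      { rewrite <- sum_n_scal, <- sum_n_add. apply sum_n_eq. intros k _. rring. }
      rewrite E in Heq. rewrite <- Heq. unfold t. rfield. exact Hne.
    + exists (fun k => if Nat.eq_dec k (S n) then 1 else 0). split.
      { exists (S n). split; [lia|]. destruct (Nat.eq_dec (S n) (S n)); [lra | lia]. }
      intros j Hj. rewrite (sum_n_eq _ (fun _ => 0)); [apply sum_n_zero|].
      intros k Hk. destruct (Nat.eq_dec k (S n)) as [->|_]; [|rring].
      destruct (Req_dec (M j (S n)) 0) as [->|Hne]; [rring|]. exfalso. apply Hall. now exists j.
Qed.

Lemma sum_n_fin (a : nat -> R) N n : (forall k, (N < k)%nat -> a k = 0) -> (N <= n)%nat -> sum_n a n = sum_n a N.
Proof.
  intros H Hn. induction Hn as [|n Hn IH]; [reflexivity|]. rewrite sum_n_S, IH, H by lia. rring.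
Qed.

Lemma is_series_fin (a : nat -> R) N : (forall k, (N < k)%nat -> a k = 0) -> is_series a (sum_n a N).
Proof.
  intros H. change (is_lim_seq (sum_n a) (sum_n a N)).
  apply is_lim_seq_ext_loc with (u := fun _ => sum_n a N); [|apply is_lim_seq_const].
  exists N. intros n Hn. symmetry. now apply sum_n_fin.
Qed.

Definition trunc (N : nat) (a : nat -> R) (n : nat) : R := if le_dec n N then a n else 0.

Lemma trunc_l2 N a : l2 (trunc N a).
Proof.
  exists (sum_n (fun k => trunc N a k ^ 2) N). apply is_series_fin.
  intros k Hk. unfold trunc. destruct (le_dec k N); [lia | rring].
Qed.

Lemma ip_trunc N a y : ip (mk_ell2 _ (trunc_l2 N a)) y = sum_n (fun k => a k * y k) N.
Proof.
  unfold ip. simpl coord. transitivity (sum_n (fun k => trunc N a k * y k) N).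
  - apply is_series_unique, is_series_fin. intros k Hk. unfold trunc. destruct (le_dec k N); [lia | rring].
  - apply sum_n_eq. intros k Hk. unfold trunc. destruct (le_dec k N); [reflexivity | lia].
Qed.

(** * Finite orthonormal systems and discreteness of the eigenvalues *)

Fixpoint hsum (a : nat -> R) (e : nat -> ell2) (n : nat) : ell2 :=
  match n with
  | O => hscal (a O) (e O)
  | S m => hadd (hsum a e m) (hscal (a (S m)) (e (S m)))
  end.

Lemma ip_hsum_l a e n y : ip (hsum a e n) y = sum_n (fun k => a k * ip (e k) y) n.
Proof.
  induction n as [|n IH]; cbn [hsum].
  - now rewrite ip_scal_l, sum_n_0.
  - now rewrite ip_add_l, ip_scal_l, sum_n_S, IH.
Qed.

Lemma hsum_coord a e n j : hsum a e n j = sum_n (fun k => a k * e k j) n.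
Proof.
  induction n as [|n IH]; cbn [hsum].
  - now rewrite sum_n_0.
  - rewrite sum_n_S, <- IH. reflexivity.
Qed.

Lemma gr_hsum g c1 c2 a e f n : (forall k, (k <= n)%nat -> gr g c1 c2 (e k) (f k)) ->
  gr g c1 c2 (hsum a e n) (hsum a f n).
Proof.
  induction n as [|n IH]; intros H; cbn [hsum].
  - apply gr_scal, H. lia.
  - apply gr_add; [apply IH; intros; apply H; lia | apply gr_scal, H; lia].
Qed.

Definition orthonormal_to (n : nat) (e : nat -> ell2) : Prop :=
  forall i j, (i <= n)%nat -> (j <= n)%nat -> ip (e i) (e j) = if Nat.eq_dec i j then 1 else 0.

Lemma ip_hsum_e a e n j : orthonormal_to n e -> (j <= n)%nat -> ip (hsum a e n) (e j) = a j.
Proof.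
  intros H Hj. rewrite ip_hsum_l, (sum_n_single _ j); auto.
  - rewrite H by auto. destruct (Nat.eq_dec j j); [ring | lia].
  - intros k Hk Hne. rewrite H by auto. destruct (Nat.eq_dec k j); [lia | rring].
Qed.

Lemma ip_hsum_hsum a e n : orthonormal_to n e -> ip (hsum a e n) (hsum a e n) = sum_n (fun k => a k ^ 2) n.
Proof.
  intros H. rewrite ip_hsum_l. apply sum_n_eq. intros k Hk.
  rewrite ip_sym, ip_hsum_e by auto. rring.
Qed.

Lemma bessel e n x : orthonormal_to n e -> sum_n (fun k => ip x (e k) ^ 2) n <= ip x x.
Proof.
  intros H. set (s := hsum (fun k => ip x (e k)) e n).
  assert (H1 := ip_pos (hsub x s)). autorewrite with ip in H1. rewrite (ip_sym x s) in H1.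
  assert (H2 : ip s s = sum_n (fun k => ip x (e k) ^ 2) n) by now apply ip_hsum_hsum.
  assert (H3 : ip s x = sum_n (fun k => ip x (e k) ^ 2) n).
  { unfold s. rewrite ip_hsum_l. apply sum_n_eq. intros k _. rewrite (ip_sym (e k)). rring. }
  lra.
Qed.

(** Bessel for the k-th standard basis vector: its projection [s] has squared norm [t] and k-th
    coordinate [t], so t^2 <= t. *)
Lemma bessel_coord e n k : orthonormal_to n e -> sum_n (fun i => e i k ^ 2) n <= 1.
Proof.
  intros H. set (s := hsum (fun i => e i k) e n). set (t := sum_n (fun i => e i k ^ 2) n).
  assert (H1 : ip s s = t) by now apply ip_hsum_hsum.
  assert (H2 : s k = t).
  { unfold s. rewrite hsum_coord. apply sum_n_eq. intros; rring. }
  assert (H3 := coord_sqr_le s k). rewrite H1, H2 in H3.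
  assert (0 <= t) by (apply sum_n_nonneg; intros; apply pow2_ge_0). nra.
Qed.

(** By [eigen_coord0] an eigenvector never vanishes at coordinate 0, so this normalization is
    possible and selects exactly one vector. *)
Definition is_eig g c1 c2 (mu : R) : Prop :=
  exists u, gr g c1 c2 u (hscal mu u) /\ ip u u = 1 /\ 0 < u 0%nat.

Lemma eigen_coord0 g c1 c2 mu (u : ell2) : g <> 0 -> gr g c1 c2 u (hscal mu u) -> u 0%nat = 0 -> u = hzero.
Proof.
  intros Hg Hu H0. apply ell2_ext. intros n. simpl.
  rewrite (eigen_pol g c1 c2 mu u Hg Hu n), H0. ring.
Qed.

Lemma is_eig_intro g c1 c2 mu u : g <> 0 -> gr g c1 c2 u (hscal mu u) -> u <> hzero -> is_eig g c1 c2 mu.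
Proof.
  intros Hg Hu Hnz.
  assert (H0 : u 0%nat <> 0). { intros H. apply Hnz. now apply (eigen_coord0 g c1 c2 mu). }
  assert (Hn : 0 < hnorm u).
  { assert (H := hnorm_pos u). destruct (Req_dec (hnorm u) 0) as [He|He]; [|lra].
    now apply hnorm_eq0 in He. }
  assert (Hi := Rinv_0_lt_compat _ Hn).
  exists (hscal (/ hnorm u * sign (u 0%nat)) u). split; [|split].
  - replace (hscal mu _) with (hscal (/ hnorm u * sign (u 0%nat)) (hscal mu u)) by hext. now apply gr_scal.
  - rewrite ip_scal_l, ip_scal_r, <- hnorm_sqr.
    assert (Hs : sign (u 0%nat) * sign (u 0%nat) = 1).
    { destruct (Rdichotomy _ _ H0) as [H|H]; [rewrite sign_eq_m1 by lra | rewrite sign_eq_1 by lra]; ring. }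
    transitivity (sign (u 0%nat) * sign (u 0%nat) * (/ hnorm u * hnorm u) * (/ hnorm u * hnorm u)); [ring|].
    rewrite Hs, Rinv_l by lra. ring.
  - simpl. rewrite Rmult_assoc. apply Rmult_lt_0_compat; auto.
    destruct (Rdichotomy _ _ H0) as [H|H]; [rewrite sign_eq_m1 by lra | rewrite sign_eq_1 by lra]; lra.
Qed.

Lemma eigen_orth g c1 c2 mu nu u v : gr g c1 c2 u (hscal mu u) -> gr g c1 c2 v (hscal nu v) ->
  mu <> nu -> ip u v = 0.
Proof.
  intros Hu Hv Hne. assert (H := gr_sym _ _ _ _ _ _ _ Hu Hv). autorewrite with ip in H.
  apply Rmult_eq_reg_l with (mu - nu); lra.
Qed.

Lemma is_eig_lower g c1 c2 mu : is_eig g c1 c2 mu -> - kap0 g c1 c2 < mu.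
Proof.
  intros (u & Hu & Hn & _). apply Rnot_le_lt. intros Hle.
  rewrite (eigen_trivial_low g c1 c2 mu u Hu Hle), ip_zero_l in Hn. lra.
Qed.

(* Each unit eigenvector has half of its mass in the first [n0 + 1] coordinates, while by
   Bessel orthonormal vectors have total mass at most 1 in each coordinate. *)
Lemma eig_card g c1 c2 M : exists K : nat, forall n (f : nat -> R),
  (forall i, (i < n)%nat -> is_eig g c1 c2 (f i) /\ Rabs (f i) <= M) ->
  (forall i j, (i < j < n)%nat -> f i <> f j) -> (n <= K)%nat.
Proof.
  destruct (large_nat (4 * wbound g c1 c2 ^ 2 * (M ^ 2 + 4)) (1 / 2) ltac:(lra)) as [n0 Hn0].
  exists (2 * (S n0))%nat. intros n f Hf Hinj. destruct n as [|n]; [lia|].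
  assert (Hch : exists e : nat -> ell2, forall i, (i < S n)%nat ->
     gr g c1 c2 (e i) (hscal (f i) (e i)) /\ ip (e i) (e i) = 1).
  { exists (fun i => epsilon (inhabits hzero) (fun u => gr g c1 c2 u (hscal (f i) u) /\ ip u u = 1)).
    intros i Hi. apply (epsilon_spec (inhabits hzero) (fun u => gr g c1 c2 u (hscal (f i) u) /\ ip u u = 1)).
    destruct (Hf i Hi) as [(u & H1 & H2 & _) _]. now exists u. }
  destruct Hch as [e He].
  assert (Hon : orthonormal_to n e).
  { intros i j Hi Hj. destruct (Nat.eq_dec i j) as [->|Hne]; [apply He; lia|].
    destruct (He i ltac:(lia)) as [Hei _]. destruct (He j ltac:(lia)) as [Hej _].
    apply (eigen_orth _ _ _ _ _ _ _ Hei Hej).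
    destruct (lt_dec i j); [apply Hinj; lia | apply not_eq_sym, Hinj; lia]. }
  assert (Hhalf : forall i, (i <= n)%nat -> 1 / 2 <= sum_n (fun k => e i k ^ 2) n0).
  { intros i Hi. destruct (He i ltac:(lia)) as [Hei Hn]. destruct (Hf i ltac:(lia)) as [_ HM].
    assert (H := gr_tail _ _ _ _ _ n0 Hei). rewrite Hn, ip_scal_l, ip_scal_r, Hn in H.
    assert (Hb : 4 * wbound g c1 c2 ^ 2 * (f i * (f i * 1) + 4 * 1) / INR (S n0) <=
       4 * wbound g c1 c2 ^ 2 * (M ^ 2 + 4) / INR (S n0)).
    { apply Rmult_le_compat_r. { apply Rlt_le, Rinv_0_lt_compat, lt_0_INR. lia. }
      apply Rmult_le_compat_l. { assert (Hw := pow2_ge_0 (wbound g c1 c2)). lra. }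
      assert (f i ^ 2 <= M ^ 2). { rewrite <- (pow2_abs (f i)). apply pow_incr. split; [apply Rabs_pos | exact HM]. }
      lra. }
    lra. }
  assert (Hlow : INR (S n) * (1 / 2) <= sum_n (fun i => sum_n (fun k => e i k ^ 2) n0) n).
  { rewrite <- (sum_n_const n (1 / 2)). apply sum_n_le. exact Hhalf. }
  assert (Hup : sum_n (fun i => sum_n (fun k => e i k ^ 2) n0) n <= INR (S n0) * 1).
  { assert (Hsw : sum_n (fun i => sum_n (fun k => e i k ^ 2) n0) n =
      sum_n (fun k => sum_n (fun i => e i k ^ 2) n) n0) by exact (sum_n_switch (fun i k => e i k ^ 2) n n0).
    rewrite Hsw, <- (sum_n_const n0 1). apply sum_n_le. intros k _. now apply bessel_coord. }
  apply INR_le. rewrite mult_INR. simpl (INR 2). change 2%nat with (S 1). rewrite (S_INR 1), INR_1. lra.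
Qed.

Lemma finite_enum (E : R -> Prop) (K : nat) :
  (forall n (f : nat -> R), (forall i, (i < n)%nat -> E (f i)) ->
     (forall i j, (i < j < n)%nat -> f i <> f j) -> (n <= K)%nat) ->
  exists n (f : nat -> R), forall x, E x -> exists i, (i < n)%nat /\ x = f i.
Proof.
  intros HK. apply NNPP. intros Hno.
  assert (H : forall n, exists f : nat -> R, (forall i, (i < n)%nat -> E (f i)) /\
     (forall i j, (i < j < n)%nat -> f i <> f j)).
  { induction n as [|n [f [Hf Hinj]]].
    - exists (fun _ => 0). split; intros; lia.
    - apply NNPP. intros Hn. apply Hno. exists n, f. intros x Hx. apply NNPP. intros Hx'. apply Hn.
      exists (fun i => if Nat.eq_dec i n then x else f i). split.
      + intros i Hi. destruct (Nat.eq_dec i n); auto. apply Hf. lia.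
      + intros i j Hij. destruct (Nat.eq_dec i n); [lia|]. destruct (Nat.eq_dec j n).
        * intros Heq. apply Hx'. exists i. split; [lia | auto].
        * apply Hinj. lia. }
  destruct (H (S K)) as [f [Hf Hinj]]. specialize (HK (S K) f Hf Hinj). lia.
Qed.

(** Bounded eigenvalues would be finitely many by [eig_card]. A nonzero finitely supported vector
    orthogonal to the corresponding [pol] sequences then exists by counting unknowns, contradicting
    [eigen_complete]. *)
Lemma eig_unbounded g c1 c2 M : g <> 0 -> exists mu, is_eig g c1 c2 mu /\ M < mu.
Proof.
  intros Hg. apply NNPP. intros Hno.
  assert (HM : forall mu, is_eig g c1 c2 mu -> Rabs mu <= Rmax (Rabs M) (kap0 g c1 c2)).
  { intros mu Hmu. assert (H1 := is_eig_lower _ _ _ _ Hmu).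
    assert (H2 : mu <= M). { apply Rnot_lt_le. intros H. apply Hno. now exists mu. }
    assert (H3 := Rmax_l (Rabs M) (kap0 g c1 c2)). assert (H4 := Rmax_r (Rabs M) (kap0 g c1 c2)).
    assert (H5 := Rle_abs M). apply Rabs_le. lra. }
  destruct (eig_card g c1 c2 (Rmax (Rabs M) (kap0 g c1 c2))) as [K HK].
  destruct (finite_enum (is_eig g c1 c2) K) as (n & f & Hf).
  { intros n f Hf Hinj. apply (HK n f); auto. }
  destruct (underdetermined n (fun j k => pol g c1 c2 (f j) k)) as (al & (k0 & Hk0 & Hal) & Hz).
  set (z := mk_ell2 _ (trunc_l2 n al)).
  assert (Hz0 : z = hzero).
  { apply (eigen_complete g c1 c2 (kap0 g c1 c2) (Rle_refl _) Hg). intros mu u Hu.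
    destruct (classic (u = hzero)) as [->|Hnz]. { rewrite ip_sym. apply ip_zero_l. }
    destruct (Hf mu (is_eig_intro _ _ _ _ u Hg Hu Hnz)) as (j & Hj & Ej). subst mu.
    unfold z. rewrite ip_trunc.
    transitivity (u 0%nat * sum_n (fun k => pol g c1 c2 (f j) k * al k) n).
    - rewrite <- sum_n_scal. apply sum_n_eq. intros k _. rewrite (eigen_pol g c1 c2 (f j) u Hg Hu k). ring.
    - rewrite (Hz j Hj). ring. }
  assert (H := f_equal (fun v => coord v k0) Hz0). simpl in H. unfold trunc in H.
  destruct (le_dec k0 n); [contradiction | lia].
Qed.

(** Above every point [E] has a least element: otherwise dependent choice produces an infinite
    strictly decreasing sequence in a bounded part of [E]. The enumeration iterates this successor,
    starting from the lower bound [L]. *)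
Lemma enumerate_discrete (E : R -> Prop) (L : R) :
  (forall x, E x -> L < x) -> (forall M, exists x, E x /\ M < x) ->
  (forall M, exists K : nat, forall n (f : nat -> R), (forall i, (i < n)%nat -> E (f i) /\ Rabs (f i) <= M) ->
     (forall i j, (i < j < n)%nat -> f i <> f j) -> (n <= K)%nat) ->
  exists lam : nat -> R, (forall n, lam n < lam (S n)) /\ (forall n, E (lam n)) /\
    (forall x, E x -> exists n, x = lam n) /\ is_lim_seq lam p_infty.
Proof.
  intros HL Hunb Hcard.
  assert (Hnext : forall x, exists e, E e /\ x < e /\ forall e', E e' -> x < e' -> e <= e').
  { intros x. apply NNPP. intros Hno.
    destruct (Hunb x) as [e0 [He0 Hx0]].
    assert (Hdesc : forall e, exists e', E e /\ x < e -> E e' /\ x < e' /\ e' < e).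
    (* The value 0 for points outside the set is arbitrary; it only makes the relation total for
       [choice]. *)
    { intros e. destruct (classic (E e /\ x < e)) as [[He Hx]|Hn]; [|exists 0; tauto].
      apply NNPP. intros Hn. apply Hno. exists e. split; [auto | split; [auto|]].
      intros e' He' Hx'. apply Rnot_lt_le. intros Hlt. apply Hn. exists e'. tauto. }
    apply choice in Hdesc. destruct Hdesc as [d Hd].
    set (f := fix f n := match n with O => e0 | S m => d (f m) end).
    assert (Hf : forall n, E (f n) /\ x < f n).
    { induction n as [|n IH]; [now split|]. simpl. destruct (Hd _ IH) as (H1 & H2 & _). now split. }
    assert (Hdec : forall i k, f (S (i + k)) < f i).
    { intros i k. induction k as [|k IH].
      - rewrite Nat.add_0_r. simpl. now destruct (Hd _ (Hf i)) as (_ & _ & H).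
      - rewrite Nat.add_succ_r. apply Rlt_trans with (2 := IH). simpl. now destruct (Hd _ (Hf (S (i + k)))) as (_ & _ & H). }
    destruct (Hcard (Rmax (Rabs x) (Rabs e0))) as [K HK].
    assert (H : (S K <= K)%nat); [|lia]. apply (HK (S K) f).
    - intros i _. split; [apply Hf|].
      assert (H1 : f i <= e0).
      { destruct i as [|i]; [apply Rle_refl|]. apply Rlt_le. apply (Hdec 0%nat i). }
      destruct (Hf i) as [_ H2]. apply Rabs_le.
      assert (H3 := Rmax_l (Rabs x) (Rabs e0)). assert (H4 := Rmax_r (Rabs x) (Rabs e0)).
      assert (H5 := Rle_abs e0). assert (H6 := Rle_abs (- x)). rewrite Rabs_Ropp in H6. lra.
    - intros i j Hij. apply Rgt_not_eq. replace j with (S (i + (j - i - 1))) by lia. apply Hdec. }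
  apply choice in Hnext. destruct Hnext as [nx Hnx].
  set (lam := fix lam n := match n with O => nx L | S m => nx (lam m) end).
  assert (Hlam : forall n, lam n < lam (S n)) by (intros n; simpl; apply Hnx).
  assert (HE : forall n, E (lam n)) by (intros [|n]; simpl; apply Hnx).
  assert (Hmono : forall i k, lam i <= lam (i + k)%nat).
  { intros i k. induction k as [|k IH]; [rewrite Nat.add_0_r; apply Rle_refl|].
    rewrite Nat.add_succ_r. apply Rle_trans with (1 := IH), Rlt_le, Hlam. }
  assert (Hinf : forall M, exists n, M < lam n).
  { intros M. apply NNPP. intros Hno.
    destruct (Hcard (Rmax (Rabs L) (Rabs M))) as [K HK].
    assert (H : (S K <= K)%nat); [|lia]. apply (HK (S K) lam).
    - intros i _. split; [apply HE|].
      assert (H1 : lam i <= M). { apply Rnot_lt_le. intros H. apply Hno. now exists i. }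
      assert (H2 := HL _ (HE i)). apply Rabs_le.
      assert (H3 := Rmax_l (Rabs L) (Rabs M)). assert (H4 := Rmax_r (Rabs L) (Rabs M)).
      assert (H5 := Rle_abs M). assert (H6 := Rle_abs (- L)). rewrite Rabs_Ropp in H6. lra.
    - intros i j Hij. apply Rlt_not_eq. apply Rlt_le_trans with (1 := Hlam i).
      replace j with (S i + (j - S i))%nat by lia. apply Hmono. }
  exists lam. split; [exact Hlam | split; [exact HE | split]].
  - intros x Hx. destruct (Hinf x) as [n Hn]. clear Hinf. induction n as [|n IH].
    + exfalso. simpl in Hn. destruct (Hnx L) as (_ & _ & Hmin). specialize (Hmin x Hx (HL x Hx)). lra.
    + destruct (Rlt_le_dec x (lam n)) as [H|[H|H]].
      * now apply IH.
      * exfalso. simpl in Hn. destruct (Hnx (lam n)) as (_ & _ & Hmin). specialize (Hmin x Hx H). lra.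
      * now exists n.
  - apply is_lim_seq_spec. intros M. destruct (Hinf M) as [n Hn]. exists n. intros m Hm.
    apply Rlt_le_trans with (1 := Hn). replace m with (n + (m - n))%nat by lia. apply Hmono.
Qed.

(** The interface between the spectral theory of a single matrix and the comparison of different
    parameters. The sign condition [eb_pos] makes the constants in the ladder relations definite. *)
Record eigenbasis g c1 c2 (lam : nat -> R) (e : nat -> ell2) : Prop := {
  eb_incr : forall n, lam n < lam (S n);
  eb_gr : forall n, gr g c1 c2 (e n) (hscal (lam n) (e n));
  eb_pos : forall n, 0 < e n 0%nat;
  eb_orth : forall n, orthonormal_to n e;
  eb_complete : forall z, (forall n, ip z (e n) = 0) -> z = hzero;
  eb_lim : is_lim_seq lam p_infty;
  eb_all : forall mu u, gr g c1 c2 u (hscal mu u) -> u <> hzero -> exists n, mu = lam n }.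

Lemma increasing_lt (lam : nat -> R) : (forall n, lam n < lam (S n)) -> forall i j, (i < j)%nat -> lam i < lam j.
Proof.
  intros H i j Hij. induction Hij as [|j Hij IH]; [apply H | apply Rlt_trans with (1 := IH), H].
Qed.

Lemma increasing_le (lam : nat -> R) : (forall n, lam n < lam (S n)) -> forall i j, (i <= j)%nat -> lam i <= lam j.
Proof.
  intros H i j Hij. destruct (Nat.eq_dec i j) as [->|Hne]; [apply Rle_refl|].
  apply Rlt_le, increasing_lt; auto. lia.
Qed.

Lemma eigenbasis_ex g c1 c2 : g <> 0 -> exists lam e, eigenbasis g c1 c2 lam e.
Proof.
  intros Hg.
  destruct (enumerate_discrete (is_eig g c1 c2) (- kap0 g c1 c2)) as (lam & Hi & HE & Hs & Hl).
  - intros x. apply is_eig_lower.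
  - intros M. now apply eig_unbounded.
  - apply eig_card.
  - apply choice in HE. destruct HE as [e He]. exists lam, e.
    assert (Hon : forall n, orthonormal_to n e).
    { intros n i j _ _. destruct (Nat.eq_dec i j) as [->|Hne]; [apply He|].
      apply (eigen_orth _ _ _ _ _ _ _ (proj1 (He i)) (proj1 (He j))).
      destruct (lt_dec i j) as [H|H].
      - apply Rlt_not_eq. now apply increasing_lt.
      - apply Rgt_not_eq. apply increasing_lt; [auto | lia]. }
    assert (Hall : forall mu u, gr g c1 c2 u (hscal mu u) -> u <> hzero -> exists n, mu = lam n).
    { intros mu u Hu Hnz. apply Hs. now apply is_eig_intro with (u := u). }
    constructor; auto; try (intros n; apply He).
    intros z Hz. apply (eigen_complete g c1 c2 (kap0 g c1 c2) (Rle_refl _) Hg). intros mu u Hu.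
    destruct (classic (u = hzero)) as [->|Hnz]. { rewrite ip_sym. apply ip_zero_l. }
    destruct (Hall mu u Hu Hnz) as [n ->].
    replace u with (hscal (u 0%nat / e n 0%nat) (e n)).
    + rewrite ip_scal_r, Hz. ring.
    + destruct (He n) as (H1 & _ & H2). apply ell2_ext. intros k. simpl.
      rewrite (eigen_pol g c1 c2 _ u Hg Hu k), (eigen_pol g c1 c2 _ (e n) Hg H1 k). field. lra.
Qed.

(** * Resolvent and min-max comparison *)

(** Riesz-Fischer: square-summable coefficients are those of a vector. *)
Lemma hsum_cv a e : (forall n, orthonormal_to n e) -> ex_series (fun k => a k ^ 2) ->
  exists x, hcv (hsum a e) x /\ forall k, ip x (e k) = a k.
Proof.
  intros He Ha.
  assert (Hdiff : forall m k, ip (hsub (hsum a e (m + k)) (hsum a e m)) (hsub (hsum a e (m + k)) (hsum a e m))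
     = sum_n (fun k => a k ^ 2) (m + k) - sum_n (fun k => a k ^ 2) m).
  { intros m k. autorewrite with ip. rewrite !ip_hsum_hsum by apply He.
    rewrite (ip_sym (hsum a e (m + k)) (hsum a e m)).
    assert (H : ip (hsum a e m) (hsum a e (m + k)) = sum_n (fun k => a k ^ 2) m).
    { rewrite ip_hsum_l. apply sum_n_eq. intros j Hj. rewrite ip_sym, ip_hsum_e by (apply He || lia). rring. }
    rewrite H. rring. }
  assert (Hc : hcauchy (hsum a e)).
  { intros eps Heps.
    assert (Hcau : ex_finite_lim_seq (sum_n (fun k => a k ^ 2))) by (destruct Ha as [l Hl]; now exists l).
    apply ex_lim_seq_cauchy_corr in Hcau.
    destruct (Hcau (mkposreal (eps ^ 2) (pow_lt _ 2 Heps))) as [N HN]. simpl in HN. exists N.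
    assert (Hle : forall m k, (N <= m)%nat -> hnorm (hsub (hsum a e (m + k)) (hsum a e m)) <= eps).
    { intros m k Hm. apply hnorm_le_sqr; [lra|]. rewrite Hdiff.
      apply Rle_trans with (1 := Rle_abs _). left. simpl. apply HN; lia. }
    intros n m Hn Hm. destruct (le_lt_dec m n) as [H|H].
    - replace n with (m + (n - m))%nat by lia. now apply Hle.
    - rewrite hnorm_sub_sym. replace m with (n + (m - n))%nat by lia. now apply Hle. }
  destruct (ell2_complete _ Hc) as [x Hx]. exists x. split; auto.
  intros k. assert (H1 := hcv_ip _ _ (e k) Hx).
  assert (H2 : is_lim_seq (fun n => ip (hsum a e n) (e k)) (a k)).
  { apply is_lim_seq_ext_loc with (u := fun _ => a k); [|apply is_lim_seq_const].
    exists k. intros n Hn. symmetry. now apply ip_hsum_e. }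
  apply is_lim_seq_unique in H1. apply is_lim_seq_unique in H2. rewrite H1 in H2. now injection H2.
Qed.

Section Basis.

Variable e : nat -> ell2.
Hypothesis Hon : forall n, orthonormal_to n e.
Hypothesis Hcomplete : forall z, (forall n, ip z (e n) = 0) -> z = hzero.

Lemma coef_sqr_ex x : ex_series (fun k => ip x (e k) ^ 2).
Proof.
  apply ex_series_bounded with (M := ip x x); [intros; apply pow2_ge_0|].
  intros n. now apply bessel.
Qed.

Lemma fourier_cv x : hcv (hsum (fun k => ip x (e k)) e) x.
Proof.
  destruct (hsum_cv (fun k => ip x (e k)) e Hon (coef_sqr_ex x)) as [s [Hs Hk]].
  assert (H : hsub s x = hzero). { apply Hcomplete. intros n. rewrite ip_sub_l, Hk. ring. }
  assert (E : s = x).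
  { apply ell2_ext. intros n. assert (H1 := f_equal (fun v => coord v n) H). simpl in H1. lra. }
  rewrite E in Hs. exact Hs.
Qed.

Lemma parseval x y : is_series (fun k => ip x (e k) * ip y (e k)) (ip x y).
Proof.
  assert (H := hcv_ip _ _ y (fourier_cv x)).
  change (is_lim_seq (sum_n (fun k => ip x (e k) * ip y (e k))) (ip x y)).
  apply is_lim_seq_ext with (2 := H). intros n. rewrite ip_hsum_l.
  apply sum_n_eq. intros k _. now rewrite (ip_sym (e k)).
Qed.

Lemma parseval_sqr x : is_series (fun k => ip x (e k) ^ 2) (ip x x).
Proof.
  apply is_series_ext with (2 := parseval x x). intros n. rring.
Qed.

End Basis.

(** Each row has at most three entries, so coordinatewise convergence suffices. This is how
    closedness of the operator is used. *)
Lemma jac_apply_cv g c1 c2 (u : nat -> nat -> R) (x : nat -> R) :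
  (forall k, is_lim_seq (fun n => u n k) (x k)) ->
  forall k, is_lim_seq (fun n => jac_apply g c1 c2 (u n) k) (jac_apply g c1 c2 x k).
Proof.
  intros H k. unfold jac_apply.
  apply is_lim_seq_plus'; [apply is_lim_seq_plus'|].
  - destruct k; [apply is_lim_seq_const|]. apply is_lim_seq_mult'; [apply is_lim_seq_const | apply H].
  - apply is_lim_seq_mult'; [apply is_lim_seq_const | apply H].
  - apply is_lim_seq_mult'; [apply is_lim_seq_const | apply H].
Qed.

Lemma dist_positive (lam : nat -> R) mu : is_lim_seq lam p_infty -> (forall n, mu <> lam n) ->
  exists d, 0 < d /\ forall n, d <= Rabs (lam n - mu).
Proof.
  intros Hl Hne.
  assert (Hfin : forall N, exists d, 0 < d <= 1 /\ forall n, (n < N)%nat -> d <= Rabs (lam n - mu)).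
  { induction N as [|N [d [Hd H]]].
    - exists 1. split; [lra | intros; lia].
    - assert (HN : 0 < Rabs (lam N - mu)). { apply Rabs_pos_lt. specialize (Hne N). lra. }
      assert (Hm1 := Rmin_l d (Rabs (lam N - mu))). assert (Hm2 := Rmin_r d (Rabs (lam N - mu))).
      exists (Rmin d (Rabs (lam N - mu))). split.
      + split; [apply Rmin_pos; lra | lra].
      + intros n Hn. destruct (Nat.eq_dec n N) as [->|Hnn]; [exact Hm2|].
        apply Rle_trans with (1 := Hm1). apply H. lia. }
  apply is_lim_seq_spec in Hl. destruct (Hl (mu + 1)) as [N HN].
  destruct (Hfin N) as [d [Hd H]]. exists d. split; [lra|]. intros n.
  destruct (lt_dec n N) as [Hn|Hn]; [now apply H|].
  assert (H1 := HN n ltac:(lia)). rewrite Rabs_pos_eq; lra.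
Qed.

Lemma in_dom_gr g c1 c2 x y : gr g c1 c2 x y -> in_dom g c1 c2 x.
Proof.
  intros H. split; [apply ell2_prop|]. apply l2_ext with (x := y); [|apply ell2_prop].
  intros n. symmetry. apply H.
Qed.

(** The solution is the spectral expansion with coefficients <y, e_k> / (lam_k - mu). Its partial
    sums satisfy the equation up to the Fourier remainder of y, and the rows pass to the limit. *)
Lemma resolvent_set g c1 c2 lam e mu : eigenbasis g c1 c2 lam e -> (forall n, mu <> lam n) ->
  in_resolvent g c1 c2 mu.
Proof.
  intros Hb Hne. split.
  - intros x [Hx _] Hj n. set (u := mk_ell2 x Hx).
    assert (Hu : gr g c1 c2 u (hscal mu u)) by (intros k; apply Hj).
    destruct (classic (u = hzero)) as [H|H].
    + exact (f_equal (fun v => coord v n) H).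
    + destruct (eb_all _ _ _ _ _ Hb mu u Hu H) as [k Hk]. now apply Hne in Hk.
  - destruct (dist_positive lam mu (eb_lim _ _ _ _ _ Hb) Hne) as [d [Hd Hdn]].
    exists (/ d ^ 2). intros y0 Hy0. set (y := mk_ell2 y0 Hy0).
    assert (Hlm : forall k, lam k - mu <> 0).
    { intros k H. specialize (Hdn k). rewrite H, Rabs_R0 in Hdn. lra. }
    set (a := fun k => ip y (e k) / (lam k - mu)).
    assert (Hak : forall k, a k ^ 2 <= / d ^ 2 * ip y (e k) ^ 2).
    { intros k. unfold a. unfold Rdiv. rewrite Rpow_mult_distr, pow_inv, Rmult_comm.
      apply Rmult_le_compat_r; [apply pow2_ge_0|]. apply Rinv_le_contravar; [now apply pow_lt|].
      rewrite <- (pow2_abs (lam k - mu)). apply pow_incr. split; [lra | apply Hdn]. }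
    assert (Hon := eb_orth _ _ _ _ _ Hb).
    assert (Hsum : forall n, sum_n (fun k => a k ^ 2) n <= / d ^ 2 * ip y y).
    { intros n. apply Rle_trans with (sum_n (fun k => / d ^ 2 * ip y (e k) ^ 2) n).
      - apply sum_n_le. intros k _. apply Hak.
      - rewrite sum_n_scal. apply Rmult_le_compat_l.
        + apply Rlt_le, Rinv_0_lt_compat. now apply pow_lt.
        + now apply bessel. }
    destruct (hsum_cv a e Hon) as [x [Hx Hxk]].
    { apply ex_series_bounded with (M := / d ^ 2 * ip y y); auto. intros; apply pow2_ge_0. }
    assert (Hgr : gr g c1 c2 x (hadd y (hscal mu x))).
    { intros j.
      assert (H1 := jac_apply_cv g c1 c2 (hsum a e) x (fun k => hcv_coord _ _ k Hx) j).
      assert (H2 : is_lim_seq (fun n => jac_apply g c1 c2 (hsum a e n) j) (y j + mu * x j)).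
      { apply is_lim_seq_ext with (u := fun n => hsum (fun k => ip y (e k)) e n j + mu * hsum a e n j).
        - intros n.
          rewrite (gr_hsum g c1 c2 a e (fun k => hscal (lam k) (e k)) n (fun k _ => eb_gr _ _ _ _ _ Hb k) j).
          rewrite !hsum_coord, <- sum_n_scal, <- sum_n_add. apply sum_n_eq. intros k _.
          simpl. unfold a. rfield. apply Hlm.
        - apply is_lim_seq_plus'.
          + apply hcv_coord. apply fourier_cv; auto. exact (eb_complete _ _ _ _ _ Hb).
          + apply is_lim_seq_mult'; [apply is_lim_seq_const | now apply hcv_coord]. }
      apply is_lim_seq_unique in H1. apply is_lim_seq_unique in H2. rewrite H1 in H2. now injection H2. }
    exists x. split; [now apply in_dom_gr with (1 := Hgr) | split].
    + intros n. rewrite (Hgr n). simpl. ring.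
    + change (l2_norm2 y0) with (l2_norm2 y). rewrite !l2_norm2_ip.
      rewrite <- (is_series_unique _ _ (parseval_sqr e Hon (eb_complete _ _ _ _ _ Hb) x)).
      apply Series_le_bound; [intros; apply pow2_ge_0|]. intros n.
      apply Rle_trans with (2 := Hsum n). apply Req_le. apply sum_n_eq. intros k _. now rewrite Hxk.
Qed.

Lemma eigenbasis_spectrum g c1 c2 lam e mu : eigenbasis g c1 c2 lam e ->
  (in_spectrum g c1 c2 mu <-> exists n, mu = lam n).
Proof.
  intros Hb. split.
  - intros Hs. apply NNPP. intros Hn. apply Hs. apply resolvent_set with (1 := Hb).
    intros n Hmu. apply Hn. now exists n.
  - intros [n ->] [Hinj _]. assert (H := eb_pos _ _ _ _ _ Hb n).
    rewrite (Hinj (e n) (in_dom_gr _ _ _ _ _ (eb_gr _ _ _ _ _ Hb n)) (eb_gr _ _ _ _ _ Hb n) 0%nat) in H. lra.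
Qed.

Lemma eigenbasis_eigenvalue g c1 c2 lam e n : eigenbasis g c1 c2 lam e -> is_eigenvalue g c1 c2 (lam n).
Proof.
  intros Hb. exists (e n). split; [|split].
  - exact (in_dom_gr _ _ _ _ _ (eb_gr _ _ _ _ _ Hb n)).
  - exists 0%nat. assert (H := eb_pos _ _ _ _ _ Hb n). lra.
  - exact (eb_gr _ _ _ _ _ Hb n).
Qed.

Lemma eigenbasis_coef g c1 c2 lam e x y k : eigenbasis g c1 c2 lam e -> gr g c1 c2 x y ->
  ip y (e k) = lam k * ip x (e k).
Proof.
  intros Hb Hx. rewrite (gr_sym _ _ _ _ _ _ _ Hx (eb_gr _ _ _ _ _ Hb k)). apply ip_scal_r.
Qed.

Lemma jac_apply_diag_change g c1 c2 c1' c2' x n :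
  jac_apply g c1' c2' x n = jac_apply g c1 c2 x n + (if Nat.even n then c1' - c1 else c2' - c2) * x n.
Proof. unfold jac_apply, jac_diag. destruct (Nat.even n); ring. Qed.

(** Courant-Fischer with an explicit test vector: a combination of the n + 1 lowest eigenvectors of
    the first matrix, orthogonal to the n lowest of the second. Its quadratic forms are bounded by
    lam_n from above and by lam'_n from below, and they differ by a diagonal form of at most
    [tau]. *)
Lemma eigenvalue_monotone g c1 c2 c1' c2' lam e lam' e' tau n :
  eigenbasis g c1 c2 lam e -> eigenbasis g c1' c2' lam' e' ->
  c1' - c1 <= tau -> c2' - c2 <= tau ->
  lam' n <= lam n + tau.
Proof.
  intros Hb Hb' H1 H2.
  destruct (underdetermined n (fun j k => ip (e k) (e' j))) as (al & (k0 & Hk0 & Hal) & Heq).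
  assert (Hon := eb_orth _ _ _ _ _ Hb n).
  set (x := hsum al e n).
  assert (Hgx := gr_hsum g c1 c2 al e (fun k => hscal (lam k) (e k)) n (fun k _ => eb_gr _ _ _ _ _ Hb k)).
  fold x in Hgx. set (y := hsum al (fun k => hscal (lam k) (e k)) n) in *.
  assert (Hxx : ip x x = sum_n (fun k => al k ^ 2) n) by now apply ip_hsum_hsum.
  assert (Hxpos : 0 < ip x x).
  { rewrite Hxx. apply Rlt_le_trans with (al k0 ^ 2).
    - rewrite <- Rsqr_pow2. now apply Rsqr_pos_lt.
    - apply (sum_n_ge_term (fun k => al k ^ 2)); auto. intros; apply pow2_ge_0. }
  assert (Hyx : ip y x <= lam n * ip x x).
  { unfold y. rewrite ip_hsum_l, Hxx, <- sum_n_scal. apply sum_n_le. intros k Hk.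
    rewrite ip_scal_l, ip_sym. unfold x. rewrite ip_hsum_e by auto.
    assert (Hle := increasing_le lam (eb_incr _ _ _ _ _ Hb) k n Hk).
    assert (Hp := pow2_ge_0 (al k)). nra. }
  set (D := fun k => (if Nat.even k then c1' - c1 else c2' - c2) * x k).
  assert (HD : l2 D).
  { apply l2_le with (y := fun k => (Rabs (c1' - c1) + Rabs (c2' - c2)) ^ 2 * x k ^ 2).
    - intros k. unfold D. rewrite Rpow_mult_distr. apply Rmult_le_compat_r; [apply pow2_ge_0|].
      assert (Ha := Rabs_pos (c1' - c1)). assert (Hb0 := Rabs_pos (c2' - c2)).
      destruct (Nat.even k); [rewrite <- (pow2_abs (c1' - c1)) | rewrite <- (pow2_abs (c2' - c2))];
       apply pow_incr; lra.
    - apply (ex_series_scal_l ((Rabs (c1' - c1) + Rabs (c2' - c2)) ^ 2) (fun k => x k ^ 2)). apply ell2_prop. }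
  set (Dx := mk_ell2 D HD).
  assert (HDx : ip Dx x <= tau * ip x x).
  { assert (H : 0 <= ip (hsub (hscal tau x) Dx) x).
    { apply Series_nonneg; [|apply ip_ex]. intros k. simpl. unfold D.
      assert (Hp := pow2_ge_0 (x k)). destruct (Nat.even k); nra. }
    autorewrite with ip in H. lra. }
  assert (Hgx' : gr g c1' c2' x (hadd y Dx)).
  { intros k. rewrite (jac_apply_diag_change g c1 c2), (Hgx k). reflexivity. }
  assert (Hp := parseval e' (eb_orth _ _ _ _ _ Hb') (eb_complete _ _ _ _ _ Hb') (hadd y Dx) x).
  assert (Hq := parseval_sqr e' (eb_orth _ _ _ _ _ Hb') (eb_complete _ _ _ _ _ Hb') x).
  assert (Hge : lam' n * ip x x <= ip (hadd y Dx) x).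
  { rewrite <- (is_series_unique _ _ Hp), <- (is_series_unique _ _ Hq), <- Series_scal_l.
    apply Rminus_le_0. rewrite <- Series_minus.
    - apply Series_nonneg.
      + intros j. rewrite (eigenbasis_coef _ _ _ _ _ _ _ j Hb' Hgx').
        destruct (lt_dec j n) as [Hj|Hj].
        * assert (H0 : ip x (e' j) = 0).
          { unfold x. rewrite ip_hsum_l, <- (Heq j Hj). apply sum_n_eq. intros; rring. }
          rewrite H0. lra.
        * assert (Hle := increasing_le lam' (eb_incr _ _ _ _ _ Hb') n j ltac:(lia)).
          assert (Hsq := pow2_ge_0 (ip x (e' j))). nra.
      + apply (ex_series_minus (V := R_NormedModule)).
        * eexists; exact Hp.
        * apply (ex_series_scal_l (lam' n) (fun j => ip x (e' j) ^ 2)). eexists; exact Hq.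
    - eexists; exact Hp.
    - apply (ex_series_scal_l (lam' n) (fun j => ip x (e' j) ^ 2)). eexists; exact Hq. }
  rewrite ip_add_l in Hge. apply Rmult_le_reg_r with (ip x x); auto. lra.
Qed.

(** * The displaced oscillator and the parity matrix *)

Definition dlower (g : R) (x : nat -> R) (n : nat) : R := lower x n + g * x n.
Definition draise (g : R) (x : nat -> R) (n : nat) : R := raise x n + g * x n.

Lemma jac_diag_cc c n : jac_diag c c n = INR n + c.
Proof. unfold jac_diag. now destruct (Nat.even n). Qed.

Lemma draise_dlower g c x n : draise g (dlower g x) n = jac_apply g c c x n - (c - g ^ 2) * x n.
Proof.
  rewrite jac_apply_lr, jac_diag_cc. unfold draise, dlower, raise, lower. destruct n as [|n].
  - rewrite INR_0. ring.
  - assert (H := sqrt_sqrt (INR (S n)) (pos_INR _)). set (s := sqrt (INR (S n))) in *. rewrite <- H. ring.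
Qed.

Lemma dlower_draise g c x n : dlower g (draise g x) n = jac_apply g c c x n + (g ^ 2 + 1 - c) * x n.
Proof.
  rewrite jac_apply_lr, jac_diag_cc. unfold draise, dlower, raise, lower.
  assert (H := sqrt_sqrt (INR (S n)) (pos_INR _)). set (s := sqrt (INR (S n))) in *.
  rewrite S_INR in H. replace (INR n) with (s * s - 1) by lra. destruct n; ring.
Qed.

(** a + g lowers the eigenvalue by 1. The norm identity is what shows when the lowered vector
    vanishes, and that mu >= c - g^2 for a nonzero [u]. *)
Lemma dlower_eigen g c mu (u : ell2) : gr g c c u (hscal mu u) ->
  exists v : ell2, (forall n, v n = dlower g u n) /\ gr g c c v (hscal (mu - 1) v) /\
    (forall n, draise g v n = (mu - c + g ^ 2) * u n) /\
    ip v v = (mu - c + g ^ 2) * ip u u.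
Proof.
  intros Hu. assert (Hw := gr_wl2 _ _ _ _ _ Hu).
  set (v := hadd (mk_ell2 _ (lower_l2 u Hw)) (hscal g u)).
  assert (Hv : forall n, v n = dlower g u n) by reflexivity.
  assert (Hr : forall n, draise g v n = (mu - c + g ^ 2) * u n).
  { intros n. change (draise g v n) with (draise g (dlower g u) n). rewrite draise_dlower with (c := c), (Hu n).
    simpl. ring. }
  assert (Hgv : gr g c c v (hscal (mu - 1) v)).
  { intros n. assert (H := dlower_draise g c v n).
    assert (E : dlower g (draise g v) n = (mu - c + g ^ 2) * v n).
    { unfold dlower at 1, lower. rewrite !Hr, Hv. unfold dlower, lower. ring. }
    rewrite E in H. cbn [coord hscal]. lra. }
  exists v. repeat split; auto.
  assert (Hwv := gr_wl2 _ _ _ _ _ Hgv).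
  assert (Hip : ip v v = Series (fun n => lower u n * v n) + g * ip u v).
  { unfold v at 1. rewrite ip_add_l, ip_scal_l. reflexivity. }
  rewrite Hip, (lower_raise_adj u v Hw Hwv).
  unfold ip. rewrite <- !Series_scal_l, <- Series_plus.
  - apply Series_ext. intros n. assert (H := Hr n). unfold draise in H. 
    replace ((mu - c + g ^ 2) * (u n * u n)) with (u n * ((mu - c + g ^ 2) * u n)) by ring. rewrite <- H. ring.
  - apply ex_series_mul; [apply ell2_prop | now apply raise_l2].
  - apply (ex_series_scal_l g (fun n => u n * v n)). apply ip_ex.
Qed.

Lemma eigen_multiple g c1 c2 mu (u v : ell2) : g <> 0 -> gr g c1 c2 u (hscal mu u) ->
  gr g c1 c2 v (hscal mu v) -> v 0%nat <> 0 -> u = hscal (u 0%nat / v 0%nat) v.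
Proof.
  intros Hg Hu Hv H0. apply ell2_ext. intros k. simpl.
  rewrite (eigen_pol g c1 c2 _ u Hg Hu k), (eigen_pol g c1 c2 _ v Hg Hv k). field. exact H0.
Qed.

Section Displaced.

Variables (g c : R) (lam : nat -> R) (e : nat -> ell2).
Hypothesis Hg : g <> 0.
Hypothesis Hb : eigenbasis g c c lam e.

Lemma ip_e_self n : ip (e n) (e n) = 1.
Proof.
  rewrite (eb_orth _ _ _ _ _ Hb n n n) by auto. destruct (Nat.eq_dec n n); [reflexivity | lia].
Qed.

(** Either a + g annihilates the eigenvector, which happens only at the bottom c - g^2, or lam_n - 1
    is again an eigenvalue and so has a smaller index. *)
Lemma lam_step n : lam n = c - g ^ 2 \/ c - g ^ 2 < lam n /\ exists k, (k < n)%nat /\ lam n = lam k + 1.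
Proof.
  destruct (dlower_eigen _ _ _ _ (eb_gr _ _ _ _ _ Hb n)) as (v & _ & Hgv & _ & Hn).
  rewrite ip_e_self, Rmult_1_r in Hn. assert (Hp := ip_pos v).
  destruct (Req_dec (ip v v) 0) as [H0|H0]; [left; lra|]. right. split; [lra|].
  assert (Hv : v <> hzero). { intros ->. now rewrite ip_zero_l in H0. }
  destruct (eb_all _ _ _ _ _ Hb _ v Hgv Hv) as [k Hk]. exists k. split; [|lra].
  destruct (lt_dec k n) as [H|H]; auto.
  assert (Hle := increasing_le lam (eb_incr _ _ _ _ _ Hb) n k ltac:(lia)). lra.
Qed.

(** Strict monotonicity excludes the bottom for positive index and forces the predecessor in
    [lam_step] to be the preceding index. The sequence is infinite by construction, so no
    eigenvector has to be exhibited. *)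
Lemma lam_exact n : lam n = INR n - g ^ 2 + c.
Proof.
  induction n as [n IH] using lt_wf_ind. destruct n as [|n].
  - rewrite INR_0. destruct (lam_step 0) as [H|[_ [k [Hk _]]]]; [lra | lia].
  - assert (Hn := IH n ltac:(lia)). assert (Hlt := eb_incr _ _ _ _ _ Hb n).
    destruct (lam_step (S n)) as [H|[_ [k [Hk H]]]].
    + exfalso. assert (Hp := pos_INR n). lra.
    + rewrite (IH k Hk) in H.
      assert (INR n < INR (S k)) by (rewrite S_INR; lra).
      apply INR_lt in H0. replace k with n in H by lia. rewrite S_INR. lra.
Qed.

(** Simplicity makes the lowered vector a multiple of [e n], and its norm gives the modulus. For the
    sign, row 0 of the eigenvalue equation shows that g times coordinate 0 of the lowered vector is
    (n + 1) e_(n+1)(0) > 0; hence the factor g on the left and |g| on the right. *)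
Lemma dlower_e n j : g * dlower g (e (S n)) j = Rabs g * sqrt (INR (S n)) * e n j.
Proof.
  destruct (dlower_eigen _ _ _ _ (eb_gr _ _ _ _ _ Hb (S n))) as (v & Hv & Hgv & _ & Hn).
  rewrite ip_e_self, Rmult_1_r, lam_exact in Hn.
  replace (lam (S n) - 1) with (lam n) in Hgv by (rewrite !lam_exact, S_INR; ring).
  assert (He0 := eb_pos _ _ _ _ _ Hb n). assert (HeS := eb_pos _ _ _ _ _ Hb (S n)).
  assert (E := eigen_multiple g c c _ v (e n) Hg Hgv (eb_gr _ _ _ _ _ Hb n) ltac:(lra)).
  set (tau := v 0%nat / e n 0%nat) in *.
  assert (Htau : tau ^ 2 = INR (S n)).
  { assert (Hn' : ip v v = INR (S n)) by lra. rewrite E in Hn'.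
    rewrite ip_scal_l, ip_scal_r, ip_e_self in Hn'. lra. }
  assert (Hv0 : g * v 0%nat = INR (S n) * e (S n) 0%nat).
  { rewrite Hv. unfold dlower, lower. assert (H := eb_gr _ _ _ _ _ Hb (S n) 0%nat).
    rewrite jac_apply_lr, jac_diag_cc, lam_exact, INR_0 in H. unfold raise, lower in H. simpl in H. lra. }
  assert (HS : 0 < INR (S n)) by (apply lt_0_INR; lia).
  assert (Hpos : 0 < g * tau).
  { unfold tau, Rdiv. rewrite <- Rmult_assoc, Hv0. apply Rmult_lt_0_compat.
    - now apply Rmult_lt_0_compat.
    - now apply Rinv_0_lt_compat. }
  assert (Hgt : g * tau = Rabs g * sqrt (INR (S n))).
  { rewrite <- Htau, <- Rsqr_pow2, sqrt_Rsqr_abs, <- Rabs_mult, Rabs_pos_eq; lra. }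
  rewrite <- Hv, E. simpl. rewrite <- Rmult_assoc, Hgt. reflexivity.
Qed.

Lemma dlower_e0 j : dlower g (e 0%nat) j = 0.
Proof.
  destruct (dlower_eigen _ _ _ _ (eb_gr _ _ _ _ _ Hb 0)) as (v & Hv & _ & _ & Hn).
  rewrite lam_exact, INR_0 in Hn. rewrite <- Hv, (ip_eq0 v); [reflexivity|]. rewrite Hn. ring.
Qed.

Lemma draise_e n j : g * draise g (e n) j = Rabs g * sqrt (INR (S n)) * e (S n) j.
Proof.
  destruct (dlower_eigen _ _ _ _ (eb_gr _ _ _ _ _ Hb (S n))) as (v & Hv & _ & Hr & _).
  specialize (Hr j). rewrite lam_exact in Hr.
  assert (Hgp := Rabs_pos_lt g Hg).
  assert (HS : 0 < INR (S n)) by (apply lt_0_INR; lia).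
  assert (Hs := sqrt_lt_R0 _ HS). assert (Hss := sqrt_sqrt (INR (S n)) ltac:(lra)).
  set (s := sqrt (INR (S n))) in *.
  assert (E : g * draise g v j = Rabs g * s * draise g (e n) j).
  { unfold draise, raise. assert (Hd : forall i, g * v i = Rabs g * s * e n i) by (intros i; rewrite Hv; apply dlower_e).
    destruct j as [|j].
    - rewrite (Rmult_plus_distr_l g), <- (Rmult_assoc g g), (Rmult_assoc g g), Hd. ring.
    - transitivity (sqrt (INR (S j)) * (g * v j) + g * (g * v (S j))); [ring|]. rewrite !Hd. ring. }
  rewrite Hr in E. apply Rmult_eq_reg_l with (Rabs g * s); [|nra].
  transitivity (g * (Rabs g * s * draise g (e n) j)); [ring|]. rewrite <- E.
  replace (INR (S n) - g ^ 2 + c - c + g ^ 2) with (s * s) by lra.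
  assert (Hg2 : g * g = Rabs g * Rabs g) by (rewrite <- Rabs_mult, Rabs_pos_eq; nra).
  transitivity (g * g * (s * s * e (S n) j)); [ring|]. rewrite Hg2. ring.
Qed.

Lemma position_e k j : g * (raise (e k) j + lower (e k) j) =
  Rabs g * (sqrt (INR k) * e (pred k) j + sqrt (INR (S k)) * e (S k) j) - 2 * g ^ 2 * e k j.
Proof.
  assert (H1 := draise_e k j). unfold draise in H1.
  assert (H2 : g * dlower g (e k) j = Rabs g * sqrt (INR k) * e (pred k) j).
  { destruct k as [|k].
    - rewrite dlower_e0, INR_0, sqrt_0. ring.
    - apply dlower_e. }
  unfold dlower in H2. lra.
Qed.

End Displaced.

(** * The parity operator in the eigenbasis *)

Definition psign (n : nat) : R := if Nat.even n then 1 else -1.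

Lemma psign_sqr n : psign n * psign n = 1.
Proof. unfold psign. destruct (Nat.even n); ring. Qed.

Lemma psign_S n : psign (S n) = - psign n.
Proof. unfold psign. rewrite Nat.even_succ, <- Nat.negb_even. destruct (Nat.even n); simpl; ring. Qed.

Lemma par_l2 (x : ell2) : l2 (fun n => psign n * x n).
Proof.
  apply l2_le with (y := fun n => x n ^ 2); [|apply ell2_prop].
  intros n. assert (H := psign_sqr n). apply Req_le.
  transitivity (psign n * psign n * x n ^ 2); [ring|]. rewrite H. ring.
Qed.

Definition par (x : ell2) : ell2 := mk_ell2 _ (par_l2 x).

Lemma par_sym x y : ip (par x) y = ip x (par y).
Proof. apply Series_ext. intros n. simpl. ring. Qed.

Lemma par_par x : par (par x) = x.
Proof.
  apply ell2_ext. intros n. simpl. rewrite <- Rmult_assoc, psign_sqr. ring.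
Qed.

Lemma par_ip x y : ip (par x) (par y) = ip x y.
Proof. now rewrite par_sym, par_par. Qed.

Lemma jac_apply_par g c (x : ell2) n : jac_apply g c c (par x) n =
  psign n * (jac_apply g c c x n - 2 * (g * (raise x n + lower x n))).
Proof.
  rewrite !jac_apply_lr. unfold raise, lower. cbn [coord par]. rewrite psign_S.
  destruct n as [|n]; [ring|]. rewrite psign_S. ring.
Qed.

(** <A0 e_m, P e_k> computed in two ways: through A0 e_m, and through A0 P e_k, where P anticommutes
    with a + a^*. The term 4 g^2 is twice the displacement in [position_e]. *)
Lemma parity_recurrence g c lam e m k : g <> 0 -> eigenbasis g c c lam e ->
  2 * Rabs g * (sqrt (INR k) * ip (e m) (par (e (pred k))) + sqrt (INR (S k)) * ip (e m) (par (e (S k)))) =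
  (INR k - INR m + 4 * g ^ 2) * ip (e m) (par (e k)).
Proof.
  intros Hg Hb.
  set (y := hsub (hscal (lam k) (e k)) (hscal 2 (hsub (hscal (Rabs g)
     (hadd (hscal (sqrt (INR k)) (e (pred k))) (hscal (sqrt (INR (S k))) (e (S k))))) (hscal (2 * g ^ 2) (e k))))).
  assert (Hy : gr g c c (par (e k)) (par y)).
  { intros n. rewrite jac_apply_par, (eb_gr _ _ _ _ _ Hb k n), (position_e g c lam e Hg Hb k n).
    unfold y. cbn [coord par hsub hadd hscal]. ring. }
  assert (H := gr_sym _ _ _ _ _ _ _ (eb_gr _ _ _ _ _ Hb m) Hy).
  rewrite <- (par_sym (e m) y) in H. unfold y in H. autorewrite with ip in H.
  rewrite !(lam_exact g c lam e Hb), !par_sym in H. lra.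
Qed.

(* The recurrence reads [s1 x_(i+1) = h x_i - s0 x_(i-1)] with [s0 <= s1] and [|h| / s1 = O(1/W)],
   so the energy [x_k^2 + x_(k+1)^2] grows by at most a constant factor over [W] steps. *)
Lemma energy_bound (G : R) : 0 < G -> exists C, 0 < C /\
  forall (W N m K : nat) (x : nat -> R), (2 <= W)%nat -> (W ^ 4 <= N)%nat ->
  (N <= m + W)%nat -> (m <= N + W)%nat -> (N <= K + W)%nat -> (K <= N + W)%nat ->
  (forall k, 2 * G * (sqrt (INR k) * x (pred k) + sqrt (INR (S k)) * x (S k)) = (INR k - INR m + 4 * G ^ 2) * x k) ->
  (forall n, sum_n (fun k => x k ^ 2) n <= 1) ->
  x K ^ 2 <= C / INR W.
Proof.
  (* The indices i and m below differ by at most 3 W, so |i - m + 4 G^2| <= (4 + 4 G^2) W. *)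
  intros HG. set (a := (4 + 4 * G ^ 2) / (2 * G)).
  assert (Ha : 0 < a). { unfold a. assert (H := pow2_ge_0 G). apply Rdiv_lt_0_compat; lra. }
  (* Bounds (1 + eta + eta^2)^W for eta = 2 a / W, by 1 + y <= exp y. *)
  set (Q := exp (2 * a + 4 * a ^ 2)).
  assert (HQ : 0 < Q) by apply exp_pos.
  exists (2 * Q). split; [lra|].
  intros W N m K x HW HN Hm1 Hm2 HK1 HK2 Hrec Hsum.
  set (w := INR W).
  assert (Hw : 2 <= w). { unfold w. change 2 with (INR 2). now apply le_INR. }
  assert (HNw : w ^ 4 <= INR N). { unfold w. rewrite <- pow_INR. now apply le_INR. }
  set (En := fun k => x k ^ 2 + x (S k) ^ 2).
  assert (HEn : forall k, 0 <= En k).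
  { intros k. unfold En. assert (H1 := pow2_ge_0 (x k)). assert (H2 := pow2_ge_0 (x (S k))). lra. }
  (* The ratio of |h| <= a w to s1 >= w^2 / 2, both proved below. *)
  set (eta := 2 * a / w).
  assert (Heta : 0 < eta). { apply Rdiv_lt_0_compat; lra. }
  assert (HKN : INR N - w <= INR K <= INR N + w).
  { unfold w. rewrite <- plus_INR. split; [|now apply le_INR].
    apply le_INR in HK1. rewrite plus_INR in HK1. lra. }
  assert (HmN : INR N - w <= INR m <= INR N + w).
  { unfold w. rewrite <- plus_INR. split; [|now apply le_INR].
    apply le_INR in Hm1. rewrite plus_INR in Hm1. lra. }
  assert (Hw3 : 8 <= w ^ 3). { replace 8 with (2 ^ 3) by ring. apply pow_incr. lra. }
  assert (Hw4 : 8 * w <= w ^ 4). { replace (w ^ 4) with (w ^ 3 * w) by ring. apply Rmult_le_compat_r; lra. }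
  assert (Hstep : forall j, INR K - w <= INR j -> (j < K)%nat -> En (S j) <= (1 + eta + eta ^ 2) * En j).
  { intros j Hj HjK. set (i := S j).
    assert (Hi : INR i = INR j + 1) by apply S_INR.
    assert (HiK : INR i <= INR K) by (apply le_INR; unfold i; lia).
    assert (Hi1 : INR (S i) = INR i + 1) by apply S_INR.
    assert (Hrec1 := Hrec i). simpl pred in Hrec1. change (pred i) with j in Hrec1.
    set (s1 := sqrt (INR (S i))) in *. set (s0 := sqrt (INR i)) in *.
    assert (Hs1 : w ^ 2 / 2 <= s1).
    { unfold s1. rewrite <- (sqrt_pow2 (w ^ 2 / 2)) by nra. apply sqrt_le_1_alt. nra. }
    assert (Hs0 : 0 <= s0 <= s1).
    { split; [apply sqrt_pos | apply sqrt_le_1_alt; lra]. }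
    assert (Hs1p : 0 < s1) by nra.
    set (h := (INR i - INR m + 4 * G ^ 2) / (2 * G)).
    assert (Hh : Rabs h <= a * w).
    { unfold h, a, Rdiv. rewrite Rabs_mult, (Rabs_pos_eq (/ _)) by (apply Rlt_le, Rinv_0_lt_compat; lra).
      replace ((4 + 4 * G ^ 2) * / (2 * G) * w) with ((4 + 4 * G ^ 2) * w * / (2 * G)) by ring.
      apply Rmult_le_compat_r; [apply Rlt_le, Rinv_0_lt_compat; lra|]. apply Rabs_le. nra. }
    assert (Hx : s1 * x (S i) = h * x i - s0 * x j).
    { unfold h. apply Rmult_eq_reg_l with (2 * G); [|lra].
      transitivity ((INR i - INR m + 4 * G ^ 2) * x i - 2 * G * (s0 * x j)); [lra|]. field. lra. }
    assert (Hbnd : Rabs (x (S i)) <= eta * Rabs (x i) + Rabs (x j)).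
    { apply Rmult_le_reg_l with s1; auto.
      rewrite <- (Rabs_pos_eq s1) at 1 by lra. rewrite <- Rabs_mult, Hx.
      eapply Rle_trans; [apply Rabs_triang|]. rewrite Rabs_Ropp, !Rabs_mult, (Rabs_pos_eq s0) by lra.
      assert (Hxi := Rabs_pos (x i)). assert (Hxj := Rabs_pos (x j)).
      assert (Hhe : Rabs h <= s1 * eta).
      { apply Rle_trans with (1 := Hh). unfold eta.
        apply Rle_trans with (w ^ 2 / 2 * (2 * a / w)).
        - apply Req_le. field. lra.
        - apply Rmult_le_compat_r; [apply Rlt_le, Heta | exact Hs1]. }
      assert (Rabs h * Rabs (x i) <= s1 * eta * Rabs (x i)) by now apply Rmult_le_compat_r.
      assert (s0 * Rabs (x j) <= s1 * Rabs (x j)) by (apply Rmult_le_compat_r; lra). lra. }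
    unfold En. change (S j) with i.
    rewrite <- (pow2_abs (x i)), <- (pow2_abs (x (S i))), <- (pow2_abs (x j)).
    assert (Hxi := Rabs_pos (x i)). assert (Hxj := Rabs_pos (x j)). assert (HxS := Rabs_pos (x (S i))).
    generalize dependent (Rabs (x i)). generalize dependent (Rabs (x j)). generalize dependent (Rabs (x (S i))).
    clear - Heta. intros A HA B HB D HAB HD.
    assert (A ^ 2 <= (eta * D + B) ^ 2) by (apply pow_incr; lra).
    assert (Hsq := pow2_ge_0 (B - D)).
    assert (0 <= eta * (B - D) ^ 2) by (apply Rmult_le_pos; lra).
    assert (0 <= eta ^ 2 * B ^ 2) by (apply Rmult_le_pos; apply pow2_ge_0).
    nra. }
  assert (Hiter : forall j, (j <= W)%nat -> En K <= (1 + eta + eta ^ 2) ^ j * En (K - j)%nat).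
  { assert (HWK : (W <= K)%nat).
    { apply INR_le. fold w. lra. }
    induction j as [|j IH]; intros Hj.
    - rewrite Nat.sub_0_r, pow_O. lra.
    - apply Rle_trans with (1 := IH ltac:(lia)).
      replace (K - j)%nat with (S (K - S j)) by lia.
      replace ((1 + eta + eta ^ 2) ^ S j) with ((1 + eta + eta ^ 2) ^ j * (1 + eta + eta ^ 2)) by (simpl; ring).
      rewrite Rmult_assoc.
      apply Rmult_le_compat_l; [apply pow_le; nra|].
      apply Hstep; [|lia]. rewrite minus_INR by lia. assert (INR (S j) <= w) by (apply le_INR; lia). lra. }
  assert (HpowQ : forall j, (j <= W)%nat -> (1 + eta + eta ^ 2) ^ j <= Q).
  { intros j Hj. apply Rle_trans with (exp (eta + eta ^ 2) ^ j).
    - apply pow_incr. assert (H := exp_ineq1_le (eta + eta ^ 2)). nra.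
    - assert (Hexp : exp (eta + eta ^ 2) ^ j = exp (INR j * (eta + eta ^ 2))).
      { rewrite <- Rpower_pow by apply exp_pos. unfold Rpower. now rewrite ln_exp. }
      rewrite Hexp. unfold Q.
      assert (Hle : INR j * (eta + eta ^ 2) <= 2 * a + 4 * a ^ 2).
      { apply Rle_trans with (w * (eta + eta ^ 2)).
        - apply Rmult_le_compat_r; [nra|]. now apply le_INR.
        - unfold eta. replace (w * (2 * a / w + (2 * a / w) ^ 2)) with (2 * a + 4 * a ^ 2 / w) by (field; lra).
          apply Rplus_le_compat_l. apply Rmult_le_reg_r with w; [lra|].
          unfold Rdiv. rewrite Rmult_assoc, Rinv_l by lra. nra. }
      destruct Hle as [Hlt|Heq]; [left; now apply exp_increasing | right; now rewrite Heq]. }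
  assert (HsumE : forall n, sum_n En n <= 2).
  { intros n. unfold En. rewrite sum_n_add.
    assert (H1 := Hsum n). assert (H2 := Hsum (S n)).
    rewrite <- (sum_n_shift (fun k => x k ^ 2)) in H2. assert (H3 := pow2_ge_0 (x 0%nat)). lra. }
  (* Averaging: each of the W energies ending at index K is at least [En K / Q], while the total
     energy is at most 2. *)
  assert (Htel : forall j, (j <= W)%nat -> INR j * (En K / Q) <= sum_n En K - sum_n En (K - j)).
  { assert (HWK : (W <= K)%nat).
    { apply INR_le. fold w. lra. }
    induction j as [|j IH]; intros Hj.
    - rewrite Nat.sub_0_r, INR_0. lra.
    - specialize (IH ltac:(lia)). assert (HI := Hiter j ltac:(lia)). assert (HP := HpowQ j ltac:(lia)).
      rewrite S_INR. replace (K - j)%nat with (S (K - S j)) in * by lia. rewrite sum_n_S in IH.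
      assert (En K / Q <= En (S (K - S j))).
      { apply Rmult_le_reg_r with Q; auto. unfold Rdiv. rewrite Rmult_assoc, Rinv_l, Rmult_1_r by lra.
        apply Rle_trans with (1 := HI). rewrite Rmult_comm. apply Rmult_le_compat_l; auto. }
      lra. }
  assert (Hfin := Htel W (le_n _)). fold w in Hfin.
  assert (H2 := HsumE K). assert (H0 := sum_n_nonneg En (K - W) HEn).
  assert (HEK : En K <= 2 * Q / w).
  { apply Rmult_le_reg_r with (w / Q). { apply Rdiv_lt_0_compat; lra. }
    replace (En K * (w / Q)) with (w * (En K / Q)) by (field; lra).
    replace (2 * Q / w * (w / Q)) with 2 by (field; lra). lra. }
  assert (Hx2 := pow2_ge_0 (x (S K))). unfold En in HEK. lra.
Qed.

Lemma parity_matrix_bound g : g <> 0 -> exists C, 0 < C /\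
  forall c lam e (W N m K : nat), eigenbasis g c c lam e -> (2 <= W)%nat -> (W ^ 4 <= N)%nat ->
  (N <= m + W)%nat -> (m <= N + W)%nat -> (N <= K + W)%nat -> (K <= N + W)%nat ->
  ip (e m) (par (e K)) ^ 2 <= C / INR W.
Proof.
  intros Hg. destruct (energy_bound (Rabs g) (Rabs_pos_lt g Hg)) as [C [HC H]].
  exists C. split; auto. intros c lam e W N m K Hb HW HN Hm1 Hm2 HK1 HK2.
  apply (H W N m K (fun k => ip (e m) (par (e k)))); auto.
  - intros k. rewrite pow2_abs. now apply (parity_recurrence g c lam e m k).
  - intros n. rewrite <- (ip_e_self g c lam e Hb m), <- par_ip.
    apply Rle_trans with (2 := bessel e n (par (e m)) (eb_orth _ _ _ _ _ Hb n)).
    apply Req_le, sum_n_eq. intros k _. now rewrite par_sym.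
Qed.

(** * Localization and homotopy *)

Lemma sum_n_cauchy_schwarz (a b : nat -> R) n :
  sum_n (fun k => a k * b k) n ^ 2 <= sum_n (fun k => a k ^ 2) n * sum_n (fun k => b k ^ 2) n.
Proof.
  assert (H := cauchy_schwarz (mk_ell2 _ (trunc_l2 n a)) (mk_ell2 _ (trunc_l2 n b))).
  assert (E : forall f h, ip (mk_ell2 _ (trunc_l2 n f)) (mk_ell2 _ (trunc_l2 n h)) = sum_n (fun k => f k * h k) n).
  { intros f h. rewrite ip_trunc. apply sum_n_eq. intros k Hk. simpl. unfold trunc.
    destruct (le_dec k n); [reflexivity | lia]. }
  rewrite !E in H.
  assert (E2 : forall f : nat -> R, sum_n (fun k => f k ^ 2) n = sum_n (fun k => f k * f k) n).
  { intros f. apply sum_n_eq. intros; rring. }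
  now rewrite !E2.
Qed.

(** Telescoping 1 / p^2 <= 2 / p - 2 / (p + 1) on each side of N; each side contributes at most
    2. *)
Lemma inv_sqr_sum_le (N : nat) M :
  sum_n (fun k => if Nat.eq_dec k N then 0 else / (INR k - INR N) ^ 2) M <= 4.
Proof.
  assert (Hstep : forall p, 1 <= p -> 2 / (p + 1) + / p ^ 2 <= 2 / p).
  { intros p Hp. apply Rmult_le_reg_r with (p ^ 2 * (p + 1)); [nra|].
    replace ((2 / (p + 1) + / p ^ 2) * (p ^ 2 * (p + 1))) with (2 * p ^ 2 + (p + 1)) by (field; lra).
    replace (2 / p * (p ^ 2 * (p + 1))) with (2 * p * (p + 1)) by (field; lra). nra. }
  set (f := fun k => if Nat.eq_dec k N then 0 else / (INR k - INR N) ^ 2).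
  assert (H : if lt_dec M N then sum_n f M <= 2 / (INR N - INR M)
              else sum_n f M <= 4 - 2 / (INR M - INR N + 1)).
  { induction M as [|M IH].
    - rewrite sum_n_0. unfold f. destruct (Nat.eq_dec 0 N) as [<-|Hne].
      + destruct (lt_dec 0 0); [lia|]. rewrite INR_0. lra.
      + destruct (lt_dec 0 N); [|lia]. assert (H1 : 1 <= INR N) by (rewrite <- INR_1; apply le_INR; lia).
        rewrite INR_0. replace ((0 - INR N) ^ 2) with (INR N ^ 2) by ring. rewrite Rminus_0_r.
        assert (H := Hstep (INR N) H1). assert (0 < 2 / (INR N + 1)) by (apply Rdiv_lt_0_compat; lra). lra.
    - rewrite sum_n_S. destruct (lt_dec (S M) N) as [Hlt|Hge].
      + destruct (lt_dec M N); [|lia]. unfold f at 2. destruct (Nat.eq_dec (S M) N); [lia|].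
        assert (Hd : 1 <= INR N - INR (S M)).
        { rewrite <- minus_INR by lia. rewrite <- INR_1. apply le_INR. lia. }
        assert (Hs := Hstep _ Hd).
        replace (INR N - INR (S M) + 1) with (INR N - INR M) in Hs by (rewrite S_INR; ring).
        replace ((INR (S M) - INR N) ^ 2) with ((INR N - INR (S M)) ^ 2) by ring. lra.
      + unfold f at 2. destruct (Nat.eq_dec (S M) N) as [He|Hne].
        * subst N. destruct (lt_dec M (S M)); [|lia]. rewrite S_INR in *.
          replace (INR M + 1 - INR M) with 1 in IH by ring.
          replace (INR M + 1 - (INR M + 1) + 1) with 1 by ring. lra.
        * destruct (lt_dec M N); [lia|].
          assert (Hd : 1 <= INR (S M) - INR N).
          { rewrite <- minus_INR by lia. rewrite <- INR_1. apply le_INR. lia. }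
          assert (Hs := Hstep _ Hd).
          replace (INR M - INR N + 1) with (INR (S M) - INR N) in IH by (rewrite S_INR; ring). lra. }
  destruct (lt_dec M N) as [Hlt|Hge].
  - assert (Hd : 1 <= INR N - INR M).
    { rewrite <- minus_INR by lia. rewrite <- INR_1. apply le_INR. lia. }
    apply Rle_trans with (1 := H). apply Rmult_le_reg_r with (INR N - INR M); [lra|].
    unfold Rdiv. rewrite Rmult_assoc, Rinv_l by lra. lra.
  - assert (Hd : INR N <= INR M) by (apply le_INR; lia).
    assert (0 < 2 / (INR M - INR N + 1)) by (apply Rdiv_lt_0_compat; lra). apply Rle_trans with (1 := H). lra.
Qed.

Lemma dist_to_nat_ge (N k : nat) x : k <> N -> Rabs (x - INR N) <= 1 / 2 ->
  Rabs (INR k - INR N) / 2 <= Rabs (INR k - x) /\ 1 <= Rabs (INR k - INR N).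
Proof.
  intros Hne Hx.
  assert (H1 : 1 <= Rabs (INR k - INR N)).
  { destruct (le_lt_dec k N).
    - rewrite Rabs_minus_sym, <- minus_INR, Rabs_pos_eq by (lia || apply pos_INR).
      rewrite <- INR_1. apply le_INR. lia.
    - rewrite <- minus_INR, Rabs_pos_eq by (lia || apply pos_INR).
      rewrite <- INR_1. apply le_INR. lia. }
  split; auto.
  assert (H2 := Rabs_triang (INR k - x) (x - INR N)).
  replace (INR k - x + (x - INR N)) with (INR k - INR N) in H2 by ring. lra.
Qed.

(** The index N contributes 1 / d^2. For the others |k - x| >= |k - N| / 2, so they add up to at
    most 4 * 4 = 16, which is at most 4 / d^2 as d <= 1/2. *)
Lemma inv_dist_sum_le (N : nat) x M : 0 < Rabs (x - INR N) <= 1 / 2 ->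
  sum_n (fun k => / (INR k - x) ^ 2) M <= 5 / Rabs (x - INR N) ^ 2.
Proof.
  intros [Hd Hx]. set (d := Rabs (x - INR N)) in *.
  assert (Hd2 : 0 < d ^ 2) by now apply pow_lt.
  apply Rle_trans with (sum_n (fun k => (if Nat.eq_dec k N then / d ^ 2 else 0)
     + 4 * (if Nat.eq_dec k N then 0 else / (INR k - INR N) ^ 2)) M).
  - apply sum_n_le. intros k _. destruct (Nat.eq_dec k N) as [->|Hne].
    + unfold d. rewrite pow2_abs. replace ((INR N - x) ^ 2) with ((x - INR N) ^ 2) by ring. lra.
    + destruct (dist_to_nat_ge N k x Hne Hx) as [H1 H2].
      rewrite <- (pow2_abs (INR k - x)), <- (pow2_abs (INR k - INR N)).
      set (a := Rabs (INR k - x)) in *. set (b := Rabs (INR k - INR N)) in *.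
      rewrite Rplus_0_l. replace (4 * / b ^ 2) with (/ (b / 2) ^ 2) by (field; lra).
      apply Rinv_le_contravar; [apply pow_lt; lra | apply pow_incr; lra].
  - rewrite sum_n_add, sum_n_scal. assert (H4 := inv_sqr_sum_le N M).
    assert (H1 : sum_n (fun k => if Nat.eq_dec k N then / d ^ 2 else 0) M <= / d ^ 2).
    { destruct (le_lt_dec N M) as [H|H].
      - rewrite (sum_n_single _ N) by (exact H || (intros k _ Hk; destruct (Nat.eq_dec k N); [contradiction | reflexivity])).
        destruct (Nat.eq_dec N N); [lra | lia].
      - rewrite (sum_n_eq _ (fun _ => 0)), sum_n_zero.
        + now apply Rlt_le, Rinv_0_lt_compat.
        + intros k Hk. destruct (Nat.eq_dec k N); [lia | reflexivity]. }
    assert (H16 : 16 <= 4 / d ^ 2).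
    { assert (d ^ 2 <= (1 / 2) ^ 2) by (apply pow_incr; lra).
      apply Rmult_le_reg_r with (d ^ 2); auto. unfold Rdiv. rewrite Rmult_assoc, Rinv_l by lra. lra. }
    apply Rle_trans with (/ d ^ 2 + 4 * 4).
    + apply Rplus_le_compat; [exact H1 | apply Rmult_le_compat_l; [lra | exact H4]].
    + unfold Rdiv in *. lra.
Qed.

Lemma sqr_le_of_mul (x a b : R) : 0 < a -> a * x ^ 2 <= b -> x ^ 2 <= b / a.
Proof.
  intros Ha H. apply Rmult_le_reg_l with a; auto. apply Rle_trans with (1 := H).
  apply Req_le. field. lra.
Qed.

(* Split [u] into its components [un] with index within [W] of [N] and the rest [uf].  The
   weights [T / |k - x|] make [uf] of size [T / W] and the [un] part is controlled by the
   smallness of the matrix of [P]: a Hilbert-Schmidt estimate written out on coefficients. *)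
Lemma eigenvalue_localization g T : g <> 0 -> exists C, 0 < C /\
  forall c lam e (W N : nat) t mu u,
  eigenbasis g c c lam e -> Rabs t <= T -> (2 <= W)%nat -> (W ^ 4 <= N)%nat ->
  gr g (c + t) (c - t) u (hscal mu u) -> ip u u = 1 ->
  Rabs (mu - c + g ^ 2 - INR N) <= 1 / 2 ->
  Rabs (mu - c + g ^ 2 - INR N) ^ 4 <= C / INR W.
Proof.
  intros Hg. destruct (parity_matrix_bound g Hg) as [C [HC HV]].
  (* The last three terms come from [uf] itself, from P [uf] seen near N, and from P [un] near N; 50
     is 2 * 5 * 5, with 5 from [inv_dist_sum_le] applied twice. The 1 keeps the constant positive
     when T = 0. *)
  exists (1 + T ^ 2 + 2 * T ^ 4 + 50 * T ^ 4 * C).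
  assert (HT2 := pow2_ge_0 T).
  assert (HT4 : 0 <= T ^ 4) by (replace (T ^ 4) with ((T ^ 2) ^ 2) by ring; apply pow2_ge_0).
  assert (HTC : 0 <= T ^ 4 * C) by (apply Rmult_le_pos; lra).
  split; [lra|].
  intros c lam e W N t mu u Hb Ht HW HN Hu Hn Hd.
  set (x := mu - c + g ^ 2) in *. set (d := Rabs (x - INR N)) in *.
  assert (Hd0 : 0 <= d) by apply Rabs_pos.
  set (w := INR W). assert (Hw : 2 <= w). { unfold w. change 2 with (INR 2). now apply le_INR. }
  (* Settled apart because the weights 1 / (k - x) are singular for d = 0. *)
  destruct (Req_dec d 0) as [Hd00|Hdne].
  { rewrite Hd00. replace (0 ^ 4) with 0 by ring. apply Rlt_le, Rdiv_lt_0_compat; lra. }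
  assert (Hdpos : 0 < d) by lra.
  assert (Ht2 : t ^ 2 <= T ^ 2).
  { rewrite <- (pow2_abs t). apply pow_incr. split; [apply Rabs_pos | exact Ht]. }
  assert (Ho := eb_orth _ _ _ _ _ Hb). assert (Hcm := eb_complete _ _ _ _ _ Hb).
  set (al := fun k => ip u (e k)). set (be := fun k => ip (par u) (e k)).
  assert (Hab : forall k, (x - INR k) * al k = t * be k).
  { intros k. assert (Hu0 : gr g c c u (hsub (hscal mu u) (hscal t (par u)))).
    { intros n. assert (H := Hu n). rewrite (jac_apply_diag_change g c c) in H. simpl in *.
      unfold psign. destruct (Nat.even n); lra. }
    assert (H := eigenbasis_coef _ _ _ _ _ _ _ k Hb Hu0). rewrite (lam_exact g c lam e Hb) in H.
    autorewrite with ip in H. fold (al k) (be k) in H. unfold x. lra. }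
  assert (Hab2 : forall k, (INR k - x) ^ 2 * al k ^ 2 <= T ^ 2 * be k ^ 2).
  { intros k. rewrite <- Rpow_mult_distr. replace ((INR k - x) * al k) with (- (t * be k)) by (rewrite <- Hab; ring).
    replace ((- (t * be k)) ^ 2) with (t ^ 2 * be k ^ 2) by ring.
    apply Rmult_le_compat_r; [apply pow2_ge_0 | exact Ht2]. }
  assert (Hdk : forall k, d <= Rabs (INR k - x)).
  { intros k. destruct (Nat.eq_dec k N) as [->|Hne].
    - unfold d. rewrite Rabs_minus_sym. lra.
    - destruct (dist_to_nat_ge N k x Hne Hd) as [H1 H2]. lra. }
  assert (Hdk2 : forall k, d ^ 2 <= (INR k - x) ^ 2).
  { intros k. rewrite <- (pow2_abs (INR k - x)). apply pow_incr. split; auto. }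
  assert (Hd2 : 0 < d ^ 2) by now apply pow_lt.
  set (nearb := fun k => andb (N <=? k + W)%nat (k <=? N + W)%nat).
  set (a := fun k => if nearb k then al k else 0).
  set (un := hsum a e (N + W)). set (uf := hsub u un).
  assert (Hunk : forall k, ip un (e k) = a k).
  { intros k. destruct (le_lt_dec k (N + W)) as [H|H].
    - unfold un. apply ip_hsum_e; auto.
    - unfold un. rewrite ip_hsum_l, (sum_n_eq _ (fun _ => 0)), sum_n_zero.
      + unfold a, nearb. replace (k <=? N + W)%nat with false by (symmetry; apply Nat.leb_gt; lia).
        now rewrite andb_false_r.
      + intros j Hj. rewrite (Ho k j k) by lia. destruct (Nat.eq_dec j k); [lia | ring]. }
  assert (Hfar : forall k, nearb k = false -> al k ^ 2 <= T ^ 2 / w ^ 2 * be k ^ 2).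
  { intros k Hk. assert (Hw2 : w <= Rabs (INR k - x)).
    { unfold nearb in Hk. apply andb_false_iff in Hk. rewrite !Nat.leb_gt in Hk.
      assert (Hkn : w + 1 <= Rabs (INR k - INR N)).
      { unfold w. rewrite <- S_INR. destruct Hk as [Hk|Hk].
        - rewrite Rabs_minus_sym, <- minus_INR, Rabs_pos_eq by (lia || apply pos_INR). apply le_INR. lia.
        - rewrite <- minus_INR, Rabs_pos_eq by (lia || apply pos_INR). apply le_INR. lia. }
      assert (H2 := Rabs_triang (INR k - x) (x - INR N)).
      replace (INR k - x + (x - INR N)) with (INR k - INR N) in H2 by ring. fold d in H2. lra. }
    replace (T ^ 2 / w ^ 2 * be k ^ 2) with (T ^ 2 * be k ^ 2 / w ^ 2) by (field; lra).
    apply sqr_le_of_mul; [apply pow_lt; lra|]. apply Rle_trans with (2 := Hab2 k).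
    apply Rmult_le_compat_r; [apply pow2_ge_0|]. rewrite <- (pow2_abs (INR k - x)). apply pow_incr. lra. }
  assert (Hw2pos : 0 <= T ^ 2 / w ^ 2).
  { apply Rmult_le_pos; auto. apply Rlt_le, Rinv_0_lt_compat, pow_lt. lra. }
  assert (Hbe1 : forall n, sum_n (fun k => be k ^ 2) n <= 1).
  { intros n. rewrite <- Hn, <- par_ip. apply bessel, Ho. }
  assert (Huf : ip uf uf <= T ^ 2 / w ^ 2).
  { rewrite <- (is_series_unique _ _ (parseval_sqr e Ho Hcm uf)).
    apply Series_le_bound; [intros; apply pow2_ge_0|]. intros n.
    apply Rle_trans with (sum_n (fun k => T ^ 2 / w ^ 2 * be k ^ 2) n).
    - apply sum_n_le. intros k _. unfold uf. rewrite ip_sub_l, Hunk. fold (al k). unfold a.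
      destruct (nearb k) eqn:Ek.
      + replace ((al k - al k) ^ 2) with 0 by ring. apply Rmult_le_pos; [auto | apply pow2_ge_0].
      + rewrite Rminus_0_r. now apply Hfar.
    - rewrite sum_n_scal. apply Rle_trans with (T ^ 2 / w ^ 2 * 1); [apply Rmult_le_compat_l; auto | lra]. }
  set (r := fun k => ip (par uf) (e k)).
  assert (Hr1 : forall n, sum_n (fun k => r k ^ 2) n <= T ^ 2 / w ^ 2).
  { intros n. apply Rle_trans with (2 := Huf). rewrite <- par_ip. apply bessel, Ho. }
  set (S := 5 / d ^ 2). assert (HSpos : 0 < S) by (apply Rdiv_lt_0_compat; lra).
  assert (HS : forall M, sum_n (fun k => / (INR k - x) ^ 2) M <= S).
  { intros M. apply inv_dist_sum_le. fold d. lra. }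
  assert (Hxk : forall k, INR k - x <> 0).
  { intros k H. specialize (Hdk k). rewrite H, Rabs_R0 in Hdk. lra. }
  (* Cauchy-Schwarz after inserting the weight k - x: the weighted coefficients of [un] have square
     sum at most T^2 by [Hab2], and the matrix entries divided by k - x have square sum at most (C /
     w) S. *)
  assert (Hnear : forall m, nearb m = true -> ip (par un) (e m) ^ 2 <= C / w * (T ^ 2 * S)).
  { intros m Hm. rewrite par_sym. unfold un. rewrite ip_hsum_l.
    apply Rle_trans with (sum_n (fun k => (a k * (INR k - x)) * (/ (INR k - x) * ip (e k) (par (e m)))) (N + W) ^ 2).
    { apply Req_le. f_equal. apply sum_n_eq. intros k _. rfield. apply Hxk. }
    assert (HCw : 0 <= C / w) by (apply Rlt_le, Rdiv_lt_0_compat; lra).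
    set (b := fun k => if nearb k then / (INR k - x) * ip (e k) (par (e m)) else 0).
    apply Rle_trans with (sum_n (fun k => (a k * (INR k - x)) * b k) (N + W) ^ 2).
    { apply Req_le. f_equal. apply sum_n_eq. intros k _. unfold b, a. destruct (nearb k); [reflexivity | ring]. }
    apply Rle_trans with (1 := sum_n_cauchy_schwarz _ _ _).
    replace (C / w * (T ^ 2 * S)) with (T ^ 2 * 1 * (C / w * S)) by ring.
    apply Rmult_le_compat; try (apply sum_n_nonneg; intros; apply pow2_ge_0).
    - apply Rle_trans with (sum_n (fun k => T ^ 2 * be k ^ 2) (N + W)).
      + apply sum_n_le. intros k _. unfold a. rewrite Rpow_mult_distr, Rmult_comm. destruct (nearb k).
        * apply Hab2.
        * replace ((INR k - x) ^ 2 * 0 ^ 2) with 0 by ring. apply Rmult_le_pos; [auto | apply pow2_ge_0].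
      + rewrite sum_n_scal. apply Rmult_le_compat_l; auto.
    - apply Rle_trans with (sum_n (fun k => C / w * / (INR k - x) ^ 2) (N + W)).
      + apply sum_n_le. intros k _. unfold b. destruct (nearb k) eqn:Ek.
        * rewrite Rpow_mult_distr, pow_inv, Rmult_comm. apply Rmult_le_compat_r.
          { apply Rlt_le, Rinv_0_lt_compat. specialize (Hdk2 k). lra. }
          unfold nearb in Hm, Ek. apply andb_true_iff in Hm, Ek. rewrite !Nat.leb_le in Hm, Ek.
          apply (HV c lam e W N k m); tauto.
        * replace (0 ^ 2) with 0 by ring. apply Rmult_le_pos; auto.
          apply Rlt_le, Rinv_0_lt_compat. specialize (Hdk2 k). lra.
      + rewrite sum_n_scal. apply Rmult_le_compat_l; auto. }
  (* Near N, the second division by (k - x)^2. It is kept as a sum against the [un] part, to be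
     summed by [HS], and replaced by its bound 1 / d^2 against the remainder [r]. *)
  assert (Hal : forall k, al k ^ 2 <= T ^ 2 / w ^ 2 * be k ^ 2 +
     (2 * T ^ 2 / d ^ 2 * r k ^ 2 + 2 * T ^ 2 * (C / w * (T ^ 2 * S)) * / (INR k - x) ^ 2)).
  { intros k.
    assert (P1 : 0 <= T ^ 2 / w ^ 2 * be k ^ 2) by (apply Rmult_le_pos; [auto | apply pow2_ge_0]).
    assert (Hik : 0 < / (INR k - x) ^ 2). { apply Rinv_0_lt_compat. specialize (Hdk2 k). lra. }
    assert (Hid : / (INR k - x) ^ 2 <= / d ^ 2) by (apply Rinv_le_contravar; auto).
    assert (HX : 0 <= C / w * (T ^ 2 * S)).
    { apply Rmult_le_pos; [apply Rlt_le, Rdiv_lt_0_compat; lra | apply Rmult_le_pos; lra]. }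
    assert (P3 : 0 <= 2 * T ^ 2 * (C / w * (T ^ 2 * S)) * / (INR k - x) ^ 2).
    { apply Rmult_le_pos; [apply Rmult_le_pos; lra | lra]. }
    assert (Hrk := pow2_ge_0 (r k)).
    assert (P2 : 0 <= 2 * T ^ 2 / d ^ 2 * r k ^ 2).
    { apply Rmult_le_pos; auto. apply Rmult_le_pos; [lra|]. now apply Rlt_le, Rinv_0_lt_compat. }
    destruct (nearb k) eqn:Ek.
    - assert (Hbk : be k ^ 2 <= 2 * (C / w * (T ^ 2 * S)) + 2 * r k ^ 2).
      { assert (E : be k = ip (par un) (e k) + r k).
        { unfold be, r, uf. rewrite !par_sym, ip_sub_l. ring. }
        rewrite E. assert (H1 := Hnear k Ek). assert (H2 := pow2_ge_0 (ip (par un) (e k) - r k)). lra. }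
      assert (H : al k ^ 2 <= (T ^ 2 * be k ^ 2) / (INR k - x) ^ 2).
      { apply sqr_le_of_mul; [specialize (Hdk2 k); lra | apply Hab2]. }
      apply Rle_trans with (1 := H).
      apply Rle_trans with (T ^ 2 * (2 * (C / w * (T ^ 2 * S)) + 2 * r k ^ 2) * / (INR k - x) ^ 2).
      + unfold Rdiv at 1. apply Rmult_le_compat_r; [lra|]. now apply Rmult_le_compat_l.
      + assert (H3 : 2 * T ^ 2 * r k ^ 2 * / (INR k - x) ^ 2 <= 2 * T ^ 2 * r k ^ 2 * / d ^ 2).
        { apply Rmult_le_compat_l; auto. apply Rmult_le_pos; [lra | auto]. }
        unfold Rdiv at 3. lra.
    - assert (H := Hfar k Ek). lra. }
  assert (Hone : 1 <= T ^ 2 / w ^ 2 * 1 + (2 * T ^ 2 / d ^ 2 * (T ^ 2 / w ^ 2) + 2 * T ^ 2 * (C / w * (T ^ 2 * S)) * S)).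
  { rewrite <- Hn at 1. rewrite <- (is_series_unique _ _ (parseval_sqr e Ho Hcm u)).
    apply Series_le_bound; [intros; apply pow2_ge_0|]. intros n.
    apply Rle_trans with (1 := sum_n_le _ _ n (fun k _ => Hal k)).
    rewrite !sum_n_add, !sum_n_scal.
    apply Rplus_le_compat; [|apply Rplus_le_compat]; apply Rmult_le_compat_l; auto.
    - apply Rmult_le_pos; [lra|]. now apply Rlt_le, Rinv_0_lt_compat.
    - apply Rmult_le_pos; [lra|]. apply Rmult_le_pos; [apply Rlt_le, Rdiv_lt_0_compat; lra | apply Rmult_le_pos; lra]. }
  assert (Hd4 : 0 < d ^ 4) by now apply pow_lt.
  (* The square of S = 5 / d^2 is the worst singularity on the right, and d^4 clears it. *)
  apply Rmult_le_compat_l with (r := d ^ 4) in Hone; [|lra]. rewrite Rmult_1_r in Hone.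
  apply Rle_trans with (1 := Hone).
  unfold S. replace (d ^ 4 * _) with (T ^ 2 * d ^ 4 / w ^ 2 + 2 * T ^ 4 * d ^ 2 / w ^ 2 + 50 * T ^ 4 * C / w)
    by (field; lra).
  assert (Hd2le : d ^ 2 <= 1) by nra. assert (Hd4le : d ^ 4 <= 1) by (replace (d ^ 4) with (d ^ 2 * d ^ 2) by ring; nra).
  assert (Hww : / w ^ 2 <= / w) by (apply Rinv_le_contravar; nra).
  assert (Hiw : 0 < / w) by (apply Rinv_0_lt_compat; lra).
  assert (Hiw2 : 0 < / w ^ 2) by (apply Rinv_0_lt_compat, pow_lt; lra).
  assert (Q1 : T ^ 2 * d ^ 4 / w ^ 2 <= T ^ 2 * / w).
  { unfold Rdiv. apply Rmult_le_compat; [apply Rmult_le_pos; lra | lra | | exact Hww]. nra. }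
  assert (Q2 : 2 * T ^ 4 * d ^ 2 / w ^ 2 <= 2 * T ^ 4 * / w).
  { unfold Rdiv. apply Rmult_le_compat; [apply Rmult_le_pos; lra | lra | | exact Hww]. nra. }
  unfold Rdiv in *. lra.
Qed.

Lemma fourth_root_nat (n : nat) : let W := Nat.sqrt (Nat.sqrt n) in
  (W ^ 4 <= n)%nat /\ (n <= (W + 1) ^ 4)%nat /\ forall W0, (W0 ^ 4 <= n)%nat -> (W0 <= W)%nat.
Proof.
  intros W.
  assert (H1 := Nat.sqrt_spec n ltac:(lia)). assert (H2 := Nat.sqrt_spec (Nat.sqrt n) ltac:(lia)).
  fold W in H2. set (s := Nat.sqrt n) in *.
  split; [|split].
  - replace (W ^ 4)%nat with ((W * W) * (W * W))%nat by (simpl; ring). nia.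
  - replace ((W + 1) ^ 4)%nat with (((W + 1) * (W + 1)) * ((W + 1) * (W + 1)))%nat by (simpl; ring). nia.
  - intros W0 H. apply (proj1 (Nat.sqrt_le_square s W0)), (proj1 (Nat.sqrt_le_square n (W0 * W0))).
    replace (W0 * W0 * (W0 * W0))%nat with (W0 ^ 4)%nat by (simpl; ring). exact H.
Qed.

(** With q = n^(1/16) and n <= (2 W)^4, the fourth power of the hypothesis gives (d q)^16 <= 16 C^4.
    A constant C' >= 1 exceeding 16 C^4 satisfies C' <= C'^16, so no further root has to be
    taken. *)
Lemma sixteenth_root_bound (C : R) (n W : nat) d : 0 < C -> 0 <= d -> (1 <= W)%nat -> (1 <= n)%nat ->
  (n <= (W + 1) ^ 4)%nat -> d ^ 4 <= C / INR W ->
  d <= (2 + 16 * C ^ 4) / Rpower (INR n) (1 / 16).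
Proof.
  intros HC Hd HW Hn HnW H.
  assert (Hnp : 0 < INR n) by (apply lt_0_INR; lia).
  assert (Hw : 1 <= INR W) by (rewrite <- INR_1; now apply le_INR).
  set (w := INR W) in *.
  set (q := Rpower (INR n) (1 / 16)). assert (Hq : 0 < q) by apply exp_pos.
  assert (Hq16 : q ^ 16 = INR n).
  { rewrite <- Rpower_pow by exact Hq. unfold q. rewrite Rpower_mult.
    replace (1 / 16 * INR 16) with 1 by (rewrite INR_IZR_INZ; simpl; field). now apply Rpower_1. }
  assert (HnW' : INR n <= (2 * w) ^ 4).
  { apply le_INR in HnW. rewrite pow_INR, plus_INR, INR_1 in HnW. fold w in HnW.
    apply Rle_trans with (1 := HnW). apply pow_incr. lra. }
  assert (Hd0 := pow_le d 4 Hd).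
  assert (HC4 : 0 < C ^ 4) by now apply pow_lt.
  assert (Hdq : (d * q) ^ 16 <= 16 * C ^ 4).
  { rewrite Rpow_mult_distr, Hq16. replace (d ^ 16) with ((d ^ 4) ^ 4) by ring.
    apply Rle_trans with ((C / w) ^ 4 * (2 * w) ^ 4).
    - apply Rmult_le_compat; [now apply pow_le | lra | | exact HnW']. apply pow_incr. split; auto.
    - apply Req_le. field. lra. }
  set (C' := 2 + 16 * C ^ 4) in *.
  assert (HC' : 1 <= C') by (unfold C'; lra).
  assert (Hle : d * q <= C').
  { apply Rnot_lt_le. intros Hlt.
    assert (H1 : C' ^ 16 <= (d * q) ^ 16) by (apply pow_incr; lra).
    assert (H2 : C' ^ 1 <= C' ^ 16) by (apply Rle_pow; [exact HC' | lia]).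
    rewrite pow_1 in H2. unfold C' in *. lra. }
  apply Rmult_le_reg_r with q; auto. unfold Rdiv. rewrite Rmult_assoc, Rinv_l, Rmult_1_r by lra. exact Hle.
Qed.

Lemma le_of_pow4 d b : 0 <= d -> 0 <= b -> d ^ 4 <= b ^ 4 -> d <= b.
Proof.
  intros Hd Hb H. apply Rnot_lt_le. intros Hlt.
  assert (b ^ 2 < d ^ 2) by nra. assert (0 <= b ^ 2) by nra.
  replace (d ^ 4) with (d ^ 2 * d ^ 2) in H by ring. replace (b ^ 4) with (b ^ 2 * b ^ 2) in H by ring. nra.
Qed.

Theorem theorem2 (g c1 c2 : R) (hg : g <> 0) :
  exists lam : nat -> R,
    (* eigenvalues enumerated in increasing order *)
    (forall n, lam n < lam (S n)) /\
    (* discrete spectrum: the spectrum is exactly {lam n}, each an eigenvalue,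
       with no finite accumulation point *)
    (forall mu, in_spectrum g c1 c2 mu <-> exists n, mu = lam n) /\
    (forall n, is_eigenvalue g c1 c2 (lam n)) /\
    is_lim_seq lam p_infty /\
    (* asymptotics *)
    exists C : R, exists N : nat, forall n : nat, (N <= n)%nat ->
      Rabs (lam n - (INR n - g ^ 2 + (c1 + c2) / 2))
        <= C / Rpower (INR n) (1 / 16).
Proof.
  set (c := (c1 + c2) / 2). set (d := (c1 - c2) / 2).
  assert (Hch : forall t, exists p : (nat -> R) * (nat -> ell2), eigenbasis g (c + t) (c - t) (fst p) (snd p)).
  { intros t. destruct (eigenbasis_ex g (c + t) (c - t) hg) as (lam & e & H). now exists (lam, e). }
  apply choice in Hch. destruct Hch as [p Hp].
  assert (Hb : eigenbasis g c1 c2 (fst (p d)) (snd (p d))).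
  { assert (H := Hp d). replace (c + d) with c1 in H by (unfold c, d; lra).
    replace (c - d) with c2 in H by (unfold c, d; lra). exact H. }
  exists (fst (p d)). split; [|split; [|split; [|split]]].
  - exact (eb_incr _ _ _ _ _ Hb).
  - intros mu. exact (eigenbasis_spectrum _ _ _ _ _ mu Hb).
  - intros n. exact (eigenbasis_eigenvalue _ _ _ _ _ n Hb).
  - exact (eb_lim _ _ _ _ _ Hb).
  - destruct (eigenvalue_localization g (Rabs d) hg) as (C & HC & Hloc).
    (* 256 = 4^4: for W > 256 C the localization gives distance at most 1/4. *)
    destruct (INR_unbounded (256 * C)) as [W0 HW0].
    (* The number of homotopy steps; each changes t by |d| / K <= 1/4. *)
    destruct (INR_unbounded (4 * Rabs d)) as [K HK].
    assert (Hb0 : eigenbasis g c c (fst (p 0)) (snd (p 0))).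
    { assert (H := Hp 0). now rewrite Rplus_0_r, Rminus_0_r in H. }
    assert (HKp : 0 < INR K) by (assert (H := Rabs_pos d); lra).
    exists (2 + 16 * C ^ 4), ((W0 + 2) ^ 4)%nat. intros n Hn.
    destruct (fourth_root_nat n) as (HW4 & HWn & HWmax).
    set (W := Nat.sqrt (Nat.sqrt n)) in *.
    assert (HW : (W0 + 2 <= W)%nat) by now apply HWmax.
    assert (HWR : INR W0 <= INR W) by (apply le_INR; lia).
    assert (HCW : C / INR W <= (1 / 4) ^ 4).
    { apply Rmult_le_reg_r with (INR W); [lra|]. unfold Rdiv at 1. rewrite Rmult_assoc, Rinv_l by lra. lra. }
    assert (Hstep : forall t, Rabs t <= Rabs d ->
      Rabs (fst (p t) n - (INR n - g ^ 2 + c)) <= 1 / 2 ->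
      Rabs (fst (p t) n - (INR n - g ^ 2 + c)) ^ 4 <= C / INR W).
    { intros t Ht. replace (fst (p t) n - (INR n - g ^ 2 + c)) with (fst (p t) n - c + g ^ 2 - INR n) by ring.
      apply (Hloc c _ _ W n t (fst (p t) n) (snd (p t) n) Hb0 Ht); auto; [lia | apply (eb_gr _ _ _ _ _ (Hp t)) |].
      rewrite (eb_orth _ _ _ _ _ (Hp t) n) by auto. destruct (Nat.eq_dec n n); [reflexivity | lia]. }
    (* Induction along the grid from the exact value at t = 0. One step costs at most 1/4 by
       [eigenvalue_monotone] in both directions, so the distance is at most 1/2 and [Hstep] reduces
       it to 1/4 again. *)
    assert (Hhom : forall i, (i <= K)%nat ->
      Rabs (fst (p (INR i / INR K * d)) n - (INR n - g ^ 2 + c)) <= 1 / 4).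
    { induction i as [|i IH]; intros Hi.
      - rewrite INR_0. replace (0 / INR K * d) with 0 by (field; lra).
        rewrite (lam_exact g c _ _ Hb0), Rminus_diag, Rabs_R0. lra.
      - specialize (IH ltac:(lia)). set (t := INR i / INR K * d) in *. set (t' := INR (S i) / INR K * d).
        assert (Htt : Rabs (t' - t) <= 1 / 4).
        { unfold t', t. replace (INR (S i) / INR K * d - INR i / INR K * d) with (d / INR K) by (rewrite S_INR; field; lra).
          unfold Rdiv. rewrite Rabs_mult, Rabs_inv, (Rabs_pos_eq (INR K)) by lra.
          apply Rmult_le_reg_r with (INR K); auto. rewrite Rmult_assoc, Rinv_l by lra. lra. }
        apply Rabs_le_between in Htt.
        assert (M1 := eigenvalue_monotone _ _ _ _ _ _ _ _ _ (1 / 4) n (Hp t) (Hp t') ltac:(lra) ltac:(lra)).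
        assert (M2 := eigenvalue_monotone _ _ _ _ _ _ _ _ _ (1 / 4) n (Hp t') (Hp t) ltac:(lra) ltac:(lra)).
        apply le_of_pow4; [apply Rabs_pos | lra|]. apply Rle_trans with (2 := HCW). apply Hstep.
        + unfold t'. rewrite Rabs_mult. rewrite <- (Rmult_1_l (Rabs d)) at 2.
          apply Rmult_le_compat_r; [apply Rabs_pos|].
          assert (INR (S i) <= INR K) by now apply le_INR.
          assert (HiK := pos_INR (S i)).
          rewrite Rabs_pos_eq by (apply Rmult_le_pos; [lra | now apply Rlt_le, Rinv_0_lt_compat]).
          apply Rmult_le_reg_r with (INR K); auto. unfold Rdiv. rewrite Rmult_assoc, Rinv_l by lra. lra.
        + apply Rabs_le_between in IH. apply Rabs_le. lra. }
    assert (Hfin := Hhom K (le_n _)). replace (INR K / INR K * d) with d in Hfin by (field; lra).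
    apply sixteenth_root_bound with (W := W); auto; [apply Rabs_pos | lia | |].
    + assert ((W0 + 2) ^ 4 <> 0)%nat by (apply Nat.pow_nonzero; lia). lia.
    + apply Hstep; [apply Rle_refl | lra].
Qed.
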